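(* Let $X$ satisfy AI and AII, let $x>0$, let $T_u>0$, and suppose that T2 holds: $\lim_{u\to\infty}\frac{T_u-t_u}{u^{\alpha_\infty}}=\omega\in(-\infty,\infty]$. Then, as $u\to\infty$: (i) If $\alpha_\infty<1/2$ and $\lim_{u\to\infty}\frac{T_u-t_u}{\sqrt u}=\vartheta\in[0,\infty]$, then $$\pi_{x,T_u}(u)\sim\begin{cases}\Psi\left(\frac{u-x+cT_u}{\sigma(T_u)}\right),&\text{if }\vartheta<\sqrt{\frac{2A}{B}(1-\alpha_\infty)x},\\[1mm]\Psi\left(\frac{u-x+cT_u}{\sigma(T_u)}\right)+\pi_{0,T_u}(u),&\text{if }\vartheta=\sqrt{\frac{2A}{B}(1-\alpha_\infty)x},\\[1mm]\pi_{0,T_u}(u),&\text{if }\vartheta>\sqrt{\frac{2A}{B}(1-\alpha_\infty)x}.\end{cases}$$ (ii) If $\alpha_\infty\ge1/2$, then $$\pi_{x,T_u}(u)\sim\pi_{0,T_u}(u).$$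
   Context: $\{X(t),t\ge0\}$ is a centered Gaussian process with stationary increments, continuous sample paths, $X(0)=0$ a.s., and variance function $\sigma^2(t)=\mathrm{Var}(X(t))$; $c>0$ is a constant. AI: $\sigma^2(t)\sim A_\infty t^{2\alpha_\infty}$ as $t\to\infty$ with $A_\infty>0$, $\alpha_\infty\in(0,1)$; further, $\sigma^2$ is twice continuously differentiable on $(0,\infty)$ and its first and second derivatives are ultimately monotone at $\infty$ (i.e. monotone on some $[t_0,\infty)$). AII: $\sigma^2(t)\sim A_0t^{2\alpha_0}$ as $t\to0$ with $A_0>0$, $\alpha_0\in(0,1]$. For $x\ge0$ the queue process with $Q(0)=x$ is $Q(t)=\max\left(x+X(t)-ct,\ \sup_{0\le s\le t}(X(t)-X(s)-c(t-s))\right)$, $t\ge0$, and $\pi_{x,T_u}(u)=\mathbb P(Q(T_u)>u)$; $\pi_{0,T_u}(u)$ is the same quantity for $x=0$. Notation: $f(u)\sim g(u)$ means $\lim_{u\to\infty} f(u)/g(u)=1$. $\Psi$ is the tail distribution function of a standard Gaussian variable. $m(u,t)=\frac{u+ct}{\sigma(t)}$; $t_u=\arg\min_{t\ge0}m(u,t)$ (unique for all large $u$). Further $$A=\left(\frac{\alpha_\infty}{c(1-\alpha_\infty)}\right)^{-\alpha_\infty}\frac1{1-\alpha_\infty},\qquad B=\left(\frac{\alpha_\infty}{c(1-\alpha_\infty)}\right)^{-\alpha_\infty-2}\alpha_\infty.$$ *)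

(* Defs.v *)
From HB Require Import structures.
From mathcomp Require Import all_boot all_order all_algebra.
From mathcomp Require Import all_classical all_reals all_analysis.

Set Implicit Arguments.
Unset Strict Implicit.
Unset Printing Implicit Defensive.

Import Order.TTheory GRing.Theory Num.Theory.
Import numFieldNormedType.Exports.

Local Open Scope classical_set_scope.
Local Open Scope ring_scope.

(* A process indexed by [0, +oo[ is a family X : R -> {RV P >-> R} of which
   only the members X t with 0 <= t are ever constrained or used. *)

Section Processes.
Context {d : measure_display} {Omega : measurableType d} {R : realType}.
Variable P : probability Omega R.
Implicit Types (X : R -> {RV P >-> R}) (Y Z : R -> Omega -> R).

(* The degenerate case is separate because normal_prob m 0 is, by convention,
   not a point mass. *)
Definition gaussian_rv (Y : Omega -> R) : Prop :=
  (exists m : R, forall S : set R, measurable S ->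
     pushforward P Y S = \d_m S) \/
  (exists m s : R, 0 < s /\ forall S : set R, measurable S ->
     pushforward P Y S = normal_prob m s S).

Definition gaussian_process X : Prop :=
  forall (n : nat) (t a : 'I_n -> R), (forall i, 0 <= t i) ->
    gaussian_rv (fun w => \sum_(i < n) a i * X (t i) w).

Definition centered X : Prop := forall t, 0 <= t -> ('E_P[X t] = 0)%E.

Definition same_fdd Y Z : Prop :=
  forall (n : nat) (t : 'I_n -> R), (forall i, 0 <= t i) ->
  forall S : set (n.-tuple R), measurable S ->
    P [set w | S [tuple Y (t i) w | i < n]] =
    P [set w | S [tuple Z (t i) w | i < n]].

Definition stationary_increments X : Prop :=
  forall h, 0 <= h ->
    same_fdd (fun t w => X (h + t) w - X h w) (fun t w => X t w - X 0 w).

Definition continuous_paths X : Prop :=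
  forall w, {within [set t : R | 0 <= t], continuous (fun t : R => X t w : R)}.

Record centered_gaussian_si X : Prop := CenteredGaussianSI {
  cgsi_gaussian : gaussian_process X;
  cgsi_centered : centered X;
  cgsi_stationary : stationary_increments X;
  cgsi_continuous : continuous_paths X;
  cgsi_start : {ae P, forall w, X 0 w = 0}
}.

Definition sigma2 X (t : R) : R := fine 'V_P[X t].

Definition sigma X (t : R) : R := Num.sqrt (sigma2 X t).

(* For continuous paths the supremum is that of a bounded nonempty set, so the
   real-valued sup is the genuine one. *)
Definition Q X (c x t : R) (w : Omega) : R :=
  Num.max (x + X t w - c * t)
    (sup [set X t w - X s w - c * (t - s) | s in `[0, t]]).

(* pi x t u = P (Q(t) > u) for the queue started at x. *)
Definition pi_queue X (c x t u : R) : R := fine (P [set w | u < Q X c x t w]).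

(* (u + c t) / sigma(t), with value +oo where sigma vanishes (at t = 0),
   rather than the value 0 given by division by zero in R. *)
Definition m_ratio X (c u t : R) : \bar R :=
  if sigma X t == 0 then +oo%E else ((u + c * t) / sigma X t)%:E.

Definition is_argmin X (c u t : R) : Prop :=
  0 <= t /\ forall s, 0 <= s -> (m_ratio X c u t <= m_ratio X c u s)%E.

(* The minimiser is unique for all large u; when none exists the value 0 is
   used. *)
Definition t_opt X (c u : R) : R := xget 0 [set t | is_argmin X c u t].

End Processes.

Section Asymptotics.
Context {R : realType}.
Implicit Types f g : R -> R.

(* As z / 0 = 0 in R, this forces g to be eventually nonzero. *)
Definition asymp_eq (F : set_system R) f g : Prop := f u / g u @[u --> F] --> (1 : R).

Definition asymp_eq_infty f g : Prop := asymp_eq (+oo : set_system R) f g.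

Definition ultimately_monotone f : Prop :=
  exists t0 : R, {in `[t0, +oo[ &, {homo f : s t / s <= t}} \/
                 {in `[t0, +oo[ &, {homo f : s t /~ s <= t}}.

Definition C2_pos f : Prop :=
  forall t : R, 0 < t ->
    [/\ derivable f t 1, derivable (derive1 f) t 1 & {for t, continuous (derive1 (derive1 f))}].

Record AI f (Ainf alphainf : R) : Prop := MkAI {
  AI_A_gt0 : 0 < Ainf;
  AI_alpha_bounds : 0 < alphainf < 1;
  AI_equiv : asymp_eq_infty f (fun t => Ainf * t `^ (2 * alphainf));
  AI_C2 : C2_pos f;
  AI_mono1 : ultimately_monotone (derive1 f);
  AI_mono2 : ultimately_monotone (derive1 (derive1 f))
}.

Record AII f (A0 alpha0 : R) : Prop := MkAII {
  AII_A_gt0 : 0 < A0;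
  AII_alpha_bounds : 0 < alpha0 <= 1;
  AII_equiv : asymp_eq 0^'+ f (fun t => A0 * t `^ (2 * alpha0))
}.

Definition Psi (z : R) : R := fine (normal_prob 0 1 `]z, +oo[).

Definition constA (c alpha : R) : R :=
  (alpha / (c * (1 - alpha))) `^ (- alpha) * (1 - alpha)^-1.

Definition constB (c alpha : R) : R :=
  (alpha / (c * (1 - alpha))) `^ (- alpha - 2) * alpha.

Definition threshold (c alpha x : R) : R :=
  Num.sqrt (2 * constA c alpha / constB c alpha * (1 - alpha) * x).

End Asymptotics.

(* Main.v *)
(* Let Z_v = X_T - X_(T - v). Then pi_0 is the probability that Z_v - c v exceeds u
   for some v <= T, and pi_x adds to this event the level event X_T - c T > u - x.
   The Gaussian exponent (u + c v)^2 / sigma^2(v) is minimal at t_u ~ tau u; with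
   a = alpha_oo, a second-order Taylor expansion of its logarithm (the derivatives
   of sigma^2 are controlled by the monotone density theorem) shows that at
   distance th sqrt u from t_u it exceeds its minimum by (G0 k0 / 2) th^2
   u^(1 - 2 a), whereas lowering the level by x decreases it by
   2 G0 (1 - a) x u^(1 - 2 a).
   If a < 1/2, these corrections beat all polynomial factors, in particular the one
   lost in a chaining bound for the supremum (this is where the behaviour of
   sigma^2 at 0 enters), so their comparison decides which event dominates. At the
   threshold both matter, and they are asymptotically disjoint because near-optimal
   v are at distance of order sqrt u from T, so that Z_v and Z_T are not
   perfectly correlated.
   If a >= 1/2, lowering the level costs only a bounded factor, while for every N
   the supremum collects N almost disjoint events as likely as the level event. *)
Require Import Defs.
From HB Require Import structures.
From mathcomp Require Import all_boot all_order all_algebra.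
From mathcomp Require Import all_classical all_reals all_analysis.
From mathcomp Require Import measurable_realfun ring lra.

Set Implicit Arguments.
Unset Strict Implicit.
Unset Printing Implicit Defensive.

Import Order.TTheory GRing.Theory Num.Theory.
Import numFieldNormedType.Exports.

Local Open Scope classical_set_scope.
Local Open Scope ring_scope.

(** AI fixes sigma^2 only up to a factor 1 + o(1), so the approximation G0 u^(2 - 2 a) of the
    minimal exponent carries an error that may far exceed the corrections of order u^(1 - 2 a) to be
    compared. Hence every exponent is measured against the exact minimum [minsq u], attained at t_u:
    the first-order term vanishes there, and the second-order term is needed only to leading order.
    Estimates have the form f v * L <= z^2, which gives the tail at z of a centered Gaussian of
    variance f v an exponent of at least L, and which keeps its meaning when f v = 0. The sharp
    order of pi_0 is never computed. For a < 1/2, bounds that differ by a polynomial factor suffice,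
    so a dyadic net and a union bound control the supremum; passing to the net lowers u by a small
    eps, at a cost proportional to eps u^(1 - 2 a). Near disjointness comes from the sum of two
    increments with a common endpoint: its variance has a deficit of order sigma^2(w - v), which
    dominates (sigma(w) - sigma(v))^2 when w - v is small relative to u, because a < 1. *)

Section NormalDensity.

(** * Moments and tail bounds of the normal density *)

Context {R : realType}.
Notation mu := (@lebesgue_measure R).
Local Notation phi := (@normal_pdf R 0 1).
Implicit Types m s z : R.

Lemma measurable_normal_pdf_EFin m s (A : set R) :
  measurable_fun A (fun x => (normal_pdf m s x)%:E).
Proof. by apply/measurable_EFinP; apply: measurable_funTS; exact: measurable_normal_pdf. Qed.

Lemma cvg_inv_pinfty : x^-1 @[x --> +oo] --> (0 : R).
Proof. by apply/gtr0_cvgV0; [exact: nbhs_pinfty_gt|exact: cvg_id]. Qed.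

(** The change of variables yields the Radon-Nikodym derivative, which agrees with [normal_pdf] only
    almost everywhere: both integrate to the measure of every measurable set. *)
Lemma integral_normal_prob m s (g : R -> \bar R) (E : set R) :
  (forall y, 0 <= g y)%E -> measurable E -> measurable_fun setT g ->
  (\int[normal_prob m s]_(y in E) g y =
   \int[mu]_(y in E) (g y * (normal_pdf m s y)%:E))%E.
Proof.
move=> g0 mE mg.
have dom := normal_prob_dominates m s.
rewrite -(Radon_Nikodym_SigmaFinite.change_of_variables dom)//; last first.
  exact: measurable_funTS.
have mf := measurable_int _ (Radon_Nikodym_SigmaFinite.f_integrable dom).
have mp := @measurable_normal_pdf_EFin m s setT.
apply: ae_eq_integral => //.
- by apply: measurable_funTS; apply: emeasurable_funM.
- by apply: measurable_funTS; apply: emeasurable_funM.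
- apply: ae_eqe_mul2l; apply: integral_ae_eq => //.
  + apply: (integrableS _ _ (@subsetT _ _)) => //.
    exact: Radon_Nikodym_SigmaFinite.f_integrable.
  + exact: measurable_funTS.
  + by move=> A AE mA; rewrite -Radon_Nikodym_SigmaFinite.f_integral.
Qed.

Lemma normal_pdf01E (x : R) :
  phi x = normal_peak 1 * expR (- (x ^+ 2 / 2)).
Proof.
by rewrite normal_pdfE ?oner_neq0// /normal_fun subr0 expr1n mulNr.
Qed.

Lemma normal_peak1_gt0 : 0 < normal_peak (1 : R).
Proof. by rewrite normal_peak_gt0// oner_neq0. Qed.

Lemma normal_peak1_le1 : normal_peak (1 : R) <= 1.
Proof.
rewrite /normal_peak expr1n mul1r invf_le1; last first.
  by rewrite sqrtr_gt0 mulrn_wgt0// pi_gt0.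
rewrite -[leLHS]sqrtr1; apply: ler_wsqrtr.
by have := @pi_ge2 R; rewrite -mulr_natl; lra.
Qed.

Lemma is_derive_normal_pdf01 (x : R) :
  is_derive x 1 phi (- x * phi x).
Proof.
have -> : phi = (fun x : R => normal_peak 1 * expR (- (x ^+ 2 / 2))).
  by apply/funext => y; exact: normal_pdf01E.
apply: is_derive_eq.
rewrite !scaler0 add0r /GRing.scale/= !mulr1; lra.
Qed.

Lemma expRN_sqr_le (x : R) : expR (- (x ^+ 2 / 2)) <= 2 / (1 + x ^+ 2).
Proof.
have h0 := sqr_ge0 x; have h1 := expR_ge1Dx (x ^+ 2 / 2).
have h2 : 0 < 1 + x ^+ 2 by lra.
by rewrite expRN ler_pdivlMr// ler_pdivrMl ?expR_gt0//; lra.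
Qed.

Lemma cvg_normal_pdf01 : phi x @[x --> +oo] --> (0 : R).
Proof.
have h : (fun x : R => expR (- x) * expR 1) x @[x --> +oo] --> (0 : R).
  rewrite -[X in _ --> X](mul0r (expR 1)).
  by apply: cvgMl; exact: cvgr_expR.
apply: (squeeze_cvgr _ (cvg_cst 0) h); near=> x.
rewrite normal_pdf_ge0/= normal_pdf01E -expRD.
apply: (@le_trans _ _ (1 * expR (- (x ^+ 2 / 2)))).
  by rewrite ler_pM2r ?expR_gt0// normal_peak1_le1.
by rewrite mul1r ler_expR; nra.
Unshelve. all: by end_near. Qed.

Lemma cvg_Mnormal_pdf01 : (x * phi x) @[x --> +oo] --> (0 : R).
Proof.
have h : (fun x : R => 2 * x^-1) x @[x --> +oo] --> (0 : R).
  rewrite -[X in _ --> X](mulr0 2).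
  by apply: cvgMl_tmp; exact: cvg_inv_pinfty.
apply: (squeeze_cvgr _ (cvg_cst 0) h); near=> x.
have x0 : 0 < x by [].
rewrite mulr_ge0 ?normal_pdf_ge0 ?(ltW x0)//= normal_pdf01E.
have h1 := expRN_sqr_le x.
have h2 := normal_peak1_le1; have h3 := normal_peak1_gt0.
have h4 : x * (2 / (1 + x ^+ 2)) <= 2 * x^-1.
  rewrite mulrCA ler_pM2l// ler_pdivrMr; last by rewrite ltr_pwDl// sqr_ge0.
  by rewrite mulrDr mulr1 expr2 mulKf ?gt_eqF// lerDr invr_ge0 ltW.
apply: le_trans h4; rewrite ler_pM2l//; apply: le_trans h1.
by rewrite ger_pMl// expR_gt0.
Unshelve. all: by end_near. Qed.

Lemma continuous_normal_pdf01 : continuous (phi : R -> R).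
Proof. by apply: continuous_normal_pdf; rewrite oner_neq0. Qed.

Lemma normal_pdf01N (x : R) : phi (- x) = phi x.
Proof. by rewrite !normal_pdf01E sqrrN. Qed.

Lemma integral_Mnormal_pdf01 (z : R) : 0 <= z ->
  (\int[mu]_(x in `[z, +oo[) (x * phi x)%:E = (phi z)%:E)%E.
Proof.
move=> z0.
rewrite (@ge0_continuous_FTC2y _ (fun x : R => x * phi x) (fun x : R => - phi x) z 0).
- by rewrite sub0e -EFinN opprK.
- by move=> x zx; rewrite mulr_ge0 ?normal_pdf_ge0// (le_trans z0).
- apply: continuous_subspaceT => x.
  by apply: continuousM; [exact: cvg_id|exact: continuous_normal_pdf01].
- by rewrite -[X in _ --> X]oppr0; apply: (@cvgN _ R^o); exact: cvg_normal_pdf01.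
- by move=> x _; apply: derivableN; apply: ex_derive; exact: is_derive_normal_pdf01.
- apply: cvg_at_right_filter; apply: (@cvgN _ R^o); exact: continuous_normal_pdf01.
- move=> x _; rewrite derive1E deriveN; last first.
    by apply: ex_derive; exact: is_derive_normal_pdf01.
  by rewrite (@derive_val _ _ _ _ _ _ _ (is_derive_normal_pdf01 x)) mulNr opprK.
Qed.

Lemma is_derive_Mnormal_pdf01 (x : R) :
  is_derive x 1 (fun y => y * phi y) ((1 - x ^+ 2) * phi x).
Proof.
have h := is_derive_normal_pdf01 x.
by apply: is_derive_eq; rewrite /GRing.scale/= mulr1; ring.
Qed.

Lemma continuous_sqrB1 : continuous (fun x : R => x ^+ 2 - 1).
Proof. by move=> x; apply: (@cvgB _ R^o); [exact: exprn_continuous|exact: cvg_cst]. Qed.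

Lemma continuous_onemsqr : continuous (fun x : R => 1 - x ^+ 2).
Proof. by move=> x; apply: (@cvgB _ R^o); [exact: cvg_cst|exact: exprn_continuous]. Qed.

(** A primitive is [- (x * phi x)]. The half-line is cut at 1, where [x ^+ 2 - 1] changes sign, so
    that the fundamental theorem on an unbounded interval meets a nonnegative integrand. *)
Lemma integral_sqrB1_normal_pdf01 :
  (\int[mu]_(x in `[1%R, +oo[) ((x ^+ 2 - 1) * phi x)%:E =
   (phi 1)%:E)%E.
Proof.
rewrite (@ge0_continuous_FTC2y _ (fun x : R => (x ^+ 2 - 1) * phi x) (fun x : R => - (x * phi x)) 1 0).
- by rewrite sub0e -EFinN opprK mul1r.
- by move=> x zx; rewrite mulr_ge0 ?normal_pdf_ge0// subr_ge0; nra.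
- apply: continuous_subspaceT => x.
  by apply: cvgM; [exact: continuous_sqrB1|exact: continuous_normal_pdf01].
- by rewrite -[X in _ --> X]oppr0; apply: (@cvgN _ R^o); exact: cvg_Mnormal_pdf01.
- by move=> x _; apply: derivableN; apply: ex_derive; exact: is_derive_Mnormal_pdf01.
- apply: cvg_at_right_filter; apply: (@cvgN _ R^o); apply: cvgM; first exact: cvg_id.
  exact: continuous_normal_pdf01.
- move=> x _; rewrite derive1E deriveN; last first.
    by apply: ex_derive; exact: is_derive_Mnormal_pdf01.
  by rewrite (@derive_val _ _ _ _ _ _ _ (is_derive_Mnormal_pdf01 x)); ring.
Qed.

Lemma integral_onemsqr_normal_pdf01 :
  (\int[mu]_(x in `[0%R, 1%R]) ((1 - x ^+ 2) * phi x)%:E =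
   (phi 1)%:E)%E.
Proof.
rewrite (@continuous_FTC2 _ (fun x : R => (1 - x ^+ 2) * phi x) (fun x : R => x * phi x)) ?ltr01//.
- by rewrite mul1r mul0r sube0.
- apply: continuous_subspaceT => x.
  by apply: cvgM; [exact: continuous_onemsqr|exact: continuous_normal_pdf01].
- split.
  + by move=> x _; apply: ex_derive; exact: is_derive_Mnormal_pdf01.
  + apply: cvg_at_right_filter; apply: cvgM; first exact: cvg_id.
    exact: continuous_normal_pdf01.
  + apply: cvg_at_left_filter; apply: cvgM; first exact: cvg_id.
    exact: continuous_normal_pdf01.
- move=> x _; rewrite derive1E.
  by rewrite (@derive_val _ _ _ _ _ _ _ (is_derive_Mnormal_pdf01 x)).
Qed.

Lemma measurable_normal_pdf01M (A : set R) (f : R -> R) : continuous f ->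
  measurable_fun A (fun x => (f x * phi x)%:E).
Proof.
move=> cf; apply/measurable_EFinP; apply: measurable_funTS.
apply: measurable_funM; first exact: continuous_measurable_fun.
exact: measurable_normal_pdf.
Qed.

(** Replacing phi by x^2 phi loses [phi 1] on [0, 1] and gains [phi 1] on [1, +oo[, so the two
    changes cancel. *)
Lemma integral_sqr_normal_pdf01_half :
  (\int[mu]_(x in `[0%R, +oo[) (x ^+ 2 * phi x)%:E =
   \int[mu]_(x in `[0%R, +oo[) (phi x)%:E)%E.
Proof.
have m1 := measurable_normal_pdf_EFin 0 1.
have m2 A : measurable_fun A (fun x : R => (x ^+ 2 * phi x)%:E).
  by apply: measurable_normal_pdf01M; exact: exprn_continuous.
have m3 A : measurable_fun A (fun x : R => ((1 - x ^+ 2) * phi x)%:E).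
  by apply: measurable_normal_pdf01M; exact: continuous_onemsqr.
have m4 A : measurable_fun A (fun x : R => ((x ^+ 2 - 1) * phi x)%:E).
  by apply: measurable_normal_pdf01M; exact: continuous_sqrB1.
have -> : `[0%R, +oo[%classic = `[0%R, 1%R] `|` `]1%R, +oo[%classic :> set R.
  by rewrite -itv_bndbnd_setU// bnd_simp ?ler01.
have dj : [disjoint `[0%R, 1%R]%classic & `]1%R, +oo[%classic :> set R].
  apply/disj_setPS => x [] /=; rewrite !in_itv/= andbT => /andP[_ h1] h2.
  by move: (lt_le_trans h2 h1); rewrite ltxx.
have p0 x : (0 <= (phi x)%:E :> \bar R)%E by rewrite lee_fin normal_pdf_ge0.
have p2 (x : R) : (0 <= (x ^+ 2 * phi x)%:E :> \bar R)%E.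
  by rewrite lee_fin mulr_ge0 ?normal_pdf_ge0 ?sqr_ge0.
rewrite !ge0_integral_setU//; [|exact: m1|exact: m2].
rewrite [X in (_ + X = _)%E](@integral_itv_obnd_cbnd _ 1 _ (fun x : R => (x ^+ 2 * phi x)%:E))//.
rewrite [X in (_ = _ + X)%E](@integral_itv_obnd_cbnd _ 1 _ (fun x : R => (phi x)%:E))//.
have -> : (\int[mu]_(x in `[0%R, 1%R]) (phi x)%:E =
   \int[mu]_(x in `[0%R, 1%R]) (x ^+ 2 * phi x)%:E +
   (phi 1)%:E)%E.
  rewrite -integral_onemsqr_normal_pdf01 -ge0_integralD//; [|exact: m2| |exact: m3]; last first.
    move=> x /=; rewrite in_itv/= => /andP[x0 x1].
    by rewrite lee_fin mulr_ge0 ?normal_pdf_ge0// subr_ge0; nra.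
  by apply: eq_integral => x _; rewrite -EFinD; congr EFin; ring.
have -> : (\int[mu]_(x in `[1%R, +oo[) (x ^+ 2 * phi x)%:E =
   (phi 1)%:E + \int[mu]_(x in `[1%R, +oo[) (phi x)%:E)%E.
  rewrite -integral_sqrB1_normal_pdf01 -ge0_integralD//; [| |exact: m4|exact: m1]; last first.
    move=> x /=; rewrite in_itv/= andbT => x1.
    by rewrite lee_fin mulr_ge0 ?normal_pdf_ge0// subr_ge0; nra.
  by apply: eq_integral => x _; rewrite -EFinD; congr EFin; ring.
by rewrite addeA.
Qed.

Lemma integral_sqr_normal_pdf01 :
  (\int[mu]_x (x ^+ 2 * phi x)%:E = 1)%E.
Proof.
rewrite ge0_symfun_integralT; last 3 first.
- by move=> x; rewrite mulr_ge0 ?normal_pdf_ge0 ?sqr_ge0.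
- by move=> x; apply: cvgM; [exact: exprn_continuous|exact: continuous_normal_pdf01].
- by move=> x /=; rewrite sqrrN normal_pdf01N.
rewrite -set_itvcy integral_sqr_normal_pdf01_half set_itvcy.
rewrite -(@ge0_symfun_integralT _ phi) ?integral_normal_pdf//.
- by move=> x; exact: normal_pdf_ge0.
- exact: continuous_normal_pdf01.
- by move=> x /=; rewrite normal_pdf01N.
Qed.

Lemma normal_pdf_affine m s (y : R) : 0 < s ->
  normal_pdf m s (s * y + m) * s = phi y.
Proof.
move=> s0; rewrite !normal_pdfE ?oner_neq0 ?gt_eqF// /normal_fun addrK subr0 expr1n.
rewrite [in LHS]mulrAC; congr (_ * expR _).
  rewrite /normal_peak expr1n mul1r -mulrnAr sqrtrM ?sqr_ge0// sqrtr_sqr gtr0_norm//.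
  by rewrite invfM mulrAC mulVf ?mul1r// gt_eqF.
rewrite exprMn -mulr_natr; field.
by rewrite gt_eqF.
Qed.

Lemma is_derive_affine s m (x : R) : is_derive x 1 (fun y : R => s * y + m) s.
Proof. by apply: is_derive_eq; rewrite /GRing.scale/= mulr1 addr0. Qed.

Lemma derive1_affine s m : (fun y : R => s * y + m)^`()%classic = cst s.
Proof.
apply/funext => x; rewrite derive1E.
by rewrite (@derive_val _ _ _ _ _ _ _ (is_derive_affine s m x)).
Qed.

Lemma continuous_affine s m : continuous (fun y : R => s * y + m).
Proof.
move=> x; apply/differentiable_continuous/derivable1_diffP.
by apply: ex_derive; exact: is_derive_affine.
Qed.

Lemma integral_normal_pdf_affine m s (g : R -> R) : 0 < s ->
  continuous g -> (forall x, 0 <= g x) ->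
  (\int[mu]_x (g x * normal_pdf m s x)%:E =
   \int[mu]_y (g (s * y + m) * phi y)%:E)%E.
Proof.
move=> s0 cg g0.
rewrite (@increasing_ge0_integration_by_substitutionT _ (fun y => s * y + m)
  (fun x => g x * normal_pdf m s x)).
- apply: eq_integral => y _; rewrite derive1_affine !fctE/= -mulrA.
  by rewrite [X in _ * X]normal_pdf_affine.
- by move=> x y xy; rewrite ltrD2r ltr_pM2l.
- by rewrite derive1_affine => x; exact: cvg_cst.
- by rewrite derive1_affine; exact: is_cvg_cst.
- by rewrite derive1_affine; exact: is_cvg_cst.
- by move=> x; apply: ex_derive; exact: is_derive_affine.
- apply: (cvg_comp (fun y : R => s * y) (fun y => y + m)); last exact: cvg_addrr_Ny.
  by apply: gt0_cvgMrNy => //; exact: cvg_id.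
- apply: (cvg_comp (fun y : R => s * y) (fun y => y + m)); last exact: cvg_addrr.
  by apply: gt0_cvgMry => //; exact: cvg_id.
- move=> x; apply: cvgM; first exact: cg.
  by apply: continuous_normal_pdf; rewrite gt_eqF.
- by move=> x; rewrite mulr_ge0// normal_pdf_ge0.
Qed.

Lemma normal_prob_tail s z : 0 < s ->
  normal_prob 0 s `]z, +oo[ = normal_prob 0 1 `]z / s, +oo[.
Proof.
move=> s0; rewrite /normal_prob.
have mp := measurable_normal_pdf_EFin 0.
rewrite !integral_itv_obnd_cbnd//.
have -> : z = s * (z / s) + 0 by rewrite addr0 mulrCA divff ?mulr1 ?gt_eqF.
rewrite (@increasing_ge0_integration_by_substitutiony _ (fun y => s * y + 0)
  (fun x => normal_pdf 0 s x)).
- rewrite addr0 [s * (z / s)]mulrCA divff ?mulr1 ?gt_eqF//.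
  apply: eq_integral => y _; rewrite derive1_affine !fctE/=.
  by rewrite normal_pdf_affine.
- by move=> x y _ _ xy; rewrite ltrD2r ltr_pM2l.
- by rewrite derive1_affine => x _; exact: cvg_cst.
- by rewrite derive1_affine; exact: is_cvg_cst.
- by rewrite derive1_affine; exact: is_cvg_cst.
- split; first by move=> x _; apply: ex_derive; exact: is_derive_affine.
  by apply: cvg_at_right_filter; exact: continuous_affine.
- apply: (cvg_comp (fun y : R => s * y) (fun y => y + 0)); last exact: cvg_addrr.
  by apply: gt0_cvgMry => //; exact: cvg_id.
- by apply: continuous_subspaceT; apply: continuous_normal_pdf; rewrite gt_eqF.
- by move=> x _; rewrite normal_pdf_ge0.
Qed.

Lemma integral_sqr_normal m s : 0 < s ->
  (\int[mu]_x (((x - m) ^+ 2) * normal_pdf m s x)%:E = (s ^+ 2)%:E)%E.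
Proof.
move=> s0; rewrite (@integral_normal_pdf_affine m s (fun x => (x - m) ^+ 2))//.
- under eq_integral do rewrite addrK exprMn -mulrA EFinM.
  rewrite ge0_integralZl ?integral_sqr_normal_pdf01 ?mule1//.
  + apply: measurable_normal_pdf01M; exact: exprn_continuous.
  + by move=> x _; rewrite lee_fin mulr_ge0 ?sqr_ge0 ?normal_pdf_ge0.
  + by rewrite lee_fin sqr_ge0.
- move=> x; apply: (cvg_comp (fun x => x - m) (fun x => x ^+ 2)).
    by apply: (@cvgB _ R^o) => //; [exact: cvg_id|exact: cvg_cst].
  exact: exprn_continuous.
- by move=> x; exact: sqr_ge0.
Qed.

Lemma normal_prob_fin m s (A : set R) : measurable A -> normal_prob m s A \is a fin_num.
Proof. by move=> mA; exact: fin_num_measure. Qed.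

Lemma PsiE (z : R) : (Psi z)%:E = normal_prob 0 1 `]z, +oo[.
Proof. by rewrite fineK//; exact: normal_prob_fin. Qed.

Lemma Psi_ge0 (z : R) : 0 <= Psi z.
Proof. by rewrite -lee_fin PsiE. Qed.

Lemma Psi_le1 (z : R) : Psi z <= 1.
Proof. by rewrite -lee_fin PsiE; exact: probability_le1. Qed.

Lemma Psi_nincr (y z : R) : y <= z -> Psi z <= Psi y.
Proof.
move=> yz; rewrite -lee_fin !PsiE; apply: le_measure; rewrite ?inE//.
by move=> x /=; rewrite !in_itv/= !andbT; exact: le_lt_trans.
Qed.

(** On the tail x >= z, hence z Psi(z) is at most the integral of x phi(x) over [z, +oo[, which is
    phi(z). *)
Lemma Psi_ub1 (z : R) : 0 < z -> Psi z <= expR (- (z ^+ 2 / 2)) / z.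
Proof.
move=> z0; rewrite ler_pdivlMr// mulrC -lee_fin EFinM PsiE.
have mp := @measurable_normal_pdf_EFin 0 1 `[z, +oo[.
rewrite /normal_prob integral_itv_obnd_cbnd; last first.
  by apply: measurable_funS mp => // x /=; rewrite !in_itv/= !andbT; exact: ltW.
rewrite -ge0_integralZl//; last 2 first.
- by move=> x _; rewrite lee_fin normal_pdf_ge0.
- by rewrite lee_fin ltW.
apply: (@le_trans _ _ (\int[mu]_(x in `[z, +oo[) (x * phi x)%:E)%E).
  apply: ge0_le_integral => //.
  - by move=> x _; rewrite lee_fin mulr_ge0 ?normal_pdf_ge0// ltW.
  - by apply: emeasurable_funM => //; exact: measurable_cst.
  - by apply: measurable_normal_pdf01M; move=> x; exact: cvg_id.
  - move=> x /=; rewrite in_itv/= andbT => zx.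
    by rewrite -EFinM lee_fin ler_wpM2r ?normal_pdf_ge0.
rewrite integral_Mnormal_pdf01 ?(ltW z0)// lee_fin normal_pdf01E.
by rewrite ler_piMl ?expR_ge0 ?normal_peak1_le1.
Qed.

(** Below 1 the right-hand side is at least 2 (1 - z^2 / 2) >= 1, so the trivial bound by 1 is
    enough there. *)
Lemma Psi_ub (z : R) : 0 <= z -> Psi z <= 2 * expR (- (z ^+ 2 / 2)).
Proof.
move=> z0; have [z1|z1] := leP 1 z.
  have zp : 0 < z by lra.
  apply: (le_trans (Psi_ub1 _)) => //.
  rewrite mulrC ler_wpM2r ?expR_ge0//.
  by rewrite invf_ple ?posrE//; lra.
apply: (le_trans (Psi_le1 z)).
have := expR_ge1Dx (- (z ^+ 2 / 2)); nra.
Qed.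

Lemma Psi_lb : exists2 k : R, 0 < k &
  forall z, 0 <= z -> k / (1 + z) * expR (- (z ^+ 2 / 2)) <= Psi z.
Proof.
(* Only the interval ]z, z + h] with h = 1 / (1 + z) is kept; on it the exponent grows by at most z
   h + h^2 / 2 <= 3 / 2. *)
exists (normal_peak 1 * expR (- (3 / 2))).
  by rewrite mulr_gt0 ?expR_gt0 ?normal_peak1_gt0.
move=> z z0; set h : R := (1 + z)^-1.
have z1 : 0 < 1 + z by lra.
have h0 : 0 < h by rewrite invr_gt0.
have h1 : h <= 1 by rewrite invf_le1//; lra.
have hz : z * h <= 1 by rewrite ler_pdivrMr//; lra.
rewrite -lee_fin PsiE.
apply: (@le_trans _ _ (normal_prob 0 1 `]z, z + h])); last first.
  apply: le_measure; rewrite ?inE//.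
  by move=> x /=; rewrite !in_itv/= andbT => /andP[].
apply: (@le_trans _ _ (\int[mu]_(x in `]z, (z + h)%R]) (phi (z + h))%:E)%E).
  rewrite integral_cst//= lebesgue_measure_itv/= lte_fin ltrDl h0.
  rewrite -EFinB -EFinM lee_fin addrAC subrr add0r normal_pdf01E.
  rewrite -/h [leLHS]mulrAC ler_pM2r// -mulrA -expRD ler_pM2l ?normal_peak1_gt0//.
  by rewrite ler_expR; nra.
apply: ge0_le_integral => //.
- by move=> x _; rewrite lee_fin normal_pdf_ge0.
- exact: measurable_normal_pdf_EFin.
- move=> x /=; rewrite in_itv/= => /andP[zx xz].
  rewrite lee_fin !normal_pdf01E ler_pM2l ?normal_peak1_gt0// ler_expR.
  by nra.
Qed.

End NormalDensity.

(** * Mean, second moment and tail of a Gaussian variable from its law *)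

Section GaussianMoments.
Context {d : measure_display} {Omega : measurableType d} {R : realType}.
Variable P : probability Omega R.
Notation mu := (@lebesgue_measure R).
Local Notation phi := (@normal_pdf R 0 1).
Implicit Types (Y : Omega -> R) (v z : R).

Lemma integral_normal_law Y (m s : R) (g : R -> R) : 0 < s ->
  measurable_fun setT Y ->
  (forall S : set R, measurable S -> pushforward P Y S = normal_prob m s S) ->
  continuous g -> (forall x, 0 <= g x) ->
  (\int[P]_w (g (Y w))%:E = \int[mu]_y (g (s * y + m) * phi y)%:E)%E.
Proof.
move=> s0 mY lawY cg g0.
have mg : measurable_fun [set: R] (fun x => (g x)%:E).
  by apply/measurable_EFinP; exact: continuous_measurable_fun.
rewrite -(integral_normal_pdf_affine m s0 cg g0).
transitivity (\int[normal_prob m s]_x (g x)%:E)%E.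
  pose Y' : {mfun Omega >-> measurableTypeR R} :=
    HB.pack (Y : Omega -> measurableTypeR R)
      (isMeasurableFun.Build _ _ _ _ (Y : Omega -> measurableTypeR R) mY).
  rewrite -(@ge0_integral_distribution _ _ _ _ _ P Y' (fun x => (g x)%:E))//.
  by apply: eq_measure_integral => A mA _; exact: lawY.
by rewrite integral_normal_prob// => y; rewrite lee_fin.
Qed.

Lemma continuous_pos_part (g : R -> R) : continuous g -> continuous (fun y => Num.max (g y) 0).
Proof. by move=> cg x; apply: continuous_max; [exact: cg|exact: cvg_cst]. Qed.

Lemma dirac_law_ae Y m : measurable_fun setT Y ->
  (forall S : set R, measurable S -> pushforward P Y S = \d_m S) ->
  {ae P, forall w, Y w = m}.
Proof.
move=> mY lawY; have mm := measurableC (measurable_set1 m).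
exists [set w | Y w <> m]; split => //.
- by have := mY measurableT _ mm; rewrite setTI.
- by have := lawY _ mm; rewrite /pushforward diracE memNset//= => -> //; exact.
Qed.

Lemma integral_pos_normal_pdf01 :
  (\int[mu]_y (Num.max y 0 * phi y)%:E = (phi 0)%:E)%E.
Proof.
rewrite -(integral_Mnormal_pdf01 (lexx 0)) [RHS]integral_mkcond.
apply: eq_integral => y _; rewrite patchE; case: ifPn.
  by rewrite inE/= in_itv/= andbT => y0; rewrite max_l.
by rewrite notin_setE/= in_itv/= andbT => /negP; rewrite -ltNge => y0; rewrite max_r ?mul0r// ltW.
Qed.

Lemma integral_neg_normal_pdf01 :
  (\int[mu]_y (Num.max (- y) 0 * phi y)%:E = (phi 0)%:E)%E.
Proof.
have cpos : continuous (fun y : R => Num.max y 0) by apply: continuous_pos_part => x; exact: cvg_id.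
have cneg : continuous (fun y : R => Num.max (- y) 0).
  by apply: continuous_pos_part => x; apply: (@cvgN _ R^o); exact: cvg_id.
have h : (\int[mu]_y (`|y| * phi y)%:E = (phi 0 + phi 0)%:E)%E.
  rewrite ge0_symfun_integralT; last 3 first.
  - by move=> x; rewrite mulr_ge0 ?normal_pdf_ge0.
  - by move=> x; apply: cvgM; [exact: norm_continuous|exact: continuous_normal_pdf01].
  - by move=> x /=; rewrite normrN normal_pdf01N.
  rewrite -set_itvcy.
  under eq_integral.
    by move=> x; rewrite inE/= in_itv/= andbT => x0; rewrite ger0_norm//; over.
  by rewrite integral_Mnormal_pdf01// -EFinM mulr_natl mulr2n.
have : (\int[mu]_y (`|y| * phi y)%:E =
  \int[mu]_y (Num.max y 0 * phi y)%:E +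
  \int[mu]_y (Num.max (- y) 0 * phi y)%:E)%E.
  rewrite -ge0_integralD//.
  - apply: eq_integral => y _; rewrite -EFinD -mulrDl; congr ((_ * _)%:E).
    have [y0|y0] := leP 0 y.
      by rewrite ger0_norm// (max_r (_ : - y <= 0)) ?oppr_le0// addr0.
    by rewrite ltr0_norm// add0r max_l// oppr_ge0 ltW.
  - by move=> x _; rewrite lee_fin mulr_ge0 ?normal_pdf_ge0// le_max lexx orbT.
  - exact: (@measurable_normal_pdf01M _ setT).
  - by move=> x _; rewrite lee_fin mulr_ge0 ?normal_pdf_ge0// le_max lexx orbT.
  - exact: (@measurable_normal_pdf01M _ setT).
rewrite h integral_pos_normal_pdf01.
by case: (integral _ _ _) => [r|//|//]; rewrite -EFinD => -[] /addrI ->.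
Qed.

(** Positive and negative parts of Y - m are integrated separately, because the transfer to the
    density takes nonnegative functions. Each gives s phi(0), and they cancel. *)
Lemma normal_law_mean Y (m s : R) : 0 < s -> measurable_fun setT Y ->
  (forall S : set R, measurable S -> pushforward P Y S = normal_prob m s S) ->
  ('E_P[Y] = m%:E)%E.
Proof.
move=> s0 mY lawY.
have c1 : continuous (fun y : R => Num.max (y - m) 0).
  by apply: continuous_pos_part => x; apply: (@cvgB _ R^o); [exact: cvg_id|exact: cvg_cst].
have c2 : continuous (fun y : R => Num.max (m - y) 0).
  by apply: continuous_pos_part => x; apply: (@cvgB _ R^o); [exact: cvg_cst|exact: cvg_id].
have g1 (y : R) : 0 <= Num.max (y - m) 0 by rewrite le_max lexx orbT.
have g2 (y : R) : 0 <= Num.max (m - y) 0 by rewrite le_max lexx orbT.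
have p0 (y : R) : (0 <= (Num.max y 0 * phi y)%:E)%E.
  by rewrite lee_fin mulr_ge0 ?normal_pdf_ge0// le_max lexx orbT.
have mp (f : R -> R) : continuous f ->
    measurable_fun [set: R] (fun y => (Num.max (f y) 0 * phi y)%:E).
  by move=> cf; apply: measurable_normal_pdf01M; exact: continuous_pos_part.
have e1 := integral_normal_law s0 mY lawY c1 g1.
have e2 := integral_normal_law s0 mY lawY c2 g2.
move: e1; under [X in _ = X -> _]eq_integral.
  move=> y _; rewrite addrK -[0]/(0 : R) -[X in Num.max _ X](mulr0 s) -maxr_pMr ?(ltW s0)// -mulrA EFinM.
  over.
rewrite ge0_integralZl//=; last 2 first.
- by apply: mp => x; exact: cvg_id.
- by rewrite lee_fin ltW.
rewrite integral_pos_normal_pdf01 -EFinM => e1.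
move: e2; under [X in _ = X -> _]eq_integral.
  move=> y _; rewrite opprD addrCA subrr addr0 -mulrN -[X in Num.max _ X](mulr0 s) -maxr_pMr ?(ltW s0)// -mulrA EFinM.
  over.
rewrite ge0_integralZl//=; last 3 first.
- by apply: mp => x; apply: (@cvgN _ R^o); exact: cvg_id.
- by move=> y _; rewrite lee_fin mulr_ge0 ?normal_pdf_ge0// le_max lexx orbT.
- by rewrite lee_fin ltW.
rewrite integral_neg_normal_pdf01 -EFinM => e2.
have i1 : P.-integrable setT (fun w => (Num.max (Y w - m) 0)%:E).
  apply/integrableP; split.
    apply/measurable_EFinP; apply: (measurableT_comp (f := fun y : R => Num.max (y - m) 0)) => //.
    exact: continuous_measurable_fun.
  by under eq_integral do rewrite gee0_abs ?lee_fin//; rewrite e1 ltry.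
have i2 : P.-integrable setT (fun w => (Num.max (m - Y w) 0)%:E).
  apply/integrableP; split.
    apply/measurable_EFinP; apply: (measurableT_comp (f := fun y : R => Num.max (m - y) 0)) => //.
    exact: continuous_measurable_fun.
  by under eq_integral do rewrite gee0_abs ?lee_fin//; rewrite e2 ltry.
have ic : P.-integrable setT (fun w => m%:E) by exact: finite_measure_integrable_cst.
rewrite unlock.
transitivity (\int[P]_w (m%:E + ((Num.max (Y w - m) 0)%:E - (Num.max (m - Y w) 0)%:E)))%E.
  apply: eq_integral => w _; rewrite -EFinB -EFinD; congr EFin.
  have [h|h] := leP m (Y w).
    by rewrite max_l ?subr_ge0// max_r ?subr_le0//; ring.
  by rewrite max_r ?subr_le0 ?(ltW h)// max_l ?subr_ge0 ?(ltW h)//; ring.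
rewrite (integralD measurableT ic (integrableB measurableT i1 i2)).
rewrite (integralB measurableT i1 i2) e1 e2 -EFinB subrr adde0 integral_cst//=.
by rewrite probability_setT mule1.
Qed.

Lemma normal_law_second_moment Y (s : R) : 0 < s -> measurable_fun setT Y ->
  (forall S : set R, measurable S -> pushforward P Y S = normal_prob 0 s S) ->
  (\int[P]_w (Y w ^+ 2)%:E = (s ^+ 2)%:E)%E.
Proof.
move=> s0 mY lawY.
rewrite (integral_normal_law s0 mY lawY (g := fun x => x ^+ 2)).
- rewrite -(@integral_normal_pdf_affine _ 0 s (fun x => x ^+ 2))//.
  + by rewrite -(integral_sqr_normal 0 s0); apply: eq_integral => x _; rewrite subr0.
  + exact: exprn_continuous.
  + by move=> x; exact: sqr_ge0.
- exact: exprn_continuous.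
- by move=> x; exact: sqr_ge0.
Qed.

(* A centered law of variance v = 0 is a point mass at 0, whose tail vanishes at z >= 0. *)
Definition gauss_tail v z : R := if v == 0 then 0 else Psi (z / Num.sqrt v).

(** In both cases of [gaussian_rv] centering forces the mean to be 0, and the second moment then
    identifies v with 0 or with s^2. *)
Lemma centered_gaussian_tail Y v : measurable_fun setT Y -> gaussian_rv P Y ->
  ('E_P[Y] = 0)%E -> (\int[P]_w (Y w ^+ 2)%:E = v%:E)%E ->
  forall z, 0 <= z -> P [set w | z < Y w] = (gauss_tail v z)%:E.
Proof.
move=> mY; rewrite /gauss_tail => -[[m lawY]|[m [s [s0 lawY]]]] EY0 vE z z0.
- have aeY := dirac_law_ae mY lawY.
  have m0 : m = 0.
    suff [] : m%:E = 0%E :> \bar R by [].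
    rewrite -EY0 unlock -[LHS]mule1 -(probability_setT P) -integral_cst//.
    apply: ae_eq_integral => //; first exact/measurable_EFinP.
    by apply: filterS aeY => w /= ->.
  have -> : v = 0.
    suff [] : v%:E = 0%E :> \bar R by [].
    rewrite -vE -(@integral0 _ _ _ P setT).
    apply: ae_eq_integral => //.
      by apply/measurable_EFinP; exact: measurable_funX.
    by apply: filterS aeY => w /= ->; rewrite m0 expr0n.
  rewrite eqxx -[LHS]/(pushforward P Y [set y | z < y]).
  have -> : [set y | z < y] = `]z, +oo[%classic.
    by apply/seteqP; split => y /=; rewrite in_itv/= andbT.
  by rewrite lawY// diracE memNset//= in_itv/= andbT m0 => /(le_lt_trans z0); rewrite ltxx.
- have m0 : m = 0 by move: EY0; rewrite (normal_law_mean s0 mY lawY) => -[].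
  rewrite m0 in lawY; have := normal_law_second_moment s0 mY lawY.
  rewrite vE => -[->]; rewrite gt_eqF ?exprn_gt0// sqrtr_sqr gtr0_norm//.
  rewrite PsiE -normal_prob_tail// -lawY//; congr (P _).
  by apply/seteqP; split => w /=; rewrite in_itv/= andbT.
Qed.

Lemma gaussian_rv_sqr_integrable Y : measurable_fun setT Y -> gaussian_rv P Y ->
  ('E_P[Y] = 0)%E -> exists2 v, 0 <= v & (\int[P]_w (Y w ^+ 2)%:E = v%:E)%E.
Proof.
move=> mY [[m lawY]|[m [s [s0 lawY]]]] EY0.
- exists (m ^+ 2); first exact: sqr_ge0.
  have aeY := dirac_law_ae mY lawY.
  rewrite -[RHS]mule1 -(probability_setT P) -integral_cst//.
  apply: ae_eq_integral => //.
    by apply/measurable_EFinP; exact: measurable_funX.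
  by apply: filterS aeY => w /= ->.
- have m0 : m = 0 by move: EY0; rewrite (normal_law_mean s0 mY lawY) => -[].
  rewrite m0 in lawY; exists (s ^+ 2); first exact: sqr_ge0.
  exact: normal_law_second_moment.
Qed.

Lemma gauss_tail_ub v V z : 0 <= v <= V -> 0 <= z ->
  gauss_tail v z <= 2 * expR (- (z ^+ 2 / (2 * V))).
Proof.
move=> /andP[v0 vV] z0; rewrite /gauss_tail; case: ifPn => [_|vn0].
  by rewrite mulr_ge0// expR_ge0.
have vp : 0 < v by rewrite lt_neqAle eq_sym vn0.
apply: (le_trans (Psi_ub _)); first by rewrite divr_ge0// sqrtr_ge0.
have -> : (z / Num.sqrt v) ^+ 2 / 2 = z ^+ 2 / (2 * v).
  by rewrite exprMn exprVn sqr_sqrtr//; field.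
rewrite ler_pM2l// ler_expR lerN2; apply: ler_wpM2l; first exact: sqr_ge0.
by rewrite lef_pV2 ?posrE; lra.
Qed.

End GaussianMoments.

(** * Laws and variances of the increments of the process *)

Section Increments.
Context {d : measure_display} {Omega : measurableType d} {R : realType}.
Variable P : probability Omega R.
Implicit Types (Y : Omega -> R) (v z : R).

(** The variance is recorded as the integral of a square, so that it can be computed by nonnegative
    integration, free of integrability conditions. *)
Definition cgauss Y v : Prop :=
  [/\ measurable_fun setT Y, gaussian_rv P Y, ('E_P[Y] = 0)%E &
      (\int[P]_w (Y w ^+ 2)%:E = v%:E)%E].

Lemma cgauss_ge0 Y v : cgauss Y v -> 0 <= v.
Proof.
by case=> _ _ _ h; rewrite -lee_fin -h; apply: integral_ge0 => w _; rewrite lee_fin sqr_ge0.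
Qed.

Lemma cgauss_tail Y v z : cgauss Y v -> 0 <= z ->
  P [set w | z < Y w] = (gauss_tail v z)%:E.
Proof. by case=> mY gY EY vE; exact: centered_gaussian_tail. Qed.

Lemma cgauss_tail_ub Y v V z : cgauss Y v -> v <= V -> 0 <= z ->
  (P [set w | (z < Y w)%R] <= (2 * expR (- (z ^+ 2 / (2 * V))))%:E)%E.
Proof.
move=> cY vV z0; rewrite (cgauss_tail cY z0) lee_fin gauss_tail_ub//.
by rewrite vV (cgauss_ge0 cY).
Qed.

Lemma measurable_gt Y z : measurable_fun setT Y -> measurable [set w | z < Y w].
Proof.
move=> mY; have := mY measurableT `]z, +oo[%classic (measurable_itv _); rewrite setTI.
by congr measurable; apply/seteqP; split => w /=; rewrite in_itv/= andbT.
Qed.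

Lemma sqr_integrable_integrable Y v : measurable_fun setT Y ->
  (\int[P]_w (Y w ^+ 2)%:E = v%:E)%E -> P.-integrable setT (EFin \o Y).
Proof.
move=> mY vE; apply: (@le_integrable _ _ _ _ _ measurableT _
  (fun w => (1 + Y w ^+ 2)%:E)).
- exact/measurable_EFinP.
- move=> w _ /=; rewrite lee_fin [leRHS]ger0_norm ?addr_ge0 ?sqr_ge0//.
  by rewrite -[in leRHS]real_normK ?num_real//; have := sqr_ge0 (`|Y w| - 1); nra.
- apply/integrableP; split.
    by apply/measurable_EFinP; apply: measurable_funD => //; exact: measurable_funX.
  under eq_integral do rewrite gee0_abs ?lee_fin ?addr_ge0 ?sqr_ge0// EFinD.
  rewrite ge0_integralD//=.
  + by rewrite vE integral_cst//= probability_setT mule1 ltry.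
  + by move=> w _; rewrite lee_fin sqr_ge0.
  + by apply/measurable_EFinP; exact: measurable_funX.
Qed.

Lemma eq_law_integral Y1 Y2 (g : R -> R) : measurable_fun setT Y1 ->
  measurable_fun setT Y2 ->
  (forall S : set R, measurable S -> P [set w | S (Y1 w)] = P [set w | S (Y2 w)]) ->
  measurable_fun setT g -> (forall x, 0 <= g x) ->
  (\int[P]_w (g (Y1 w))%:E = \int[P]_w (g (Y2 w))%:E)%E.
Proof.
move=> m1 m2 law mg g0.
pose Z1 : {mfun Omega >-> R} := HB.pack Y1 (isMeasurableFun.Build _ _ _ _ Y1 m1).
pose Z2 : {mfun Omega >-> R} := HB.pack Y2 (isMeasurableFun.Build _ _ _ _ Y2 m2).
have mg' : measurable_fun setT (fun x => (g x)%:E) by exact/measurable_EFinP.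
rewrite -(@ge0_integral_distribution _ _ _ _ _ P Z1 (fun x => (g x)%:E))//.
rewrite -(@ge0_integral_distribution _ _ _ _ _ P Z2 (fun x => (g x)%:E))//.
by apply: eq_measure_integral => A mA _; exact: law.
Qed.

Variable X : R -> {RV P >-> R}.
Hypothesis hX : centered_gaussian_si X.
Local Notation f := (sigma2 X).

Lemma measurable_X t : measurable_fun setT (X t : Omega -> R).
Proof. exact: measurable_funPT. Qed.

Lemma measurable_increment s t : measurable_fun setT (fun w => X t w - X s w).
Proof. exact: measurable_funB (@measurable_X t) (@measurable_X s). Qed.

Lemma measurable_level t z : measurable [set w | z < X t w].
Proof. exact: measurable_gt (@measurable_X t). Qed.

(** Three times cover everything needed: single values, increments, and sums of two increments with
    a common endpoint. *)
Lemma gaussian_comb3 (a1 a2 a3 t1 t2 t3 : R) : 0 <= t1 -> 0 <= t2 -> 0 <= t3 ->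
  gaussian_rv P (fun w => a1 * X t1 w + a2 * X t2 w + a3 * X t3 w).
Proof.
move=> h1 h2 h3.
have := @cgsi_gaussian _ _ _ _ _ hX 3%N (fun i => nth 0 [:: t1; t2; t3] i)
  (fun i => nth 0 [:: a1; a2; a3] i).
have -> : (fun w => \sum_(i < 3) nth 0 [:: a1; a2; a3] i * X (nth 0 [:: t1; t2; t3] i) w)
   = (fun w => a1 * X t1 w + a2 * X t2 w + a3 * X t3 w).
  by apply/funext => w; rewrite !big_ord_recl big_ord0/= addr0 addrA.
by apply => -[[|[|[|i]]] ?].
Qed.

Lemma gaussian_X t : 0 <= t -> gaussian_rv P (X t : Omega -> R).
Proof.
move=> t0; have := gaussian_comb3 1 0 0 t0 t0 t0.
by congr gaussian_rv; apply/funext => w; rewrite !mul0r !addr0 mul1r.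
Qed.

Lemma cgauss_X t : 0 <= t -> cgauss (X t : Omega -> R) (f t).
Proof.
move=> t0; have EX : ('E_P[X t : Omega -> R] = 0)%E by exact: (cgsi_centered hX t0).
have [v v0 vE] := gaussian_rv_sqr_integrable (@measurable_X t) (gaussian_X t0) EX.
split; [exact: measurable_X|exact: gaussian_X|by []|].
rewrite vE; congr EFin; rewrite /sigma2 /variance unlock EX/=.
rewrite unlock (_ : integral _ _ _ = v%:E)//= -vE.
by apply: eq_integral => w _; rewrite !fctE/= subr0 expr2.
Qed.

Lemma integrable_X t : 0 <= t -> P.-integrable setT (EFin \o X t).
Proof. by move=> /cgauss_X[mX _ _ vX]; exact: sqr_integrable_integrable vX. Qed.

Lemma expectation_comb3 (a1 a2 a3 t1 t2 t3 : R) : 0 <= t1 -> 0 <= t2 -> 0 <= t3 ->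
  ('E_P[(fun w => a1 * X t1 w + a2 * X t2 w + a3 * X t3 w)%R] = 0)%E.
Proof.
move=> h1 h2 h3.
have EX t : 0 <= t -> (\int[P]_w (X t w)%:E = 0)%E.
  by move=> t0; have := cgsi_centered hX t0; rewrite unlock.
have iZ a t : 0 <= t -> P.-integrable setT (fun w => (a%:E * (X t w)%:E)%E).
  by move=> t0; apply: (integrableZl measurableT); exact: integrable_X.
have eZ a t : 0 <= t -> (\int[P]_w (a%:E * (X t w)%:E) = 0)%E.
  by move=> t0; rewrite integralZl ?EX ?mule0//; exact: integrable_X.
rewrite unlock.
under eq_integral do rewrite !EFinD !EFinM.
rewrite integralD//; last 2 first.
- by apply: (integrableD measurableT); exact: iZ.
- exact: iZ.
rewrite integralD//; [|exact: iZ|exact: iZ].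
by rewrite !eZ// !adde0.
Qed.

Lemma increment_law s t (S : set R) : 0 <= s <= t -> measurable S ->
  P [set w | S (X t w - X s w)] = P [set w | S (X (t - s) w - X 0 w)].
Proof.
move=> /andP[s0 st] mS.
have ts : 0 <= t - s by rewrite subr_ge0.
have mS1 : measurable [set x : 1.-tuple R | S (tnth x ord0)].
  rewrite -[X in measurable X]setTI.
  exact: (measurable_tnth (@ord0 0)).
have := @cgsi_stationary _ _ _ _ _ hX s s0 1%N (fun=> t - s) (fun=> ts) _ mS1.
have -> : [set w | [set x | S (tnth x ord0)]
    [tuple X (s + (t - s)) w - X s w | _ < 1]] = [set w | S (X t w - X s w)].
  by apply/seteqP; split => w /=; rewrite tnth_mktuple subrKC.
have -> : [set w | [set x | S (tnth x ord0)] [tuple X (t - s) w - X 0 w | _ < 1]] =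
    [set w | S (X (t - s) w - X 0 w)].
  by apply/seteqP; split => w /=; rewrite tnth_mktuple.
by [].
Qed.

Lemma increment_sqr s t : 0 <= s <= t ->
  (\int[P]_w ((X t w - X s w) ^+ 2)%:E = (f (t - s))%:E)%E.
Proof.
move=> st; have ts : 0 <= t - s by rewrite subr_ge0; case/andP: st.
have mB := measurable_increment.
rewrite (@eq_law_integral _ (fun w => X (t - s) w - X 0 w) (fun y => y ^+ 2))//; last 2 first.
- by move=> S mS; exact: increment_law.
- by move=> y; exact: sqr_ge0.
have [_ _ _ <-] := cgauss_X ts.
apply: ae_eq_integral => //.
- by apply/measurable_EFinP; apply: measurable_funX.
- by apply/measurable_EFinP; apply: measurable_funX; exact: measurable_X.
- by apply: filterS (cgsi_start hX) => w /= ->; rewrite subr0.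
Qed.

Lemma cgauss_incr s t : 0 <= s <= t -> cgauss (fun w => X t w - X s w) (f (t - s)).
Proof.
move=> st; have /andP[s0 /(le_trans s0) t0] := st.
have e : (fun w => 1 * X t w + (-1) * X s w + 0 * X s w) = (fun w => X t w - X s w).
  by apply/funext => w; rewrite mul0r addr0 mulN1r mul1r.
split; last exact: increment_sqr.
- exact: measurable_increment.
- by rewrite -e; exact: gaussian_comb3.
- by rewrite -e; exact: expectation_comb3.
Qed.

Lemma cgauss_decr s t : 0 <= s <= t -> cgauss (fun w => X s w - X t w) (f (t - s)).
Proof.
move=> st; have /andP[s0 /(le_trans s0) t0] := st.
have e : (fun w => (-1) * X t w + 1 * X s w + 0 * X s w) = (fun w => X s w - X t w).
  by apply/funext => w; rewrite mul0r addr0 mulN1r mul1r addrC.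
split.
- exact: measurable_increment.
- by rewrite -e; exact: gaussian_comb3.
- by rewrite -e; exact: expectation_comb3.
- by rewrite -increment_sqr//; apply: eq_integral => w _; rewrite -sqrrN opprB.
Qed.

Lemma sigma2_ge0 t : 0 <= t -> 0 <= f t.
Proof. by move=> /cgauss_X /cgauss_ge0. Qed.

Lemma sigma2_0 : f 0 = 0.
Proof.
have [_ _ _ h] := cgauss_X (lexx 0).
suff [] : (f 0)%:E = 0%E :> \bar R by [].
rewrite -h -(@integral0 _ _ _ P setT); apply: ae_eq_integral => //.
  by apply/measurable_EFinP; apply: measurable_funX; exact: measurable_X.
by apply: filterS (cgsi_start hX) => w /= ->; rewrite expr0n.
Qed.

(* The parallelogram identity expresses the variance of the sum of two
   increments ending at t through that of their difference. *)
Lemma cgauss_pair r s t : 0 <= r -> r <= s -> s <= t ->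
  cgauss (fun w => (X t w - X r w) + (X t w - X s w))
    (2 * f (t - r) + 2 * f (t - s) - f (s - r)).
Proof.
move=> r0 rs st; have s0 := le_trans r0 rs; have t0 := le_trans s0 st.
have e : (fun w => 2 * X t w + (-1) * X r w + (-1) * X s w) =
    (fun w => (X t w - X r w) + (X t w - X s w)).
  by apply/funext => w; ring.
have gY : gaussian_rv P (fun w => (X t w - X r w) + (X t w - X s w)).
  by rewrite -e; exact: gaussian_comb3.
have EY : ('E_P[(fun w => (X t w - X r w) + (X t w - X s w))%R] = 0)%E.
  by rewrite -e; exact: expectation_comb3.
have mB := measurable_increment.
have mY : measurable_fun setT (fun w => (X t w - X r w) + (X t w - X s w)).
  exact: measurable_funD.
split => //.
have [v v0 vE] := gaussian_rv_sqr_integrable mY gY EY.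
rewrite vE; congr EFin.
have m2 (Y : Omega -> R) : measurable_fun setT Y ->
    measurable_fun setT (fun w => (Y w ^+ 2)%:E).
  by move=> mY'; apply/measurable_EFinP; exact: measurable_funX.
(* (p + q)^2 + (p - q)^2 = 2 p^2 + 2 q^2, written without subtraction so that all integrals are of
   nonnegative functions; the finite value [v] is isolated afterwards in R. *)
have : (\int[P]_w (((X t w - X r w) + (X t w - X s w)) ^+ 2)%:E +
    \int[P]_w ((X s w - X r w) ^+ 2)%:E =
  2%:E * \int[P]_w ((X t w - X r w) ^+ 2)%:E + 2%:E * \int[P]_w ((X t w - X s w) ^+ 2)%:E)%E.
  rewrite -!ge0_integralZl//; [|exact: m2| |exact: m2|]; last 2 first.
  - by move=> w _; rewrite lee_fin sqr_ge0.
  - by move=> w _; rewrite lee_fin sqr_ge0.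
  rewrite -!ge0_integralD//.
  - by apply: eq_integral => w _; rewrite -!EFinM -!EFinD; congr EFin; ring.
  - by move=> w _; rewrite -EFinM lee_fin mulr_ge0 ?sqr_ge0.
  - by apply: emeasurable_funM => //; exact: m2.
  - by move=> w _; rewrite -EFinM lee_fin mulr_ge0 ?sqr_ge0.
  - by apply: emeasurable_funM => //; exact: m2.
  - by move=> w _; rewrite lee_fin sqr_ge0.
  - exact: m2.
  - by move=> w _; rewrite lee_fin sqr_ge0.
  - exact: m2.
rewrite vE !increment_sqr ?r0 ?rs ?s0 ?st ?(le_trans rs st)// -!EFinM -!EFinD => -[h].
by rewrite -h addrK.
Qed.

Lemma increment_tail s t z : 0 <= s <= t -> 0 <= z ->
  P [set w | z < X t w - X s w] = (gauss_tail (f (t - s)) z)%:E.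
Proof. by move=> st; exact: cgauss_tail (cgauss_incr st). Qed.

Lemma increment_abs_tail_ub s t V z : 0 <= s <= t -> f (t - s) <= V -> 0 <= z ->
  (P [set w | (z < `|X t w - X s w|)%R] <= (4 * expR (- (z ^+ 2 / (2 * V))))%:E)%E.
Proof.
move=> st fV z0.
have m1 := @measurable_gt _ z (let: And4 m _ _ _ := cgauss_incr st in m).
have m2 := @measurable_gt _ z (let: And4 m _ _ _ := cgauss_decr st in m).
have -> : [set w | z < `|X t w - X s w|] =
    [set w | z < X t w - X s w] `|` [set w | z < X s w - X t w].
  by apply/seteqP; split => w /=; rewrite ltr_normr opprB => /orP.
apply: (le_trans (measureU2 P m1 m2)).
have -> : (4 * expR (- (z ^+ 2 / (2 * V))))%:E =
  ((2 * expR (- (z ^+ 2 / (2 * V))))%:E + (2 * expR (- (z ^+ 2 / (2 * V))))%:E)%E.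
  by rewrite -EFinD; congr EFin; ring.
apply: leeD.
- exact: cgauss_tail_ub (cgauss_incr st) fV z0.
- exact: cgauss_tail_ub (cgauss_decr st) fV z0.
Qed.

End Increments.

(** * Dyadic approximation and chaining along one continuous path *)

Section Dyadic.
Context {R : realType}.
Implicit Types (g : R -> R) (T s : R).

Lemma bernoulli_ineq (b : R) n : 0 <= b -> 1 + n%:R * b <= (1 + b) ^+ n.
Proof.
move=> b0; elim: n => [|n IH]; first by rewrite mul0r addr0 expr0.
rewrite exprS; apply: le_trans (ler_wpM2l _ IH); last by rewrite addr_ge0.
rewrite -natr1; have h : 0 <= n%:R :> R by [].
by nra.
Qed.

Lemma natr_lt_exp2 n : n%:R < 2 ^+ n :> R.
Proof. by rewrite -natrX ltr_nat ltn_expl. Qed.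

Lemma exp2_gt n : 0 < 2 ^+ n :> R.
Proof. by rewrite exprn_gt0. Qed.

Lemma small_dyadic T (del : R) : 0 < T -> 0 < del -> exists N,
  forall n, (N <= n)%N -> T / 2 ^+ n < del.
Proof.
move=> T0 d0; exists (Num.truncn (T / del)).+1 => n Nn.
have h : 0 <= T / del by rewrite divr_ge0// ltW.
rewrite ltr_pdivrMr ?exp2_gt// mulrC -ltr_pdivrMr//.
have /andP[_ h1] := truncn_itv h.
apply: (lt_trans h1); apply: (le_lt_trans _ (natr_lt_exp2 n)).
by rewrite ler_nat.
Qed.

(** The index at level n is the integer part of s 2^n / T. Doubling a number turns its integer part
    k into 2 k or 2 k + 1, so consecutive approximations are equal or adjacent on the finer grid;
    chaining telescopes over these steps. *)
Lemma dyadic_floor T s : 0 < T -> 0 <= s <= T -> exists k : nat -> nat,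
  forall n, [/\ (k n <= 2 ^ n)%N, T * (k n)%:R / 2 ^+ n <= s,
    s - T * (k n)%:R / 2 ^+ n <= T / 2 ^+ n &
    k n.+1 = (2 * k n)%N \/ k n.+1 = (2 * k n).+1].
Proof.
move=> T0 /andP[s0 sT]; pose y n : R := s / T * 2 ^+ n.
have y0 n : 0 <= y n by rewrite mulr_ge0 ?divr_ge0 ?exprn_ge0// ltW.
exists (fun n => Num.truncn (y n)) => n.
have /andP[h1 h2] := truncn_itv (y0 n).
have /andP[h3 h4] := truncn_itv (y0 n.+1).
have p := exp2_gt n.
set a := Num.truncn (y n) in h1 h2 *; set b := Num.truncn (y n.+1) in h3 h4 *.
have yE : s = T * y n / 2 ^+ n.
  by rewrite /y; field; rewrite !gt_eqF.
have yS : y n.+1 = 2 * y n by rewrite /y exprS; ring.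
split.
- rewrite -(ler_nat R) natrX; apply: (le_trans h1).
  rewrite /y -[leRHS]mul1r ler_wpM2r ?exprn_ge0//.
  by rewrite ler_pdivrMr// mul1r.
- by rewrite [leRHS]yE ler_pM2r ?invr_gt0// ler_pM2l.
- rewrite [X in X - _]yE -mulrBl -mulrBr ler_pM2r ?invr_gt0// -[leRHS]mulr1 ler_pM2l//.
  by move: h2; rewrite -natr1; lra.
- have l1 : (2 * a <= b)%N.
    by rewrite -ltnS -(ltr_nat R) natrM; apply: le_lt_trans h4; rewrite yS ler_pM2l.
  have l2 : (b < (2 * a).+2)%N.
    rewrite -(ltr_nat R); apply: (le_lt_trans h3); rewrite yS.
    by move: h2; rewrite -(ltr_pM2l (_ : 0 < 2 :> R))// -natrM mulnS addnC addn2.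
  move: l1 l2; rewrite ltnS leq_eqVlt => /orP[/eqP ->|l1]; first by left.
  by rewrite leq_eqVlt ltnS => /orP[/eqP ->|l2]; [right|exfalso; move: (leq_trans l1 l2); rewrite ltnn].
Qed.

Lemma within_continuous_eps g s (eps : R) :
  {within [set t : R | 0 <= t], continuous g} -> 0 <= s -> 0 < eps ->
  exists2 del, 0 < del & forall y, 0 <= y -> `|s - y| < del -> `|g s - g y| < eps.
Proof.
move=> /subspace_continuousP cg s0 e0.
have /(_ s0)/cvgrPdist_lt/(_ _ e0) := cg s.
rewrite /within/= => -[del /= d0 h]; exists del => // y y0 sy.
exact: h.
Qed.

Lemma dyadic_approx g T s (eps : R) :
  {within [set t : R | 0 <= t], continuous g} -> 0 < T -> 0 <= s <= T -> 0 < eps ->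
  exists n k, [/\ (k <= 2 ^ n)%N, `|s - T * k%:R / 2 ^+ n| < eps &
    `|g s - g (T * k%:R / 2 ^+ n)| < eps].
Proof.
move=> cg T0 sT e0; have s0 : 0 <= s by case/andP: sT.
have [del d0 hd] := within_continuous_eps cg s0 e0.
have [k hk] := dyadic_floor T0 sT.
have [N hN] := @small_dyadic T (Num.min del eps) T0 (ltac:(by rewrite lt_min d0 e0)).
have [h1 h2 h3 _] := hk N.
have h4 : `|s - T * (k N)%:R / 2 ^+ N| < Num.min del eps.
  by rewrite ger0_norm ?subr_ge0//; apply: (le_lt_trans h3); exact: hN.
move: h4; rewrite lt_min => /andP[h4 h5].
exists N, (k N); split => //; apply: hd => //.
by rewrite divr_ge0 ?exprn_ge0// mulr_ge0// ltW.
Qed.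

(** The value at s is reached from the level-n0 approximation by telescoping through the finer
    levels, where step j costs at most [e j]; continuity removes the remaining distance. *)
Lemma chaining_dist g T n0 (e : nat -> R) (eps s : R) : 0 < T ->
  {within [set t : R | 0 <= t], continuous g} ->
  (forall J, \sum_(j < J) e j <= eps) ->
  (forall j k, (k < 2 ^ (n0 + j).+1)%N ->
    `|g (T * k.+1%:R / 2 ^+ (n0 + j).+1) - g (T * k%:R / 2 ^+ (n0 + j).+1)| <= e j) ->
  0 <= s <= T ->
  exists k, [/\ (k <= 2 ^ n0)%N, T * k%:R / 2 ^+ n0 <= s,
    s - T * k%:R / 2 ^+ n0 <= T / 2 ^+ n0 & `|g s - g (T * k%:R / 2 ^+ n0)| <= eps].
Proof.
move=> T0 cg he hg sT; have s0 : 0 <= s by case/andP: sT.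
have [k hk] := dyadic_floor T0 sT.
exists (k n0); have [h1 h2 h3 _] := hk n0; split => //.
pose p n := T * (k n)%:R / 2 ^+ n.
have p0 n : 0 <= p n by rewrite /p divr_ge0 ?exprn_ge0// mulr_ge0// ltW.
have step j : `|g (p (n0 + j).+1) - g (p (n0 + j)%N)| <= e j.
  have e0 : 0 <= e j by apply: le_trans (hg j 0%N _); rewrite ?expn_gt0.
  have [k1 _ _ k3] := hk (n0 + j)%N.
  have [k4 _ _ _] := hk (n0 + j).+1.
  have pE : p (n0 + j)%N = T * (2 * k (n0 + j))%:R / 2 ^+ (n0 + j).+1.
    by rewrite /p exprS natrM; field; rewrite gt_eqF ?exp2_gt.
  case: k3 => k3; rewrite pE /p k3; first by rewrite subrr normr0.
  by apply: hg; move: k4; rewrite k3.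
have tel J : `|g (p (n0 + J)%N) - g (p n0)| <= \sum_(j < J) e j.
  elim: J => [|J IH]; first by rewrite addn0 subrr normr0 big_ord0.
  rewrite big_ord_recr/= addnS.
  have -> : g (p (n0 + J).+1) - g (p n0) =
    (g (p (n0 + J)%N) - g (p n0)) + (g (p (n0 + J).+1) - g (p (n0 + J)%N)) by ring.
  by apply: (le_trans (ler_normD _ _)); apply: lerD.
apply/ler_addgt0Pr => eta eta0.
have [del d0 hd] := within_continuous_eps cg s0 eta0.
have [N hN] := small_dyadic T0 d0.
have [_ q2 q3 _] := hk (n0 + N)%N.
have hs : `|g s - g (p (n0 + N)%N)| < eta.
  apply: hd => //; rewrite ger0_norm ?subr_ge0//.
  by apply: (le_lt_trans q3); apply: hN; rewrite leq_addl.
have -> : g s - g (T * (k n0)%:R / 2 ^+ n0) =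
  (g (p (n0 + N)%N) - g (p n0)) + (g s - g (p (n0 + N)%N)) by rewrite /p; ring.
apply: (le_trans (ler_normD _ _)); apply: lerD; last exact: ltW.
exact: le_trans (tel N) (he N).
Qed.

End Dyadic.

(** * The queue events and their probabilities *)

Section Overflow.
Context {d : measure_display} {Omega : measurableType d} {R : realType}.
Variable P : probability Omega R.
Variable X : R -> {RV P >-> R}.
Hypothesis hX : centered_gaussian_si X.
Variable c : R.
Hypothesis hc : 0 < c.
Local Notation f := (sigma2 X).

Definition netput_gt (t s u : R) : set Omega :=
  [set w | u < X t w - X s w - c * (t - s)].

Definition overflow (t u : R) : set Omega :=
  [set w | exists2 s, 0 <= s <= t & u < X t w - X s w - c * (t - s)].

Lemma measurable_netput_gt t s u : measurable (netput_gt t s u).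
Proof.
apply: measurable_gt; apply: measurable_funB => //.
exact: measurable_increment.
Qed.

Lemma netput_gtE t s u :
  netput_gt t s u = [set w | u + c * (t - s) < X t w - X s w].
Proof. by apply/seteqP; split => w; rewrite /netput_gt/= => h; lra. Qed.

(** Strictness of the inequality and continuity of the paths let a dyadic point replace the
    exceedance time; the countable union then makes the event measurable. *)
Lemma overflowE t u : 0 < t -> overflow t u =
  \bigcup_n \bigcup_(k in [set k | (k <= 2 ^ n)%N]) netput_gt t (t * k%:R / 2 ^+ n) u.
Proof.
move=> t0; apply/seteqP; split => w /=.
- move=> [s st hs].
  (* The slack is divided by 1 + c: moving s by less than e changes the path by less than e and the
     drift by less than c e. *)
  pose e := (X t w - X s w - c * (t - s) - u) / (1 + c).
  have c1 : 0 < 1 + c by rewrite addr_gt0.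
  have e0 : 0 < e by rewrite divr_gt0// subr_gt0.
  have cX : continuous_paths X := cgsi_continuous hX.
  have [n [k [k1 k2 k3]]] := dyadic_approx (cX w) t0 st e0.
  exists n => //; exists k => //; rewrite /netput_gt/=.
  set y := t * k%:R / 2 ^+ n in k2 k3 *.
  move: k2 k3; rewrite !ltr_norml => /andP[_ k2] /andP[k3 _].
  have -> : u = X t w - X s w - c * (t - s) - e * (1 + c).
    by rewrite /e divfK ?gt_eqF//; ring.
  by move: k2; rewrite -(ltr_pM2l hc); lra.
- move=> [n _ [k /= kn h]]; exists (t * k%:R / 2 ^+ n) => //.
  rewrite divr_ge0 ?exprn_ge0 ?mulr_ge0 ?(ltW t0)//=.
  by rewrite ler_pdivrMr ?exp2_gt// ler_pM2l// -natrX ler_nat.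
Qed.

Lemma measurable_overflow t u : 0 < t -> measurable (overflow t u).
Proof.
move=> t0; rewrite overflowE//; apply: bigcupT_measurable => n.
by apply: bigcup_measurable => k _; exact: measurable_netput_gt.
Qed.

(** The netput is continuous on a compact interval, hence bounded above, so [sup] is a true
    supremum; by strictness [u < sup] is witnessed by a point. *)
Lemma Q_gtP x t u w : 0 <= t ->
  u < Q X c x t w <-> u < x + X t w - c * t \/ overflow t u w.
Proof.
move=> t0; rewrite /Q lt_max /overflow/=.
set S := [set _ | _ in _].
have cQ : {within `[0, t], continuous (fun s => X t w - X s w - c * (t - s))}.
  have sub : `[0, t]%classic `<=` [set s : R | 0 <= s].
    by move=> s /=; rewrite in_itv/= => /andP[].
  have cX0 : continuous_paths X := cgsi_continuous hX.
  have cX := continuous_subspaceW sub (cX0 w).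
  move=> s; apply: (@cvgB _ R^o); first by apply: (@cvgB _ R^o); [exact: cvg_cst|exact: cX].
  apply: cvgM; first exact: cvg_cst.
  apply: (@cvgB _ R^o); first exact: cvg_cst.
  by apply: continuous_subspaceT => y; exact: cvg_id.
have [m _ hm] := EVT_max t0 cQ.
have ubS : has_ubound S.
  by exists (X t w - X m w - c * (t - m)) => _ [s /= st <-]; exact: hm.
split.
- move=> /orP[->|h]; [by left|right].
  have S0 : S !=set0.
    by exists (X t w - X 0 w - c * (t - 0)), 0 => //=; rewrite in_itv/= lexx.
  by have [_ [s /= st <-] us] := sup_gt S0 h; exists s.
- move=> [->//|[s st us]]; apply/orP; right; apply: (lt_le_trans us).
  by apply: sup_upper_bound; [split => //; exists (X t w - X s w - c * (t - s)), s|exists s].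
Qed.

Lemma Q_gt_set x t u : 0 <= t -> [set w | u < Q X c x t w] =
  [set w | u - x + c * t < X t w] `|` overflow t u.
Proof.
move=> t0; apply/seteqP; split => w /=.
  by move=> /(Q_gtP _ _ _ t0)[h|h]; [left|right] => //=; lra.
by move=> [h|h]; apply/(Q_gtP _ _ _ t0); [left|right] => //; lra.
Qed.

Lemma probability_fineK (A : set Omega) : measurable A -> (fine (P A))%:E = P A.
Proof. by move=> mA; rewrite fineK// fin_num_measure. Qed.

(** For x = 0 the level event is the exceedance at s = 0, except on the null set where X 0 differs
    from 0. *)
Lemma pi_queue0E t u : 0 < t -> (pi_queue X c 0 t u)%:E = P (overflow t u).
Proof.
move=> t0; rewrite /pi_queue Q_gt_set ?ltW//.
have m1 := measurable_level X t (u - 0 + c * t).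
have m2 := measurable_overflow u t0.
rewrite probability_fineK; last exact: measurableU.
have [N [mN N0 hN]] := cgsi_start hX.
have mN' : measurable (overflow t u `|` N) by exact: measurableU.
apply/eqP; rewrite eq_le; apply/andP; split; last first.
  by apply: le_measure; rewrite ?inE//; first [exact: measurableU|exact: subsetUr].
apply: (@le_trans _ _ (P (overflow t u `|` N))).
  apply: le_measure; rewrite ?inE//; first exact: measurableU.
  move=> w [/= h|h]; last by left.
  have [x0|x0] := pselect (X 0 w = 0); last by right; exact: hN.
  by left; exists 0; [rewrite lexx ltW|rewrite x0; lra].
by apply: (le_trans (measureU2 P m2 mN)); rewrite [X in (_ + X)%E]N0 adde0.
Qed.

Lemma level_prob x t u : 0 <= t -> 0 <= u - x + c * t ->
  P [set w | u - x + c * t < X t w] = (gauss_tail (f t) (u - x + c * t))%:E.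
Proof. by move=> t0 z0; exact: cgauss_tail (cgauss_X hX t0) z0. Qed.

Lemma pi_queueE x t u : 0 < t ->
  (pi_queue X c x t u)%:E = P ([set w | u - x + c * t < X t w] `|` overflow t u).
Proof.
move=> t0; rewrite /pi_queue Q_gt_set ?ltW// probability_fineK//.
apply: measurableU; last exact: measurable_overflow.
exact: measurable_level.
Qed.

Lemma pi_queue_ge_overflow x t u : 0 < t -> pi_queue X c 0 t u <= pi_queue X c x t u.
Proof.
move=> t0; rewrite -lee_fin pi_queue0E// pi_queueE//.
have m2 := measurable_overflow u t0.
have m1 := measurable_level X t (u - x + c * t).
by apply: le_measure; rewrite ?inE//; first [exact: measurableU|exact: subsetUr].
Qed.

Lemma pi_queue_ge_level x t u : 0 < t -> 0 <= u - x + c * t ->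
  gauss_tail (f t) (u - x + c * t) <= pi_queue X c x t u.
Proof.
move=> t0 z0; have e1 := level_prob (ltW t0) z0; rewrite -lee_fin -e1 pi_queueE//.
have m2 := measurable_overflow u t0.
have m1 := measurable_level X t (u - x + c * t).
by apply: le_measure; rewrite ?inE//; first [exact: measurableU|exact: subsetUl].
Qed.

(** Inclusion-exclusion, with the intersection entering only through an upper bound [J]. *)
Lemma pi_queue_joint x t u J : 0 < t -> 0 <= u - x + c * t ->
  (P ([set w | (u - x + c * t < X t w)%R] `&` overflow t u) <= J%:E)%E ->
  gauss_tail (f t) (u - x + c * t) + pi_queue X c 0 t u - J <= pi_queue X c x t u
    <= gauss_tail (f t) (u - x + c * t) + pi_queue X c 0 t u.
Proof.
move=> t0 z0.
have m2 := measurable_overflow u t0.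
have m1 := measurable_level X t (u - x + c * t).
have e1 := level_prob (ltW t0) z0; have e2 := pi_queue0E u t0; have e3 := pi_queueE x u t0.
have mI := measurableI _ _ m1 m2.
rewrite -(probability_fineK mI) lee_fin => hJ.
have fin1 : (P [set w | (u - x + c * t < X t w)%R] < +oo)%E by rewrite e1 ltry.
have h := measureUfinl m1 m2 fin1.
have : (pi_queue X c x t u)%:E = ((gauss_tail (f t) (u - x + c * t))%:E +
    (pi_queue X c 0 t u)%:E -
    (fine (P ([set w | (u - x + c * t < X t w)%R] `&` overflow t u)))%:E)%E.
  by rewrite e3 e2 -e1 (probability_fineK mI); exact: h.
rewrite -!EFinD => -[{}h].
have h0 : 0 <= fine (P ([set w | u - x + c * t < X t w] `&` overflow t u)).
  by rewrite fine_ge0.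
by apply/andP; split; rewrite h; lra.
Qed.

Lemma overflow_ge_tail t v u : 0 <= u -> 0 < t -> 0 <= v <= t ->
  gauss_tail (f v) (u + c * v) <= pi_queue X c 0 t u.
Proof.
move=> u0 t0 /andP[v0 vt].
have tv : 0 <= t - v <= t by rewrite subr_ge0 vt lerBlDr lerDl.
rewrite -lee_fin pi_queue0E//.
have := increment_tail hX tv (ltac:(by rewrite addr_ge0// mulr_ge0// ltW) : 0 <= u + c * v).
rewrite subKr => <-.
have -> : [set w | u + c * v < X t w - X (t - v) w] = netput_gt t (t - v) u.
  by rewrite netput_gtE subKr.
apply: le_measure; rewrite ?inE; [exact: measurable_netput_gt|exact: measurable_overflow|].
by move=> w h; exists (t - v).
Qed.

End Overflow.

(** * Union bound for the overflow event over a polynomial net *)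

Section ChainingBound.
Context {d : measure_display} {Omega : measurableType d} {R : realType}.
Variable P : probability Omega R.
Variable X : R -> {RV P >-> R}.
Hypothesis hX : centered_gaussian_si X.
Variables (c A0 alpha0 : R).
Hypothesis hc : 0 < c.
Hypothesis hAII : AII (sigma2 X) A0 alpha0.
Local Notation f := (sigma2 X).

Lemma sigma2_near0 : exists2 t0 : R, 0 < t0 &
  forall t : R, 0 < t < t0 -> f t <= 2 * A0 * t `^ (2 * alpha0).
Proof.
have [A00 _ h] := hAII.
have /cvgrPdist_lt/(_ 1 ltr01) := h.
move=> [t0 /= t00 h0]; exists t0 => // t /andP[tp tt0].
have := h0 t; rewrite /= sub0r normrN gtr0_norm// => /(_ tt0 tp).
have p0 : 0 < A0 * t `^ (2 * alpha0) by rewrite mulr_gt0// powR_gt0.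
rewrite ltr_norml => /andP[h1 _].
have : f t / (A0 * t `^ (2 * alpha0)) < 2 by lra.
by rewrite ltr_pdivrMr// mulrA => /ltW.
Qed.

Definition jump (t : R) (n k : nat) (e : R) : set Omega :=
  [set w | e < `|X (t * k.+1%:R / 2 ^+ n) w - X (t * k%:R / 2 ^+ n) w|].

Lemma measurable_jump t n k e : measurable (jump t n k e).
Proof.
apply: measurable_gt; apply: measurableT_comp => //.
exact: measurable_increment.
Qed.

(** Moving s to the net changes the path by at most eps / 2 unless some jump is large, and the drift
    by at most eps / 2 through the mesh size. *)
Lemma overflow_subset t u eps n0 (e : nat -> R) : 0 < t ->
  (forall J, \sum_(j < J) e j <= eps / 2) -> c * (t / 2 ^+ n0) <= eps / 2 ->
  overflow X c t u `<=`
    (\bigcup_(k < ((2 ^ n0).+1)%N) netput_gt X c t (t * k%:R / 2 ^+ n0) (u - eps))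
    `|` \bigcup_j \bigcup_(k < (2 ^ (n0 + j).+1)%N) jump t (n0 + j).+1 k (e j).
Proof.
move=> t0 he hce w [s st us].
have [h|h] := pselect ((\bigcup_j \bigcup_(k < (2 ^ (n0 + j).+1)%N)
  jump t (n0 + j).+1 k (e j)) w); [by right|left].
have cX : continuous_paths X := cgsi_continuous hX.
have hg j k : (k < 2 ^ (n0 + j).+1)%N ->
    `|X (t * k.+1%:R / 2 ^+ (n0 + j).+1) w - X (t * k%:R / 2 ^+ (n0 + j).+1) w| <= e j.
  move=> hk; rewrite leNgt; apply/negP => hj; apply: h.
  by exists j => //; exists k.
have [k [k1 k2 k3 k4]] := chaining_dist t0 (cX w) he hg st.
exists k => //=; rewrite /netput_gt/=.
set y := t * k%:R / 2 ^+ n0 in k2 k3 k4 *.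
move: k4; rewrite ler_norml => /andP[k4 _].
have : c * (s - y) <= eps / 2 by apply: le_trans hce; rewrite ler_pM2l.
by lra.
Qed.

Lemma finite_union_bound (A : nat -> set Omega) n (B : R) :
  (forall k, (k < n)%N -> measurable (A k)) ->
  (forall k, (k < n)%N -> (P (A k) <= B%:E)%E) ->
  (P (\bigcup_(k < (n)%N) A k) <= (n%:R * B)%:E)%E.
Proof.
move=> mA hA; rewrite bigcup_mkord.
apply: (le_trans (Boole_inequality P mA)).
apply: (@le_trans _ _ (\sum_(i < n) B%:E)%E).
  by apply: lee_sum => i _; exact: hA.
by rewrite sumEFin big_const_ord iter_addr_0 mulr_natl.
Qed.

Lemma jump_prob_ub t n k e V : 0 < t -> (k < 2 ^ n)%N -> f (t / 2 ^+ n) <= V -> 0 <= e ->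
  (P (jump t n k e) <= (4 * expR (- (e ^+ 2 / (2 * V))))%:E)%E.
Proof.
move=> t0 kn fV e0; apply: increment_abs_tail_ub => //.
  have p : 0 < (2 ^+ n)^-1 :> R by rewrite invr_gt0 exp2_gt.
  rewrite mulr_ge0 ?mulr_ge0 ?(ltW t0) ?(ltW p)//= ler_pM2r// ler_pM2l//.
  by rewrite ler_nat.
by rewrite -mulrBl -mulrBr -natr1 addrAC subrr add0r mulr1.
Qed.

(* The geometric tolerances kap * q^j against the standard deviations q^(2j) / u^2
   leave a Gaussian exponent D u^4 (1 + j b). *)
Lemma chain_level_ub (q kap D b u : R) (n0 j : nat) :
  0 < q < 1 -> 0 < A0 -> 0 < kap -> 0 < u ->
  D = kap ^+ 2 / (4 * A0) -> b = (q ^+ 2)^-1 - 1 ->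
  expR (- (D * u ^+ 4 * b)) <= 4^-1 ->
  16 * 2 ^+ n0 * expR (- (D * u ^+ 4)) <= expR (- u ^+ 2) ->
  2 ^+ (n0 + j).+1 *
    (4 * expR (- ((kap * q ^+ j) ^+ 2 / (2 * (2 * A0 * (u ^+ 4)^-1 * (q ^+ 4) ^+ j)))))
  <= expR (- u ^+ 2) / 2 ^+ j.+1.
Proof.
move=> /andP[q0 q1] A00 k0 u0 DE bE h1 h2.
have qj0 : 0 < q ^+ j by rewrite exprn_gt0.
have b0 : 0 <= b.
  by rewrite bE subr_ge0 invf_ge1 ?exprn_gt0// exprn_ile1// ltW.
have -> : (kap * q ^+ j) ^+ 2 / (2 * (2 * A0 * (u ^+ 4)^-1 * (q ^+ 4) ^+ j)) =
    D * u ^+ 4 * (1 + b) ^+ j.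
  have -> : (q ^+ 4) ^+ j = (q ^+ j) ^+ 4 by rewrite -!exprM mulnC.
  have -> : (1 + b) ^+ j = ((q ^+ j) ^+ 2)^-1.
    by rewrite bE addrC subrK exprVn -!exprM mulnC.
  rewrite DE; field.
  by rewrite !gt_eqF.
have D0 : 0 <= D * u ^+ 4.
  by rewrite DE mulr_ge0 ?divr_ge0 ?mulr_ge0 ?exprn_ge0// ltW.
(* By Bernoulli, (1 + b)^j >= 1 + j b, so each further level contributes a factor of at most 1/4:
   one half pays for twice as many jumps, the other makes the levels summable. *)
have h3 : expR (- (D * u ^+ 4 * (1 + b) ^+ j)) <= expR (- (D * u ^+ 4)) * (4^-1) ^+ j.
  apply: (@le_trans _ _ (expR (- (D * u ^+ 4)) * expR (- (D * u ^+ 4 * b)) ^+ j)).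
    rewrite -expRM_natr -expRD ler_expR.
    have := ler_wpM2l D0 (bernoulli_ineq j b0); lra.
  by rewrite ler_wpM2l ?expR_ge0// lerXn2r ?nnegrE ?expR_ge0// invr_ge0.
rewrite ler_pdivlMr ?exp2_gt//.
apply: (@le_trans _ _ (2 ^+ (n0 + j).+1 * (4 * (expR (- (D * u ^+ 4)) * (4^-1) ^+ j)) * 2 ^+ j.+1)).
  by rewrite ler_wpM2r ?exprn_ge0// ler_wpM2l ?exprn_ge0// ler_wpM2l.
apply: le_trans h2.
have -> : 2 ^+ (n0 + j).+1 * (4 * (expR (- (D * u ^+ 4)) * (4^-1) ^+ j)) * 2 ^+ j.+1 =
  16 * 2 ^+ n0 * expR (- (D * u ^+ 4)) * ((2 * 2 * 4^-1) ^+ j) :> R.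
  by rewrite !exprMn !exprS exprD; ring.
have -> : 2 * 2 * 4^-1 = 1 :> R by field.
by rewrite expr1n mulr1.
Qed.

Lemma dyadic_net_size (t u K : R) (m : nat) : 0 < t <= K * u -> 1 <= u ->
  2 * K + 4 <= u -> exists n0 : nat,
  t / 2 ^+ n0 <= (u ^+ m)^-1 /\ 2 ^+ n0 <= u ^+ m.+2.
Proof.
move=> /andP[t0 tK] u1 uK; have u0 : 0 < u by lra.
have um1 : 1 <= u ^+ m by rewrite exprn_ege1.
have um0 : 0 < u ^+ m by rewrite exprn_gt0.
have y0 : 0 <= t * u ^+ m by rewrite mulr_ge0// ltW.
pose M := (Num.truncn (t * u ^+ m)).+2.
have /andP[M1 M2] := truncn_itv y0.
have /andP[h1 h2] := @up_log_bounds 2 M isT isT.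
exists (up_log 2 M).
have e1 : t * u ^+ m <= 2 ^+ up_log 2 M.
  apply: (le_trans (ltW M2)); rewrite -natrX ler_nat; exact: ltnW.
have e2 : 2 ^+ up_log 2 M <= 2 * (t * u ^+ m + 2).
  have : (2 ^ up_log 2 M <= 2 * M)%N.
    case E : (up_log 2 M) h1 => [|k]; first by rewrite expn0 muln_gt0.
    by move=> /= /ltnW h1; rewrite expnS leq_mul2l h1 orbT.
  rewrite -(ler_nat R) natrM natrX => /le_trans; apply; rewrite ler_pM2l//.
  by rewrite /M -addn2 natrD lerD2r.
split.
  by rewrite ler_pdivrMr ?exp2_gt// mulrC ler_pdivlMr.
apply: (le_trans e2).
have : t * u ^+ m <= K * u * u ^+ m by rewrite ler_pM2r.
rewrite !exprS; set z := u ^+ m in um1 um0 *.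
have h3 : 1 <= u * z by rewrite mulr_ege1.
have h4 : (2 * K + 4) * (u * z) <= u * (u * z) by rewrite ler_wpM2r// (le_trans ler01).
by lra.
Qed.

(** The Taylor term of order n + 1 of the exponential already dominates. *)
Lemma poly_le_exp (u : R) n (C : R) : 0 < u -> C * (n.+1)`!%:R <= u -> 0 <= C ->
  C * u ^+ n <= expR u.
Proof.
move=> u0 hu C0.
have h := @expR_ge1Dxn R u n (ltW u0).
have f0 : 0 < (n.+1)`!%:R :> R by rewrite ltr0n fact_gt0.
apply: le_trans (_ : u ^+ n.+1 / (n.+1)`!%:R <= _); last by lra.
rewrite ler_pdivlMr// exprS mulrAC.
by rewrite ler_wpM2r// exprn_ge0// ltW.
Qed.

(** Since m alpha0 >= 2, a step of length u^(-m) has variance of order u^(-4), and each halving of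
    the step multiplies the bound by 2^(-2 alpha0) = q^4. *)
Lemma sigma2_dyadic_ub (t1 u t q : R) (m n0 j : nat) :
  (forall t : R, 0 < t < t1 -> f t <= 2 * A0 * t `^ (2 * alpha0)) ->
  0 < t1 -> 0 < t -> 1 <= u -> t1^-1 < u -> (0 < m)%N -> 2 <= m%:R * alpha0 ->
  q ^+ 4 = 2 `^ (- (2 * alpha0)) -> t / 2 ^+ n0 <= (u ^+ m)^-1 ->
  f (t / 2 ^+ (n0 + j).+1) <= 2 * A0 * (u ^+ 4)^-1 * (q ^+ 4) ^+ j.
Proof.
move=> ft1 t10 t0 u1 ut1 m0 mal q4 hn1.
have [A00 /andP[al0 al1] _] := hAII.
have u0 : 0 < u by lra.
have um : u <= u ^+ m by case: m m0 {mal hn1} => // m _; rewrite exprS ler_peMr ?exprn_ege1// ltW.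
have um0 : 0 < u ^+ m by rewrite exprn_gt0.
have h3 : t / 2 ^+ (n0 + j).+1 <= (u ^+ m)^-1 * (2 ^+ j)^-1.
  rewrite -addnS exprD invfM mulrA; apply: ler_pM => //.
  - by rewrite divr_ge0 ?exprn_ge0// ltW.
  - by rewrite lef_pV2 ?posrE ?exp2_gt// exprS ler_peMl ?exprn_ge0// ler1n.
have t20 : 0 < t / 2 ^+ (n0 + j).+1 by rewrite divr_gt0 ?exp2_gt.
have h4 : (u ^+ m)^-1 * (2 ^+ j)^-1 < t1.
  have a1 : (u ^+ m)^-1 <= u^-1 by rewrite lef_pV2 ?posrE.
  have a2 : u^-1 < t1 by move: ut1; rewrite invf_plt ?posrE.
  have a3 : (2 ^+ j)^-1 <= 1 :> R by rewrite invf_le1 ?exp2_gt// exprn_ege1// ler1n.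
  have a4 : 0 < (u ^+ m)^-1 by rewrite invr_gt0.
  have := ler_wpM2l (ltW a4) a3; lra.
apply: (le_trans (ft1 _ _)); first by rewrite t20/=; exact: le_lt_trans h4.
rewrite -[leRHS]mulrA ler_pM2l; last by rewrite mulr_gt0.
have a0 : 0 <= 2 * alpha0 by rewrite mulr_ge0// ltW.
apply: (le_trans (ge0_ler_powR a0 _ _ h3)); rewrite ?nnegrE ?(ltW t20)//.
  by apply: mulr_ge0; rewrite invr_ge0 ?(ltW um0)// exprn_ge0.
rewrite powRM ?invr_ge0 ?exprn_ge0 ?(ltW um0) ?(ltW u0)//.
apply: ler_pM => //; rewrite ?powR_ge0//.
  rewrite -!powR_invn ?(ltW u0)// -powRrM ler_powR//.
  by nra.
rewrite q4 -powR_invn// -powRrM -powR_mulrn ?powR_ge0// -powRrM.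
by rewrite le_eqVlt; apply/orP; left; apply/eqP; congr (_ `^ _); ring.
Qed.

(** The net has polynomially many points, uniformly in t <= K u, and all jump events together have
    probability at most exp(-u^2). The event [E] is carried along so that the same bound serves pi_0
    (E the whole space) and the intersection with the level event. *)
Lemma overflow_union_bound (eps K : R) : 0 < eps -> 0 < K -> exists p : nat,
  \forall u \near +oo, forall t (E : set Omega) (B : R), 0 < t <= K * u ->
  measurable E ->
  (forall s, 0 <= s <= t -> (P (E `&` netput_gt X c t s (u - eps)) <= B%:E)%E) ->
  (P (E `&` overflow X c t u) <= (u ^+ p * B + expR (- u ^+ 2))%:E)%E.
Proof.
move=> eps0 K0.
have [A00 /andP[al0 al1] _] := hAII.
have [t1 t10 ft1] := sigma2_near0.
pose m := (Num.truncn (2 / alpha0)).+1.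
have mal : 2 <= m%:R * alpha0.
  have h : 0 <= 2 / alpha0 by rewrite divr_ge0// ltW.
  have /andP[_ h1] := truncn_itv h.
  by rewrite -ler_pdivrMr// ltW.
pose r : R := 2 `^ (- (2 * alpha0)).
have r0 : 0 < r by rewrite powR_gt0.
have r1 : r < 1.
  rewrite /r powRN invf_lt1 ?powR_gt0//.
  have := @gt0_ltr_powR R (2 * alpha0) (ltac:(by rewrite mulr_gt0)) 1 2.
  rewrite powR1 !nnegrE; apply; lra.
(* With variances decaying like q^(4 j), tolerances q^j are summable and yet decay more slowly than
   the standard deviations q^(2 j). *)
pose q := Num.sqrt (Num.sqrt r).
have q4 : q ^+ 4 = r.
  by rewrite (exprM q 2 2) !sqr_sqrtr ?sqrtr_ge0// ltW.
have q0 : 0 < q by rewrite !sqrtr_gt0.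
have q1 : q < 1.
  by rewrite -(@ltr_pXn2r R 4)// ?nnegrE ?ltW// q4 expr1n.
(* The factor 1 - q normalises the geometric series, so that all tolerances sum to at most eps /
   2. *)
pose kap := eps / 2 * (1 - q).
have k0 : 0 < kap by rewrite mulr_gt0 ?divr_gt0// subr_gt0.
pose D := kap ^+ 2 / (4 * A0).
have D0 : 0 < D by rewrite divr_gt0 ?exprn_gt0// mulr_gt0.
have DE : D = kap ^+ 2 / (4 * A0) by [].
clearbody D.
pose b := (q ^+ 2)^-1 - 1.
have b0 : 0 < b.
  by rewrite subr_gt0 invf_gt1 ?exprn_gt0// exprn_ilt1// ltW.
have bE : b = (q ^+ 2)^-1 - 1 by [].
clearbody b.
have Db0 : 0 < D * b by exact: mulr_gt0.
pose e j := kap * q ^+ j.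
have e0 j : 0 <= e j by rewrite mulr_ge0 ?exprn_ge0// ltW.
have se J : \sum_(j < J) e j <= eps / 2.
  rewrite -mulr_sumr.
  have h : (1 - q) * \sum_(j < J) q ^+ j = 1 - q ^+ J by rewrite -[RHS]opprB subrX1; ring.
  rewrite /kap -mulrA h.
  have hq : 0 <= q ^+ J by rewrite exprn_ge0// ltW.
  by have := mulr_ge0 (ltW eps0) hq; lra.
exists m.+3; near=> u => t E B /andP[t0 tK] mE hB.
have u2 : 2 <= u by [].
have uK : 2 * K + 4 <= u by [].
have uc : 2 * c / eps <= u by [].
have uD : 3 / (D * b) <= u by [].
have uD2 : 2 / D <= u by [].
have ut1 : t1^-1 < u by near: u; apply: nbhs_pinfty_gt; exact: num_real.
have uf : 16 * m.+3`!%:R <= u by near: u; apply: nbhs_pinfty_ge; exact: num_real.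
have u0 : 0 < u by lra.
have u1 : 1 <= u by lra.
have t0K : 0 < t <= K * u by rewrite t0.
have [n0 [hn1 hn2]] := dyadic_net_size m t0K u1 uK.
have um : u <= u ^+ m by rewrite /m exprS ler_peMr ?exprn_ege1// ltW.
have um0 : 0 < u ^+ m by rewrite exprn_gt0.
have tn0 : t / 2 ^+ n0 <= u^-1 by apply: (le_trans hn1); rewrite lef_pV2 ?posrE.
have hce : c * (t / 2 ^+ n0) <= eps / 2.
  apply: (@le_trans _ _ (c * u^-1)); first by rewrite ler_pM2l.
  rewrite ler_pdivrMr//.
  by move: uc; rewrite ler_pdivrMr//; lra.
have B0 : 0 <= B.
  by rewrite -lee_fin; apply: le_trans (hB 0 _); rewrite ?lexx ?(ltW t0).
have h1 : expR (- (D * u ^+ 4 * b)) <= 4^-1.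
  rewrite expRN lef_pV2 ?posrE ?expR_gt0//.
  apply: le_trans (expR_ge1Dx _).
  move: uD; rewrite (ler_pdivrMr _ _ Db0) => h3.
  have h4 : u <= u ^+ 4 by rewrite exprS ler_peMr ?exprn_ege1// ltW.
  have := ler_wpM2r (ltW (mulr_gt0 D0 b0)) h4.
  lra.
have h2 : 16 * 2 ^+ n0 * expR (- (D * u ^+ 4)) <= expR (- u ^+ 2).
  rewrite expRN ler_pdivrMr ?expR_gt0// -expRD.
  apply: (@le_trans _ _ (16 * u ^+ m.+2)); first by rewrite ler_pM2l.
  apply: (@le_trans _ _ (expR u)).
    by apply: poly_le_exp => //; lra.
  rewrite ler_expR.
  move: uD2; rewrite ler_pdivrMr// => h3.
  have h4 : 2 * u ^+ 3 <= D * u ^+ 4.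
    by rewrite [u ^+ 4]exprS mulrA ler_wpM2r ?exprn_ge0 1?mulrC// ltW.
  have h5 : u ^+ 2 <= u ^+ 3 by rewrite [leRHS]exprS ler_peMl ?exprn_ge0// ltW.
  have h6 : u <= u ^+ 2 by rewrite expr2 ler_peMl// ltW.
  lra.
have fV j : f (t / 2 ^+ (n0 + j).+1) <= 2 * A0 * (u ^+ 4)^-1 * (q ^+ 4) ^+ j.
  exact: (@sigma2_dyadic_ub t1 u t q m n0 j).
have mb j : measurable (\bigcup_(k < (2 ^ (n0 + j).+1)%N) jump t (n0 + j).+1 k (e j)).
  by apply: bigcup_measurable => k _; exact: measurable_jump.
have mbb : measurable (\bigcup_j \bigcup_(k < (2 ^ (n0 + j).+1)%N)
    jump t (n0 + j).+1 k (e j)) by exact: bigcupT_measurable.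
have mA : measurable (\bigcup_(k < ((2 ^ n0).+1)%N)
    (E `&` netput_gt X c t (t * k%:R / 2 ^+ n0) (u - eps))).
  by apply: bigcup_measurable => k _; apply: measurableI => //; exact: measurable_netput_gt.
have Pb : (P (\bigcup_j \bigcup_(k < (2 ^ (n0 + j).+1)%N)
    jump t (n0 + j).+1 k (e j)) <= (expR (- u ^+ 2))%:E)%E.
  apply: (le_trans (generalized_Boole_inequality P mb mbb)).
  apply: (le_trans _ (epsilon_trick0 xpredT (expR_ge0 (- u ^+ 2)))).
  apply: lee_nneseries => [//|j _].
  apply: (@le_trans _ _ ((2 ^ (n0 + j).+1)%N%:R *
    (4 * expR (- ((kap * q ^+ j) ^+ 2 / (2 * (2 * A0 * (u ^+ 4)^-1 * (q ^+ 4) ^+ j))))))%:E).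
    apply: finite_union_bound => k kn; first exact: measurable_jump.
    exact: jump_prob_ub.
  rewrite lee_fin !natrX.
  by apply: (@chain_level_ub q kap D b u n0 j) => //; rewrite q0 q1.
have PA : (P (\bigcup_(k < ((2 ^ n0).+1)%N)
    (E `&` netput_gt X c t (t * k%:R / 2 ^+ n0) (u - eps))) <= ((2 ^ n0).+1%:R * B)%:E)%E.
  apply: finite_union_bound => k kn.
    by apply: measurableI => //; exact: measurable_netput_gt.
  apply: hB; rewrite divr_ge0 ?exprn_ge0 ?mulr_ge0 ?(ltW t0)//=.
  by rewrite ler_pdivrMr ?exp2_gt// ler_pM2l// -natrX ler_nat.
have mO := measurable_overflow hX hc u t0.
apply: (@le_trans _ _ (P ((\bigcup_(k < ((2 ^ n0).+1)%N)
    (E `&` netput_gt X c t (t * k%:R / 2 ^+ n0) (u - eps))) `|`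
    \bigcup_j \bigcup_(k < (2 ^ (n0 + j).+1)%N) jump t (n0 + j).+1 k (e j)))).
  apply: le_measure; rewrite ?inE; [exact: measurableI|exact: measurableU|].
  move=> w [Ew /(overflow_subset t0 se hce)[[k kn hk]|h]]; last by right.
  by left; exists k.
apply: (le_trans (measureU2 P mA mbb)).
rewrite EFinD; apply: leeD => //; apply: (le_trans PA); rewrite lee_fin.
rewrite ler_wpM2r// -natr1 natrX exprS.
have h3 : 1 <= u ^+ m.+2 by rewrite exprn_ege1.
by nra.
Unshelve. all: by end_near. Qed.

End ChainingBound.

(** * Real analysis: Taylor bounds, monotone density, weighted AM-GM *)

Section Calculus.
Context {R : realType}.
Implicit Types (F : R -> R).

Lemma cvg_pinfty_near_lt F (l e : R) : F x @[x --> +oo] --> l -> 0 < e ->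
  \forall x \near +oo, `|F x - l| < e.
Proof. by move=> h e0; exact: (@cvgr_distC_lt _ R^o _ _ _ _ _ h). Qed.

Lemma near_pinfty_ge (y : R) : \forall x \near +oo, y <= x.
Proof. by apply: nbhs_pinfty_ge; exact: num_real. Qed.

Lemma near_pinfty_gt (y : R) : \forall x \near +oo, y < x.
Proof. by apply: nbhs_pinfty_gt; exact: num_real. Qed.

Lemma mean_value F F' (x y : R) : x < y ->
  (forall z, x <= z <= y -> is_derive z 1 F (F' z)) ->
  exists2 z, x < z < y & F y - F x = F' z * (y - x).
Proof.
move=> xy h.
have [||z] := @MVT _ F F' x y xy.
- by move=> z; rewrite in_itv/= => /andP[xz zy]; apply: h; rewrite !ltW.
- apply: derivable_within_continuous => z; rewrite in_itv/= => hz.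
  by apply: ex_derive; exact: h.
- by rewrite in_itv/= => hz e; exists z.
Qed.

Lemma mean_value_sym F F' (x y : R) :
  (forall z, Num.min x y <= z <= Num.max x y -> is_derive z 1 F (F' z)) ->
  exists2 z, Num.min x y <= z <= Num.max x y & F y - F x = F' z * (y - x).
Proof.
have [xy|yx|->] := ltgtP x y => h.
- have [z /andP[xz zy] e] := mean_value xy h.
  by exists z => //; rewrite !ltW.
- have [z /andP[xz zy] e] := mean_value yx h.
  by exists z; [rewrite !ltW|rewrite -opprB e; ring].
- by exists y; [rewrite lexx|rewrite !subrr mulr0].
Qed.

(* Taylor at a critical point x: the remainder against k (y - x)^2 / 2 has the
   sign of F'' - k at an intermediate point. *)
Lemma taylor_critical F F1 F2 (x y k : R) :
  (forall z, Num.min x y <= z <= Num.max x y -> is_derive z 1 F (F1 z)) ->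
  (forall z, Num.min x y <= z <= Num.max x y -> is_derive z 1 F1 (F2 z)) ->
  F1 x = 0 -> exists z th, [/\ Num.min x y <= z <= Num.max x y, 0 <= th &
    F y - F x - k / 2 * (y - x) ^+ 2 = (F2 z - k) * th].
Proof.
move=> h1 h2 F10.
have hD z : Num.min x y <= z <= Num.max x y ->
    is_derive z 1 (fun z => F z - k / 2 * (z - x) ^+ 2) (F1 z - k * (z - x)).
  move=> hz; have h := h1 z hz.
  apply: is_derive_eq; rewrite /GRing.scale/= /cst/=.
  by rewrite !(mulr0, mulr1, mul0r, addr0, subr0, add0r); field.
have [z hz e] := mean_value_sym hD.
have hz2 z' : Num.min x z <= z' <= Num.max x z -> Num.min x y <= z' <= Num.max x y.
  move: hz => /andP[z1 z2] /andP[z3 z4]; apply/andP; split.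
    by apply: le_trans z3; rewrite le_min z1 andbT ge_min lexx.
  by apply: (le_trans z4); rewrite ge_max z2 andbT le_max lexx.
have [z' hz' e'] := mean_value_sym (fun z0 h => h2 z0 (hz2 z0 h)).
exists z', ((z - x) * (y - x)); split; first exact: hz2.
- move: hz; case: (leP x y) => xy /andP[z1 z2].
    by rewrite mulr_ge0// subr_ge0.
  by rewrite mulr_le0// subr_le0// ltW.
- move: e; rewrite subrr expr0n/= mulr0 subr0 => e.
  by rewrite addrAC e; move: e'; rewrite F10 subr0 => ->; ring.
Qed.

Lemma powRS_sub1 (t rho : R) : 0 < t -> t `^ rho = t * t `^ (rho - 1).
Proof.
move=> t0; rewrite -{2}(powRr1 (ltW t0)) -powRD ?subrKC//.
by rewrite (gt_eqF t0) implybT.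
Qed.

Lemma powR_diff_quotient (rho e : R) : 0 < e ->
  exists2 del, 0 < del & forall h, h != 0 -> `|h| < del ->
    `|(1 + h) `^ rho - 1 - rho * h| <= e * `|h|.
Proof.
move=> e0; have := is_derive1_powR rho (@ltr01 R).
rewrite powR1 mulr1 => -[dr dv].
have : h^-1 *: (((powR (R:=R))^~ rho \o shift 1) (h *: 1) - 1 `^ rho) @[h --> 0^'] --> rho.
  by rewrite -[X in _ --> X]dv; exact: dr.
move=> /cvgrPdist_lt/(_ _ e0) [del /= d0 H]; exists del => // h hn0 hd.
have := H h; rewrite /= sub0r normrN => /(_ hd hn0).
rewrite powR1 /GRing.scale/= mulr1 /shift/= => /ltW.
rewrite -(ler_pM2r (_ : 0 < `|h|)) ?normr_gt0// -normrM.
by congr (_ <= _); rewrite -normrN; congr (`|_|); rewrite [h + 1]addrC; field.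
Qed.

Lemma cvg_powR_scale F (rho B s : R) : 0 < s ->
  F t / t `^ rho @[t --> +oo] --> B -> F (t * s) / t `^ rho @[t --> +oo] --> B * s `^ rho.
Proof.
move=> s0 cF.
have : (F (t * s) / (t * s) `^ rho) * s `^ rho @[t --> +oo] --> B * s `^ rho.
  apply: cvgM; last exact: cvg_cst.
  apply: (cvg_comp (fun t => t * s) (fun t => F t / t `^ rho)) cF.
  by apply: gt0_cvgMly => //; exact: cvg_id.
apply: cvg_trans; apply: near_eq_cvg; near=> t.
have t0 : 0 < t by near: t; exact: near_pinfty_gt.
rewrite powRM ?ltW//; field.
by rewrite !gt_eqF ?powR_gt0.
Unshelve. all: by end_near. Qed.

(** For h of either sign, monotonicity of F' gives h t F'(t) <= F(t (1 + h)) - F(t). After division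
    by t^rho the right side tends to B ((1 + h)^rho - 1), which is B rho h up to a small multiple of
    |h|. A small positive h yields the upper bound, its opposite the lower one. *)
Lemma monotone_density_incr F F' (rho B t0 : R) :
  (forall t : R, 0 < t -> is_derive t 1 F (F' t)) ->
  {in `[t0, +oo[ &, {homo F' : s t / s <= t}} ->
  F t / t `^ rho @[t --> +oo] --> B ->
  F' t / t `^ (rho - 1) @[t --> +oo] --> B * rho.
Proof.
move=> dF monF cF.
have key h : -1 < h -> \forall t \near +oo,
    h * (F' t / t `^ (rho - 1)) <= F (t * (1 + h)) / t `^ rho - F t / t `^ rho.
  move=> h1; have s0 : 0 < 1 + h by lra.
  near=> t.
  have tp : 0 < t by near: t; exact: near_pinfty_gt.
  have tt0 : t0 <= t by near: t; exact: near_pinfty_ge.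
  have tt1 : t0 / (1 + h) <= t by near: t; exact: near_pinfty_ge.
  have ts0 : t0 <= t * (1 + h) by rewrite -ler_pdivrMr.
  have tsp : 0 < t * (1 + h) by rewrite mulr_gt0.
  have hd z : Num.min t (t * (1 + h)) <= z <= Num.max t (t * (1 + h)) ->
      is_derive z 1 F (F' z).
    move=> /andP[hz _]; apply: dF; apply: lt_le_trans hz.
    by rewrite lt_min tp tsp.
  have [z /andP[hz1 hz2] e] := mean_value_sym hd.
  have zt0 : t0 <= z by apply: le_trans hz1; rewrite le_min tt0 ts0.
  have hF : F' t * (t * h) <= F (t * (1 + h)) - F t.
    rewrite e (_ : t * (1 + h) - t = t * h); last by ring.
    have [h0|h0] := leP 0 h.
      rewrite ler_wpM2r ?mulr_ge0 ?(ltW tp)//; apply: monF; rewrite ?in_itv/= ?tt0 ?zt0//.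
      by apply: le_trans hz1; rewrite le_min lexx; nra.
    have th0 : t * h <= 0 by rewrite pmulr_rle0// ltW.
    rewrite ler_wnM2r//.
    apply: monF; rewrite ?in_itv/= ?tt0 ?zt0//.
    by apply: (le_trans hz2); rewrite ge_max lexx/=; nra.
  have p0 : 0 < t `^ rho by rewrite powR_gt0.
  rewrite -mulrBl ler_pdivlMr//; apply: le_trans hF.
  rewrite (powRS_sub1 rho tp) le_eqVlt; apply/orP; left; apply/eqP; field.
  by rewrite gt_eqF ?powR_gt0.
have lim h : -1 < h ->
    F (t * (1 + h)) / t `^ rho - F t / t `^ rho @[t --> +oo] --> B * (1 + h) `^ rho - B.
  by move=> h1; apply: (@cvgB _ R^o) => //; apply: cvg_powR_scale => //; lra.
apply/cvgrPdist_le => e e0.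
pose e1 := e / (2 * (1 + `|B|)).
have B1 : 0 < 1 + `|B| by have := normr_ge0 B; lra.
have e10 : 0 < e1 by rewrite divr_gt0 ?mulr_gt0.
have e1E : `|B| * e1 <= e / 2.
  rewrite /e1 invfM mulrA [X in _ <= X]mulrC mulrC -mulrA -[leRHS]mulr1 mulrC.
  have : `|B| / (1 + `|B|) <= 1 by rewrite ler_pdivrMr// mul1r; have := normr_ge0 B; lra.
  by move=> hB; nra.
have [del d0 hdel] := powR_diff_quotient rho e10.
pose h := Num.min (2^-1) (del / 2).
have h0 : 0 < h by rewrite lt_min invr_gt0 ltr0n divr_gt0.
have hh : h <= 2^-1 by rewrite ge_min lexx.
have hd : h < del by apply: (@le_lt_trans _ _ (del / 2)); [rewrite ge_min lexx orbT|lra].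
have bd h' : h' != 0 -> `|h'| = h -> B * (1 + h') `^ rho - B <= h' * (B * rho) + h * (e / 2).
  move=> hn0 hE; have := hdel h' hn0; rewrite hE => /(_ hd) q.
  have : B * ((1 + h') `^ rho - 1 - rho * h') <= `|B| * (e1 * h).
    by apply: (le_trans (ler_norm _)); rewrite normrM ler_wpM2l.
  have : `|B| * (e1 * h) <= h * (e / 2) by rewrite mulrA [leRHS]mulrC ler_pM2r.
  lra.
have hm1 : -1 < - h by lra.
have hp1 : -1 < h by lra.
have he : 0 < h * (e / 2) by rewrite mulr_gt0 ?divr_gt0.
have b1 := bd h (lt0r_neq0 h0) (gtr0_norm h0).
have b2 : B * (1 + - h) `^ rho - B <= (- h) * (B * rho) + h * (e / 2).
  by apply: bd; rewrite ?oppr_eq0 ?lt0r_neq0// normrN gtr0_norm.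
apply: filterS (filterI (key _ hp1) (filterI (key _ hm1)
  (filterI (cvg_pinfty_near_lt (lim _ hp1) he) (cvg_pinfty_near_lt (lim _ hm1) he)))) =>
  t [k1 [k2 [l1 l2]]].
move: l1 l2; rewrite !ltr_norml => /andP[_ l1] /andP[_ l2].
set W := F' t / t `^ (rho - 1) in k1 k2 *.
rewrite ler_norml; apply/andP; split; rewrite -(ler_pM2l h0); lra.
Unshelve. all: by end_near. Qed.

Lemma monotone_density F F' (rho B : R) :
  (forall t : R, 0 < t -> is_derive t 1 F (F' t)) -> ultimately_monotone F' ->
  F t / t `^ rho @[t --> +oo] --> B ->
  F' t / t `^ (rho - 1) @[t --> +oo] --> B * rho.
Proof.
move=> dF [t0 [mF|mF]] cF; first exact: monotone_density_incr dF mF cF.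
have dN (t : R) : 0 < t -> is_derive t 1 (\- F) (- F' t).
  by move=> t0'; have := dF t t0' => h; apply: is_deriveN.
have mN : {in `[t0, +oo[ &, {homo (\- F') : s t / s <= t}}.
  by move=> s t hs ht st; rewrite /= lerN2; apply: mF.
have cN : (\- F) t / t `^ rho @[t --> +oo] --> - B.
  under eq_fun do rewrite mulNr.
  exact: (@cvgN _ R^o).
have := monotone_density_incr dN mN cN.
rewrite mulNr => /(@cvgN _ R^o); rewrite opprK => h.
apply: cvg_trans h; apply: near_eq_cvg; apply: nearW => t.
by rewrite !fctE/= mulNr opprK.
Qed.

(** Apply ln z <= z - 1 at y / w and at 1 / w, where w is the right-hand side. The weights a and 1 -
    a average these two points to 1, so the bounds sum to 0; the second one is strict as w differs
    from 1. *)
Lemma bernoulli_powR_lt (y a : R) : 0 < y -> y != 1 -> 0 < a < 1 ->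
  y `^ a < 1 + a * (y - 1).
Proof.
move=> y0 y1 /andP[a0 a1].
set w := 1 + a * (y - 1).
have w0 : 0 < w by rewrite /w; nra.
have w1 : w != 1.
  by rewrite /w -subr_eq0 addrAC subrr add0r mulf_neq0 ?subr_eq0// gt_eqF.
rewrite -ltr_ln ?posrE ?powR_gt0// ln_powR.
have h1 : ln (y / w) <= y / w - 1.
  have := expR_ge1Dx (ln (y / w)); rewrite lnK ?posrE ?divr_gt0//; lra.
have h2 : ln w^-1 < w^-1 - 1.
  have : ln w^-1 != 0 by rewrite ln_eq0 ?invr_gt0// invr_eq1.
  by move=> /expR_gt1Dx; rewrite lnK ?posrE ?invr_gt0//; lra.
rewrite ln_div ?posrE// in h1; rewrite lnV ?posrE// in h2.
have h3 : a * (y / w - 1) + (1 - a) * (w^-1 - 1) = 0.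
  rewrite (_ : _ + _ = (1 + a * (y - 1)) / w - 1); last by field; rewrite gt_eqF.
  by rewrite divff ?subrr ?gt_eqF.
have := ler_wpM2l (ltW a0) h1.
have : (1 - a) * (- ln w) < (1 - a) * (w^-1 - 1) by rewrite ltr_pM2l// subr_gt0.
lra.
Qed.

Lemma bernoulli_powR (y a : R) : 0 < y -> 0 < a < 1 -> y `^ a <= 1 + a * (y - 1).
Proof.
move=> y0 ha; have [->|y1] := eqVneq y 1; first by rewrite powR1; lra.
exact/ltW/bernoulli_powR_lt.
Qed.

(* The weighted AM-GM gap (1 - a) + a r >= r^a grows as r moves away from 1;
   concavity of r^a at r0 propagates the gap beyond r0. *)
Lemma amgm_gap (a r r0 del : R) : 0 < a < 1 -> 0 < r0 -> 0 < r ->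
  0 <= (r - r0) * (1 - r0^-1) -> (1 + del) * r0 `^ a <= (1 - a) + a * r0 -> 0 <= del ->
  (1 + del) * r `^ a <= (1 - a) + a * r.
Proof.
move=> ha r00 r0' hr h d0; have /andP[a0 a1] := ha.
have -> : r = r0 * (r / r0) by field; rewrite gt_eqF.
rewrite (powRM _ (ltW r00) (ltW (divr_gt0 r0' r00))).
have hb := bernoulli_powR (divr_gt0 r0' r00) ha.
apply: (@le_trans _ _ ((1 + del) * r0 `^ a * (1 + a * (r / r0 - 1)))).
  by rewrite mulrA ler_wpM2l// mulr_ge0 ?powR_ge0//; lra.
have p0 : 0 <= 1 + a * (r / r0 - 1).
  by have := divr_gt0 r0' r00; nra.
apply: (le_trans (ler_wpM2r p0 h)).
rewrite -subr_ge0.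
have -> : 1 - a + a * (r0 * (r / r0)) - (1 - a + a * r0) * (1 + a * (r / r0 - 1)) =
   a * (1 - a) * ((r - r0) * (1 - r0^-1)) by field; rewrite gt_eqF.
by apply: mulr_ge0 => //; apply: mulr_ge0; lra.
Qed.

(** A positive gap at the two points 1 - eta and 1 + eta propagates outwards by [amgm_gap]; [del] is
    the smaller of the two gaps. *)
Lemma amgm_gap_unif (a eta : R) : 0 < a < 1 -> 0 < eta < 1 -> exists2 del, 0 < del &
  forall r, 0 < r -> eta <= `|r - 1| -> (1 + del) * r `^ a <= (1 - a) + a * r.
Proof.
move=> ha /andP[e0 e1].
have gap r0 : 0 < r0 -> r0 != 1 -> exists2 del, 0 < del &
    (1 + del) * r0 `^ a <= (1 - a) + a * r0.
  move=> r00 r01; have p0 : 0 < r0 `^ a by rewrite powR_gt0.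
  exists (((1 - a) + a * r0) / r0 `^ a - 1).
    rewrite subr_gt0 ltr_pdivlMr// mul1r.
    by have := bernoulli_powR_lt r00 r01 ha; lra.
  by rewrite subrKC divfK// gt_eqF.
have [d1 d10 h1] : exists2 del, 0 < del & (1 + del) * (1 + eta) `^ a <= (1 - a) + a * (1 + eta).
  by apply: gap; [lra|rewrite gt_eqF//; lra].
have [d2 d20 h2] : exists2 del, 0 < del & (1 + del) * (1 - eta) `^ a <= (1 - a) + a * (1 - eta).
  by apply: gap; [lra|rewrite lt_eqF//; lra].
exists (Num.min d1 d2); first by rewrite lt_min d10.
have m0 : 0 <= Num.min d1 d2 by rewrite le_min !ltW.
have m1 : Num.min d1 d2 <= d1 by rewrite ge_min lexx.
have m2 : Num.min d1 d2 <= d2 by rewrite ge_min lexx orbT.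
move=> r r0; rewrite ler_normr => /orP[h|h].
- apply: (@amgm_gap a r (1 + eta)) => //; first by lra.
    rewrite mulr_ge0//; first by lra.
    by rewrite subr_ge0 invf_le1; lra.
  by apply: le_trans h1; rewrite ler_wpM2r ?powR_ge0//; lra.
- apply: (@amgm_gap a r (1 - eta)) => //; first by lra.
    rewrite mulr_le0//; first by lra.
    by rewrite subr_le0 invf_ge1; lra.
  by apply: le_trans h2; rewrite ler_wpM2r ?powR_ge0//; lra.
Qed.

End Calculus.

(* With s = t / u, (u + c t)^2 / sigma^2(t) is close to u^(2 - 2 a) G(s) for
   G(s) = (1 + c s)^2 / (A s^(2 a)); G is minimal at crit_point, with value
   min_value, and curvature is (ln G)'' there. *)
Definition crit_point {R : realType} (a c : R) : R := a / (c * (1 - a)).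

Definition min_value {R : realType} (A a c : R) : R :=
  (1 + c * crit_point a c) ^+ 2 / (A * crit_point a c `^ (2 * a)).

Definition curvature {R : realType} (a c : R) : R :=
  2 * a * (1 - a) / crit_point a c ^+ 2.

(** The logarithm of the squared ratio separates drift from variance: its two derivatives involve f
    only through f'/f and (ln f)'', whose limits after scaling by t and t^2 depend on a alone. *)
Definition log_ratio {R : realType} (f : R -> R) (c u t : R) : R :=
  2 * ln (u + c * t) - ln (f t).

Definition log_ratio1 {R : realType} (f : R -> R) (c u t : R) : R :=
  2 * c / (u + c * t) - derive1 f t / f t.

Definition log_ratio2 {R : realType} (f : R -> R) (c u t : R) : R :=
  - (2 * c ^+ 2 / (u + c * t) ^+ 2) -
  (derive1 (derive1 f) t / f t - (derive1 f t / f t) ^+ 2).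

(** * Regular variation of the variance and location of the minimiser *)

Section VarianceAsymptotics.
Context {R : realType}.
Variables (f : R -> R) (A a c : R).
Hypothesis hAI : AI f A a.
Hypothesis hc : 0 < c.
Hypothesis hf0 : forall t, 0 <= t -> 0 <= f t.
(** AI gives no control of f near 0; this bound is later derived from AII and serves to dispose of
    small t. *)
Hypothesis hb0 : exists2 t0 : R, 0 < t0 & exists C : R, forall t, 0 <= t < t0 -> f t <= C.
Local Notation f1 := (derive1 f).
Local Notation f2 := (derive1 (derive1 f)).

Let A_gt0 : 0 < A. Proof. exact: AI_A_gt0 hAI. Qed.
Let a01 : 0 < a < 1. Proof. exact: AI_alpha_bounds hAI. Qed.

Local Notation tau := (crit_point a c).
Local Notation Q_ u := (u `^ (2 - 2 * a)).
Local Notation G0 := (min_value A a c).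
Local Notation k0 := (curvature a c).
Local Notation logm := (log_ratio f c).
Local Notation logm1 := (log_ratio1 f c).
Local Notation logm2 := (log_ratio2 f c).

Lemma tau_gt0 : 0 < tau.
Proof. by have /andP[h1 h2] := a01; rewrite /crit_point divr_gt0// mulr_gt0// subr_gt0. Qed.

Lemma ctauE : c * tau = a / (1 - a).
Proof.
have /andP[h1 h2] := a01; rewrite /crit_point; field.
by rewrite !gt_eqF// subr_gt0.
Qed.

Lemma G0_gt0 : 0 < G0.
Proof.
have h := tau_gt0; rewrite divr_gt0 ?exprn_gt0 ?mulr_gt0 ?powR_gt0//.
by have := mulr_gt0 hc h; lra.
Qed.

Lemma k0_gt0 : 0 < k0.
Proof.
have /andP[h1 h2] := a01; have h := tau_gt0.
rewrite divr_gt0 ?exprn_gt0// mulr_gt0 ?subr_gt0//.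
by rewrite mulr_gt0.
Qed.

Lemma is_derive_f (t : R) : 0 < t -> is_derive t 1 f (f1 t).
Proof.
move=> t0; have [h _ _] := AI_C2 hAI t0.
by rewrite derive1E; exact: derivableP.
Qed.

Lemma is_derive_f1 (t : R) : 0 < t -> is_derive t 1 f1 (f2 t).
Proof.
move=> t0; have [_ h _] := AI_C2 hAI t0.
by rewrite [f2 t]derive1E; exact: derivableP.
Qed.

Lemma cvg_f_ratio : f t / t `^ (2 * a) @[t --> +oo] --> A.
Proof.
have := AI_equiv hAI; rewrite /asymp_eq_infty /asymp_eq => h.
have : f t / (A * t `^ (2 * a)) * A @[t --> +oo] --> 1 * A.
  by apply: cvgM h _; exact: cvg_cst.
rewrite mul1r; apply: cvg_trans; apply: near_eq_cvg; near=> t.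
have t0 : 0 < t by near: t; exact: near_pinfty_gt.
by field; rewrite !gt_eqF ?powR_gt0.
Unshelve. all: by end_near. Qed.

Lemma cvg_f1_ratio : f1 t / t `^ (2 * a - 1) @[t --> +oo] --> A * (2 * a).
Proof. exact: monotone_density is_derive_f (AI_mono1 hAI) cvg_f_ratio. Qed.

Lemma cvg_f2_ratio : f2 t / t `^ (2 * a - 1 - 1) @[t --> +oo] --> A * (2 * a) * (2 * a - 1).
Proof. exact: monotone_density is_derive_f1 (AI_mono2 hAI) cvg_f1_ratio. Qed.

Lemma near_f_gt0 : \forall t \near +oo, 0 < f t.
Proof.
near=> t; have t0 : 0 < t by near: t; exact: near_pinfty_gt.
have : `|f t / t `^ (2 * a) - A| < A.
  by near: t; exact: cvg_pinfty_near_lt cvg_f_ratio A_gt0.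
rewrite ltr_norml => /andP[h _].
have : 0 < f t / t `^ (2 * a) by lra.
by rewrite pmulr_lgt0// invr_gt0 powR_gt0.
Unshelve. all: by end_near. Qed.

Lemma cvg_inv_f_ratio : t `^ (2 * a) / f t @[t --> +oo] --> A^-1.
Proof.
have h : (f t / t `^ (2 * a))^-1 @[t --> +oo] --> A^-1.
  by apply: cvgV; [rewrite gt_eqF|exact: cvg_f_ratio].
by apply: cvg_trans h; apply: near_eq_cvg; apply: nearW => t; rewrite invf_div.
Qed.

Lemma cvg_elasticity1 : t * f1 t / f t @[t --> +oo] --> 2 * a.
Proof.
have : (f1 t / t `^ (2 * a - 1)) * (t `^ (2 * a) / f t) @[t --> +oo] --> A * (2 * a) * A^-1.
  exact: cvgM cvg_f1_ratio cvg_inv_f_ratio.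
rewrite mulrAC divff ?gt_eqF// mul1r; apply: cvg_trans; apply: near_eq_cvg; near=> t.
have t0 : 0 < t by near: t; exact: near_pinfty_gt.
have ft : 0 < f t by near: t; exact: near_f_gt0.
rewrite /= (powRS_sub1 (2 * a) t0); field.
by rewrite !gt_eqF ?powR_gt0.
Unshelve. all: by end_near. Qed.

Lemma cvg_elasticity2 : t ^+ 2 * f2 t / f t @[t --> +oo] --> 2 * a * (2 * a - 1).
Proof.
have : (f2 t / t `^ (2 * a - 1 - 1)) * (t `^ (2 * a) / f t) @[t --> +oo] -->
    A * (2 * a) * (2 * a - 1) * A^-1.
  exact: cvgM cvg_f2_ratio cvg_inv_f_ratio.
have -> : A * (2 * a) * (2 * a - 1) * A^-1 = 2 * a * (2 * a - 1).
  by field; rewrite gt_eqF.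
apply: cvg_trans; apply: near_eq_cvg; near=> t.
have t0 : 0 < t by near: t; exact: near_pinfty_gt.
have ft : 0 < f t by near: t; exact: near_f_gt0.
rewrite /= (powRS_sub1 (2 * a) t0) (powRS_sub1 (2 * a - 1) t0); field.
by rewrite !gt_eqF ?powR_gt0.
Unshelve. all: by end_near. Qed.

(** The expression is t^2 (ln f)'', and 2 a (2 a - 1) - (2 a)^2 = - 2 a. *)
Lemma cvg_logconvexity :
  t ^+ 2 * (f2 t / f t - (f1 t / f t) ^+ 2) @[t --> +oo] --> - (2 * a).
Proof.
have : t ^+ 2 * f2 t / f t - (t * f1 t / f t) * (t * f1 t / f t) @[t --> +oo] -->
    2 * a * (2 * a - 1) - 2 * a * (2 * a).
  apply: (@cvgB _ R^o); first exact: cvg_elasticity2.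
  by apply: cvgM; exact: cvg_elasticity1.
rewrite (_ : _ - _ = - (2 * a)); last by ring.
apply: cvg_trans; apply: near_eq_cvg; near=> t.
have ft : 0 < f t by near: t; exact: near_f_gt0.
by field; rewrite gt_eqF.
Unshelve. all: by end_near. Qed.

(** Passes from independent limits, s to tau and t to infinity, to t = s u: as eta < tau, the whole
    window |t / u - tau| <= eta moves to infinity with u. *)
Lemma near_prod_scale (P : R -> R -> Prop) :
  (\forall s \near tau & t \near +oo, P s t) ->
  exists2 eta, 0 < eta < tau & \forall u \near +oo, forall t, `|t / u - tau| <= eta -> P (t / u) t.
Proof.
have tau0 := tau_gt0.
move=> [[Q1 Q2] /= [[e /= e0 h1] h2] h].
exists (Num.min (e / 2) (tau / 2)).
  apply/andP; split; first by rewrite lt_min; apply/andP; split; apply: divr_gt0.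
  apply: (@le_lt_trans _ _ (tau / 2)); last by rewrite ltr_pdivrMr// mulr_natr mulr2n ltrDl.
  by rewrite ge_min lexx orbT.
case: h2 => M [_ hM].
near=> u => t; rewrite le_min => /andP[t1 t2].
have u0 : 0 < u by near: u; exact: near_pinfty_gt.
have uM : 2 * M / tau < u by near: u; exact: near_pinfty_gt.
have tu : tau / 2 <= t / u by move: t2; rewrite ler_norml => /andP[h3 _]; lra.
apply: (h (t / u, t)); split => /=.
  by apply: h1; rewrite /= distrC; lra.
apply: hM; move: tu; rewrite ler_pdivlMr//; apply: lt_le_trans.
by move: uM; rewrite ltr_pdivrMr//; lra.
Unshelve. all: by end_near. Qed.

Lemma scaled_powR (u t p : R) : 0 < u -> 0 < t -> (t / u) `^ p = t `^ p / u `^ p.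
Proof.
move=> u0 t0; rewrite powRM ?(ltW t0) ?invr_ge0 ?(ltW u0)//.
by rewrite -powR_inv1 ?(ltW u0)// -powRrM mulN1r powRN.
Qed.

Lemma powR_2B2a (u : R) : 0 < u -> Q_ u = u ^+ 2 / u `^ (2 * a).
Proof.
move=> u0; rewrite powRB ?powR_mulrn ?(ltW u0)//.
by rewrite (gt_eqF u0) implybT.
Qed.

Lemma near_cvg_prod (F : R -> R) (G : R -> R) (l m e : R) : {for tau, continuous F} ->
  G t @[t --> +oo] --> m -> F tau * m = l -> 0 < e ->
  \forall s \near tau & t \near +oo, `|F s * G t - l| < e.
Proof.
move=> cF cG <- e0.
have h1 : F st.1 @[st --> filter_prod (nbhs tau) (+oo : set_system R)] --> F tau.
  by apply: (cvg_comp fst F) cF; exact: cvg_fst.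
have h2 : G st.2 @[st --> filter_prod (nbhs tau) (+oo : set_system R)] --> m.
  by apply: (cvg_comp snd G) cG; exact: cvg_snd.
have h : F st.1 * G st.2 @[st --> filter_prod (nbhs tau) (+oo : set_system R)] --> F tau * m.
  exact: cvgM h1 h2.
exact: (@cvgr_distC_lt _ R^o _ _ _ _ _ h).
Qed.

Lemma ratio_local (e : R) : 0 < e -> exists2 eta, 0 < eta < tau &
  \forall u \near +oo, forall t, `|t / u - tau| <= eta ->
    [/\ 0 < t, 0 < f t & `|(u + c * t) ^+ 2 / f t / Q_ u - G0| <= e].
Proof.
move=> e0; have tau0 := tau_gt0.
have cF : {for tau, continuous (fun s => (1 + c * s) ^+ 2 * s `^ (- (2 * a)))}.
  apply: differentiable_continuous; apply/derivable1_diffP; apply: ex_derive.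
  have h := is_derive1_powR (- (2 * a)) tau0.
  exact: is_deriveM.
have l0 : (1 + c * tau) ^+ 2 * tau `^ (- (2 * a)) * A^-1 = G0.
  by rewrite powRN /min_value; field; rewrite !gt_eqF ?powR_gt0.
have [eta he h] := near_prod_scale (near_cvg_prod cF cvg_inv_f_ratio l0 e0).
have [M [_ hM]] := near_f_gt0.
exists eta => //; apply: filterS (filterI (near_pinfty_gt 0)
  (filterI (near_pinfty_gt (M / (tau - eta))) h)) => u [u0 [uM q]] t ht.
have s0 : 0 < t / u by case/andP: he => _ he; move: ht; rewrite ler_norml => /andP[]; lra.
have t0 : 0 < t by move: s0; rewrite pmulr_lgt0// invr_gt0.
have hf : 0 < f t.
  apply: hM; move: uM; rewrite ltr_pdivrMr ?subr_gt0; last by case/andP: he.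
  move/lt_le_trans; apply; rewrite mulrC -ler_pdivlMr//.
  by move: ht; rewrite ler_norml => /andP[]; lra.
split => //.
have := q t ht.
move/ltW; congr (`|_ - _| <= _).
rewrite powRN scaled_powR// powR_2B2a//; field.
by rewrite !gt_eqF ?powR_gt0.
Qed.

Lemma is_derive_logm (u t : R) : 0 < u -> 0 < t -> 0 < f t ->
  is_derive t 1 (logm u) (logm1 u t).
Proof.
move=> u0 t0 ft0; have df := is_derive_f t0.
have p0 : 0 < u + c * t by rewrite addr_gt0// mulr_gt0.
have d1 : is_derive t 1 (fun t => u + c * t) c.
  by have := is_derive_affine c u t; congr is_derive; apply/funext => y; rewrite addrC.
have d2 := @is_derive1_comp _ (@ln R) (fun t => u + c * t) t _ _ (is_derive1_ln p0) d1.
have d3 := @is_derive1_comp _ (@ln R) f t _ _ (is_derive1_ln ft0) df.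
have : is_derive t 1 (fun t => 2 * (@ln R \o (fun t => u + c * t)) t - (@ln R \o f) t)
    (2 * ((u + c * t)^-1 * c) - (f t)^-1 * f1 t).
  by apply: is_derive_eq; rewrite /GRing.scale/=; ring.
by congr is_derive; rewrite /log_ratio1; ring.
Qed.

Lemma is_derive_logm1 (u t : R) : 0 < u -> 0 < t -> 0 < f t ->
  is_derive t 1 (logm1 u) (logm2 u t).
Proof.
move=> u0 t0 ft0; have df := is_derive_f t0; have df1 := is_derive_f1 t0.
have p0 : 0 < u + c * t by rewrite addr_gt0// mulr_gt0.
have d1 : is_derive t 1 (fun t => u + c * t) c.
  by have := is_derive_affine c u t; congr is_derive; apply/funext => y; rewrite addrC.
have d2 := @is_deriveV _ (fun t => u + c * t) t c 1 (lt0r_neq0 p0) d1.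
have d3 := @is_deriveV _ f t (f1 t) 1 (lt0r_neq0 ft0) df.
have : is_derive t 1 (fun t => 2 * c * (u + c * t)^-1 - f1 t * (f t)^-1)
   (2 * c * (- (u + c * t) ^- 2 * c) - (f1 t * (- (f t) ^- 2 * f1 t) + (f t)^-1 * f2 t)).
  by apply: is_derive_eq; rewrite /GRing.scale/=; ring.
congr is_derive; rewrite /log_ratio2; field.
by rewrite !gt_eqF.
Qed.

Lemma logm2_local (e : R) : 0 < e -> exists2 eta, 0 < eta < tau &
  \forall u \near +oo, forall t, `|t / u - tau| <= eta ->
    `|u ^+ 2 * logm2 u t - k0| <= e.
Proof.
move=> e0; have tau0 := tau_gt0.
have e20 : 0 < e / 2 by rewrite divr_gt0.
have cF : {for tau, continuous (fun s : R => s ^- 2)}.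
  apply: differentiable_continuous; apply/derivable1_diffP.
  by apply: derivableV => //; rewrite gt_eqF ?exprn_gt0.
have h1 := near_cvg_prod cF cvg_logconvexity erefl e20.
have p0 : 0 < 1 + c * tau by rewrite addr_gt0// mulr_gt0.
have cF2 : {for tau, continuous (fun s : R => 2 * c ^+ 2 * (1 + c * s) ^- 2)}.
  apply: differentiable_continuous; apply/derivable1_diffP.
  apply: derivableM => //; apply: derivableV => //.
  by rewrite gt_eqF ?exprn_gt0.
have c1 : (fun=> 1 : R) t @[t --> (+oo : set_system R)] --> (1 : R) by exact: cvg_cst.
have h2 := near_cvg_prod cF2 c1 erefl e20.
have h : \forall s \near tau & t \near +oo,
   `|s ^- 2 * (t ^+ 2 * (f2 t / f t - (f1 t / f t) ^+ 2)) - tau ^- 2 * - (2 * a)| < e / 2 /\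
   `|2 * c ^+ 2 * (1 + c * s) ^- 2 * 1 - 2 * c ^+ 2 * (1 + c * tau) ^- 2 * 1| < e / 2.
  exact: filterS2 h1 h2.
have [eta he hh] := near_prod_scale h.
exists eta => //; apply: filterS (filterI (near_pinfty_gt 0) hh) => u [u0 q] t ht.
have s0 : 0 < t / u by case/andP: he => _ he; move: ht; rewrite ler_norml => /andP[]; lra.
have t0 : 0 < t by move: s0; rewrite pmulr_lgt0// invr_gt0.
have [q1 q2] := q t ht.
(* As c tau / (1 + c tau) = a, the right side equals 2 a / tau^2 - 2 a^2 / tau^2. *)
have kE : k0 = - (tau ^- 2 * - (2 * a)) - 2 * c ^+ 2 * (1 + c * tau) ^- 2 * 1.
  have /andP[b1 b2] := a01.
  rewrite /curvature /crit_point; field.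
  by rewrite !gt_eqF//; lra.
have -> : u ^+ 2 * logm2 u t - k0 =
  - ((t / u) ^- 2 * (t ^+ 2 * (f2 t / f t - (f1 t / f t) ^+ 2)) - tau ^- 2 * - (2 * a))
  - (2 * c ^+ 2 * (1 + c * (t / u)) ^- 2 * 1 - 2 * c ^+ 2 * (1 + c * tau) ^- 2 * 1).
  have p1 : 0 < u + c * t by rewrite addr_gt0// mulr_gt0.
  have p2 : 1 + c * (t / u) = (u + c * t) / u by field; rewrite gt_eqF.
  rewrite kE /log_ratio2 p2.
  set W := f2 t / f t - _.
  have -> : (t / u) ^- 2 = u ^+ 2 / t ^+ 2 by field; rewrite !gt_eqF.
  have -> : ((u + c * t) / u) ^- 2 = u ^+ 2 / (u + c * t) ^+ 2 by field; rewrite !gt_eqF.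
  by field; rewrite !gt_eqF.
apply: (le_trans (ler_normB _ _)); rewrite normrN; lra.
Qed.

Lemma near_powR_ge (p y : R) : 0 < p -> \forall u \near +oo, y <= u `^ p.
Proof.
move=> p0; near=> u.
have y1 : 0 < `|y| + 1 by have := normr_ge0 y; lra.
have u1 : (`|y| + 1) `^ p^-1 <= u by near: u; exact: near_pinfty_ge.
have : ((`|y| + 1) `^ p^-1) `^ p <= u `^ p.
  apply: ge0_ler_powR => //; rewrite ?nnegrE ?powR_ge0 ?(ltW p0)//.
rewrite -powRrM mulVf ?gt_eqF// powRr1 ?(ltW y1)//; apply: le_trans.
by have := ler_norm y; lra.
Unshelve. all: by end_near. Qed.

Lemma f_bounded_on (S : R) : exists2 C : R, 0 < C & forall t, 0 <= t <= S -> f t <= C.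
Proof.
have [t0 t00 [C0 hC0]] := hb0.
have [St|tS] := leP S (t0 / 2).
  exists (Num.max C0 1); first by rewrite lt_max ltr01 orbT.
  move=> t /andP[h1 h2]; rewrite le_max; apply/orP; left; apply: hC0.
  by rewrite h1/=; lra.
have cf : {within `[t0 / 2, S], continuous f}.
  apply: derivable_within_continuous => z; rewrite in_itv/= => /andP[h1 _].
  by apply: ex_derive; apply: is_derive_f; lra.
have [m _ hm] := EVT_max (ltW tS) cf.
exists (Num.max (Num.max C0 1) (f m)); first by rewrite !lt_max ltr01 !orbT.
move=> t /andP[h1 h2]; rewrite !le_max; have [h3|h3] := ltP t t0.
  by rewrite hC0// h1.
apply/orP; right; apply: hm; rewrite in_itv/= h2 andbT; lra.
Qed.

(** Away from tau the ratio exceeds its minimum by a fixed factor, uniformly in t >= 0. In terms of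
    r = s / tau, (1 - a)(1 + c s) = (1 - a) + a r, so this is the gap in the weighted AM-GM
    inequality. *)
Lemma global_gap (eta : R) : 0 < eta -> exists2 del, 0 < del &
  \forall u \near +oo, forall t, 0 <= t -> eta <= `|t / u - tau| ->
    f t * (G0 * Q_ u * (1 + del)) <= (u + c * t) ^+ 2.
Proof.
move=> e0; have tau0 := tau_gt0; have /andP[a0 a1] := a01; have G00 := G0_gt0.
have A0 := A_gt0.
pose eta1 := Num.min (eta / tau) (2^-1).
have e1 : 0 < eta1 < 1.
  apply/andP; split; first by rewrite lt_min (divr_gt0 e0 tau0) invr_gt0 ltr0n.
  by apply: (@le_lt_trans _ _ (2^-1)); [rewrite ge_min lexx orbT|lra].
have e1e : eta1 * tau <= eta by rewrite -ler_pdivlMr// ge_min lexx.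
have [del d0 hdel] := amgm_gap_unif a01 e1.
exists del => //.
have dA : 0 < A * del by rewrite mulr_gt0.
have : \forall t \near +oo, f t <= A * (1 + del) * t `^ (2 * a).
  near=> t; have t0 : 0 < t by near: t; exact: near_pinfty_gt.
  have : `|f t / t `^ (2 * a) - A| < A * del.
    by near: t; exact: cvg_pinfty_near_lt cvg_f_ratio dA.
  rewrite ltr_norml => /andP[_ h].
  have : f t / t `^ (2 * a) <= A * (1 + del) by lra.
  by rewrite ler_pdivrMr// powR_gt0.
move=> [S [_ hS]].
have [C C0 hC] := f_bounded_on (Num.max S 0).
have a20 : 0 < 2 * a by rewrite mulr_gt0.
apply: filterS (filterI (near_pinfty_gt 0)
  (near_powR_ge (C * (G0 * (1 + del))) a20)) => u [u0 uC] t t0 ht.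
have p0 : 0 < u `^ (2 * a) by rewrite powR_gt0.
have q0 : 0 < Q_ u by rewrite powR_gt0.
have uE : u ^+ 2 = Q_ u * u `^ (2 * a).
  by rewrite powR_2B2a// divfK// gt_eqF.
(* For bounded t, f is bounded while (u + c t)^2 >= u^2, larger than [Q_ u] by the factor u^(2
   a). *)
have [tS|St] := leP t (Num.max S 0).
  have ft : f t <= C by apply: hC; rewrite t0.
  have k1 : 0 < G0 * (1 + del) by rewrite mulr_gt0//; lra.
  have : f t * (G0 * (1 + del)) <= u `^ (2 * a).
    by apply: le_trans uC; rewrite ler_pM2r.
  rewrite -(ler_pM2l q0) -uE => h.
  apply: (@le_trans _ _ (u ^+ 2)); first by apply: le_trans h; lra.
  by rewrite lerXn2r ?nnegrE ?(ltW u0) ?addr_ge0 ?mulr_ge0 ?(ltW hc) ?(ltW u0)// lerDl mulr_ge0// ltW.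
have [S1 S2] : S < t /\ 0 < t by move: St; rewrite gt_max => /andP[].
have ft := hS t S1.
have s0 : 0 < t / u by rewrite divr_gt0.
set s := t / u in ht s0 *.
have r0 : 0 < s / tau by rewrite divr_gt0.
have hr : eta1 <= `|s / tau - 1|.
  rewrite -(ler_pM2r tau0); apply: (le_trans e1e); apply: (le_trans ht).
  rewrite -[X in _ * X]gtr0_norm// -normrM mulrBl mul1r divfK// gt_eqF//.
have hh := hdel _ r0 hr.
have sE : (1 - a) * (1 + c * s) = (1 - a) + a * (s / tau).
  have : c * s = a / (1 - a) * (s / tau).
    by rewrite -ctauE; field; rewrite gt_eqF.
  by move=> ->; field; rewrite !gt_eqF//; lra.
have tE : t = s * u by rewrite /s divfK// gt_eqF.
have powsq : (s / tau) `^ a ^+ 2 = s `^ (2 * a) / tau `^ (2 * a).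
  rewrite -powR_mulrn ?powR_ge0// -powRrM [a * _]mulrC scaled_powR//.
have tpow : t `^ (2 * a) = s `^ (2 * a) * u `^ (2 * a).
  by rewrite tE powRM// ltW.
(* Squaring gives (1 + del)^2: one factor pays for the bound f t <= A (1 + del) t^(2 a), the other
   is the gap that remains. *)
have sq : (1 + del) ^+ 2 * (s / tau) `^ a ^+ 2 <= (1 - a) ^+ 2 * (1 + c * s) ^+ 2.
  rewrite -!exprMn sE; apply: lerXn2r => //; rewrite nnegrE.
    by rewrite mulr_ge0 ?powR_ge0//; lra.
  by have := mulr_ge0 (ltW a0) (ltW r0); lra.
have G0A : G0 * A * (1 - a) ^+ 2 = (tau `^ (2 * a))^-1.
  rewrite /min_value ctauE; field.
  by rewrite !gt_eqF ?powR_gt0//; lra.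
have uct : (u + c * t) ^+ 2 = u ^+ 2 * (1 + c * s) ^+ 2.
  by rewrite tE; ring.
rewrite uct uE.
have k2 : 0 <= G0 * Q_ u * (1 + del) by apply: mulr_ge0; [apply: mulr_ge0; [exact: ltW|exact: powR_ge0]|lra].
apply: (le_trans (ler_wpM2r k2 ft)).
rewrite tpow.
have k3 : 0 < Q_ u * u `^ (2 * a) by rewrite mulr_gt0.
have k4 : 0 < (1 - a) ^+ 2 by rewrite exprn_gt0// subr_gt0.
rewrite -(ler_pM2l k4).
have := ler_wpM2l (ltW k3) sq.
rewrite powsq -G0A; lra.
Unshelve. all: by end_near. Qed.

Lemma scaled_dist_le (u z s e : R) : 0 < u ->
  (`|z / u - s| <= e) = ((s - e) * u <= z <= (s + e) * u).
Proof.
move=> u0; rewrite ler_norml -(ler_pdivlMr _ _ u0) -(ler_pdivrMr _ _ u0).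
by congr andb; apply/idP/idP => h; lra.
Qed.

Lemma scaled_dist_lt (u z s e : R) : 0 < u ->
  (`|z / u - s| < e) = ((s - e) * u < z < (s + e) * u).
Proof.
move=> u0; rewrite ltr_norml -(ltr_pdivlMr _ _ u0) -(ltr_pdivrMr _ _ u0).
by congr andb; apply/idP/idP => h; lra.
Qed.

Lemma ratio_at_crit (del : R) : 0 < del -> \forall u \near +oo, 0 < f (tau * u) /\
  (u + c * (tau * u)) ^+ 2 < f (tau * u) * (G0 * Q_ u * (1 + del)).
Proof.
move=> d0; have G00 := G0_gt0.
have Gd : 0 < G0 * (del / 2) by rewrite mulr_gt0// divr_gt0.
have [eta /andP[eta0 _] h] := ratio_local Gd.
apply: filterS (filterI (near_pinfty_gt 0) h) => u [u0 q].
have [|_ ft] := q (tau * u); first by rewrite mulfK ?gt_eqF// subrr normr0 ltW.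
rewrite ler_norml => /andP[_ hG]; split => //.
have p0 : 0 < Q_ u by rewrite powR_gt0.
have : (u + c * (tau * u)) ^+ 2 / f (tau * u) / Q_ u < G0 * (1 + del) by lra.
by rewrite !ltr_pdivrMr//; lra.
Qed.

(** Minimality is cross-multiplied: points s with f s = 0 then satisfy it trivially, as if the ratio
    were +oo there. *)
Definition argmin_pt (u t : R) : Prop :=
  [/\ 0 <= t, 0 < f t & forall s, 0 <= s -> f s * (u + c * t) ^+ 2 <= f t * (u + c * s) ^+ 2].

(** The minimum over a compact window around tau u exists by continuity; outside the window the gap
    makes the ratio larger than its value at tau u. *)
Lemma argmin_pt_exists : \forall u \near +oo, exists t, argmin_pt u t.
Proof.
have tau0 := tau_gt0; have G00 := G0_gt0.
have [eta he h1] := ratio_local (ltr01).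
have [e0 etau] := andP he.
have [del d0 h2] := global_gap e0.
apply: filterS (filterI (near_pinfty_gt 0)
  (filterI h1
  (filterI h2
  (ratio_at_crit d0)))) => u [u0 [q1 [q2 [ft hG]]]].
have itvP z : (tau - eta) * u <= z <= (tau + eta) * u -> `|z / u - tau| <= eta.
  by rewrite -scaled_dist_le.
have cg : {within `[(tau - eta) * u, (tau + eta) * u], continuous (fun t => (u + c * t) ^+ 2 / f t)}.
  apply: derivable_within_continuous => z; rewrite in_itv/= => /itvP /q1[z0 fz _].
  apply: derivableM.
    by apply: ex_derive; apply: is_deriveX.
  by apply: derivableV; rewrite ?gt_eqF//; apply: ex_derive; exact: is_derive_f.
have le1 : (tau - eta) * u <= (tau + eta) * u by rewrite ler_pM2r//; lra.
have [m + hm] := EVT_min le1 cg.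
rewrite in_itv/= => /itvP hmm; have [m0 fm _] := q1 m hmm.
exists m; split => //; first exact: ltW.
have tu_in : tau * u \in `[(tau - eta) * u, (tau + eta) * u].
  by rewrite in_itv/= !ler_pM2r//; apply/andP; split; lra.
have mtau := hm _ tu_in.
have hM : (u + c * m) ^+ 2 <= f m * (G0 * Q_ u * (1 + del)).
  rewrite [leRHS]mulrC -(ler_pdivrMr _ _ fm); apply: (le_trans mtau).
  by rewrite ler_pdivrMr// [leRHS]mulrC ltW.
move=> s s0; have [hs|hs] := leP `|s / u - tau| eta.
  have [_ fs _] := q1 s hs.
  have sin : s \in `[(tau - eta) * u, (tau + eta) * u].
    by rewrite in_itv/= -scaled_dist_le.
  by have := hm _ sin; rewrite ler_pdivrMr// mulrAC ler_pdivlMr// [X in X <= _]mulrC [X in _ <= X]mulrC.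
have := q2 s s0 (ltW hs) => h4.
apply: (@le_trans _ _ (f s * (f m * (G0 * Q_ u * (1 + del))))).
  by rewrite ler_wpM2l ?hf0.
by rewrite mulrCA ler_pM2l.
Qed.

(** The gap excludes minimisers far from tau u. The minimiser is therefore interior to a region
    where f > 0 and is a critical point of the log ratio, which removes the first-order term from
    all later expansions. *)
Lemma argmin_pt_local (eta : R) : 0 < eta -> \forall u \near +oo, forall t,
  argmin_pt u t -> [/\ 0 < t, `|t / u - tau| < eta & logm1 u t = 0].
Proof.
move=> e0; have tau0 := tau_gt0; have G00 := G0_gt0.
have [eta0 he0 h1] := ratio_local (ltr01).
have [e00 etau0] := andP he0.
pose e1 := Num.min eta eta0.
have e10 : 0 < e1 by rewrite lt_min e0 e00.
have [del d0 h2] := global_gap e10.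
apply: filterS (filterI (near_pinfty_gt 0)
  (filterI h1
  (filterI h2
  (ratio_at_crit d0)))) => u [u0 [q1 [q2 [ftau h5]]]] t [t0 ft tmin].
have close : `|t / u - tau| < e1.
  rewrite ltNge; apply/negP => /(q2 t t0) h4.
  have h6 := tmin (tau * u) (mulr_ge0 (ltW tau0) (ltW u0)).
  have h7 : f (tau * u) * (f t * (G0 * Q_ u * (1 + del))) <=
      f (tau * u) * (u + c * t) ^+ 2 by rewrite ler_pM2l.
  have h8 : f t * (u + c * (tau * u)) ^+ 2 <
      f t * (f (tau * u) * (G0 * Q_ u * (1 + del))) by rewrite ltr_pM2l.
  lra.
have c1 : `|t / u - tau| < eta by apply: (lt_le_trans close); rewrite ge_min lexx.
have c2 : `|t / u - tau| < eta0 by apply: (lt_le_trans close); rewrite ge_min lexx orbT.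
have [tp _ _] := q1 t (ltW c2).
split => //.
pose lo := (tau - eta0) * u; pose hi := (tau + eta0) * u.
have inP z : z \in `]lo, hi[ -> `|z / u - tau| <= eta0.
  by rewrite in_itv/= -scaled_dist_lt// => /ltW.
have lohi : lo <= hi by rewrite ler_pM2r//; lra.
have tin : t \in `]lo, hi[.
  by rewrite in_itv/= -scaled_dist_lt.
have dl z : z \in `]lo, hi[ -> is_derive z 1 (logm u) (logm1 u z).
  by move=> /inP /q1[z0 fz _]; exact: is_derive_logm.
have lmin z : z \in `]lo, hi[ -> logm u t <= logm u z.
  move=> /inP /q1[z0 fz _].
  have a1 : 0 < u + c * t by rewrite addr_gt0// mulr_gt0.
  have a2 : 0 < u + c * z by rewrite addr_gt0// mulr_gt0.
  have := tmin z (ltW z0).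
  have lnE (p q : R) : 0 < p -> 0 < q -> ln (p * q ^+ 2) = ln p + 2 * ln q.
    by move=> p1 q1'; rewrite lnM ?posrE ?exprn_gt0// lnXn// mulr_natl.
  rewrite -ler_ln ?posrE ?mulr_gt0 ?exprn_gt0// (lnE _ _ fz a1) (lnE _ _ ft a2).
  by rewrite /log_ratio; lra.
have dvl z : z \in `]lo, hi[ -> derivable (logm u) z 1 by move=> /dl h; exact: ex_derive.
have [_ dv] := derive1_at_min lohi dvl tin lmin.
by have [_ dv'] := dl t tin; rewrite -dv' dv.
Qed.

(** Turns a strict inequality between limiting constants into an admissible error: [phi e] will be
    the constant obtained when all limits are perturbed by e. *)
Lemma continuous_lt_near (phi : R -> R) (kap m : R) : {for 0, continuous phi} ->
  kap < phi 0 -> 0 < m -> exists2 e, 0 < e < m & kap < phi e.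
Proof.
move=> cphi h m0; have d0 : 0 < phi 0 - kap by rewrite subr_gt0.
have [e /= e0 he] : \forall x \near (0 : R), `|phi 0 - phi x| < phi 0 - kap.
  exact: (@cvgr_dist_lt _ R^o _ _ _ _ _ cphi).
pose e' := Num.min (e / 2) (m / 2).
have e'0 : 0 < e' by rewrite lt_min !divr_gt0.
have e'e : e' < e by rewrite gt_min; apply/orP; left; lra.
have e'm : e' < m by rewrite gt_min; apply/orP; right; lra.
exists e'; first by rewrite e'0.
have := he e'; rewrite /= sub0r normrN gtr0_norm// => /(_ e'e).
by rewrite ltr_norml => /andP[]; lra.
Qed.

Lemma near_poly_exp (p del C : R) n : 0 < p -> 0 < del ->
  \forall u \near +oo, C * u ^+ n <= expR (del * u `^ p).
Proof.
move=> p0 d0; pose m := (Num.truncn (n%:R / p)).+1.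
have mp : n%:R <= p * m%:R.
  have /truncn_itv/andP[_ h] : 0 <= n%:R / p by rewrite divr_ge0// ltW.
  by move: h; rewrite ltr_pdivrMr// mulrC => /ltW.
pose C' := `|C| / del ^+ m.
near=> u.
have u1 : 1 <= u by near: u; exact: near_pinfty_ge.
have u0 : 0 < u by lra.
have y1 : (`|C'| * (m.+1)`!%:R + 1) / del <= u `^ p by near: u; exact: near_powR_ge.
have y0 : 0 < u `^ p by rewrite powR_gt0.
have dm : 0 < del ^+ m by rewrite exprn_gt0.
have C'0 : 0 <= C' by rewrite divr_ge0// ltW.
have h : C' * (del * u `^ p) ^+ m <= expR (del * u `^ p).
  apply: poly_le_exp => //; first exact: mulr_gt0.
  by move: y1; rewrite ler_pdivrMr// ger0_norm//; lra.
apply: le_trans h; rewrite exprMn /C' mulrA divfK ?gt_eqF//.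
apply: (@le_trans _ _ (`|C| * u ^+ n)); first by rewrite ler_wpM2r ?ler_norm ?exprn_ge0 ?ltW.
rewrite ler_wpM2l// -(powR_mulrn n (ltW u0)) -(powR_mulrn m (ltW y0)) -powRrM.
by rewrite ler_powR.
Unshelve. all: by end_near. Qed.

Lemma near_mulr_expN (p del C e : R) n : 0 < p -> 0 < del -> 0 < e ->
  \forall u \near +oo, C * u ^+ n * expR (- (del * u `^ p)) <= e.
Proof.
move=> p0 d0 e0; apply: filterS (near_poly_exp (C / e) n p0 d0) => u h.
by rewrite expRN ler_pdivrMr ?expR_gt0// -ler_pdivrMl// mulrC mulrAC.
Qed.

(** * Expansion of the exponent around the minimiser *)

Variable tu : R -> R.
Hypothesis htu : \forall u \near +oo, argmin_pt u (tu u).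
(** This is u^(1 - 2 a), the order by which the exponent changes when u moves by a constant or t
    moves by order sqrt u away from t_u. *)
Local Notation w_ u := (Q_ u / u).
Local Notation minsq u := ((u + c * tu u) ^+ 2 / f (tu u)).

Let tau_pos : 0 < tau. Proof. exact: tau_gt0. Qed.
Let G0_pos : 0 < G0. Proof. exact: G0_gt0. Qed.
Let k0_pos : 0 < k0. Proof. exact: k0_gt0. Qed.

Lemma argmin_scaled (eta : R) : 0 < eta -> \forall u \near +oo, `|tu u / u - tau| <= eta.
Proof.
move=> e0; have loc := argmin_pt_local e0; apply: filterS (filterI htu
  loc) => u [h1 h2].
by have [_ /ltW] := h2 _ h1.
Qed.

Lemma argmin_window (th b eta : R) : 0 < b < 1 -> 0 < eta ->
  \forall u \near +oo, forall t : R, `|t - tu u| <= th * u `^ b -> `|t / u - tau| <= eta.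
Proof.
move=> /andP[b0 b1] e0;
have e20 : 0 < eta / 2 by exact: divr_gt0.
have b10 : 0 < 1 - b by rewrite subr_gt0.
apply: filterS (filterI (near_pinfty_gt 0)
  (filterI (argmin_scaled e20)
  (near_powR_ge (th / (eta / 2)) b10))) => u [u0 [h1 h2]] t ht.
have h3 : `|(t - tu u) / u| <= eta / 2.
  rewrite normrM normfV (gtr0_norm u0) ler_pdivrMr//; apply: (le_trans ht).
  have uE : u = u `^ b * u `^ (1 - b).
    by rewrite -powRD ?subrKC ?powRr1 ?(ltW u0)// (gt_eqF u0) implybT.
  rewrite [X in _ <= _ * X]uE mulrCA mulrC ler_wpM2l ?powR_ge0//.
  by move: h2; rewrite ler_pdivrMr ?divr_gt0// mulrC.
have -> : t / u - tau = (t - tu u) / u + (tu u / u - tau) by field; rewrite gt_eqF.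
by apply: (le_trans (ler_normD _ _)); lra.
Qed.

Lemma minsq_scaled (e : R) : 0 < e ->
  \forall u \near +oo, (G0 - e) * Q_ u <= minsq u <= (G0 + e) * Q_ u.
Proof.
move=> e0; have [eta /andP[eta0 _] h] := ratio_local e0.
apply: filterS (filterI (near_pinfty_gt 0)
  (filterI (argmin_scaled eta0)
  h)) => u [u0 [h1 h2]].
have [_ _] := h2 _ h1; rewrite ler_norml => /andP[h3 h4].
have q0 : 0 < Q_ u by rewrite powR_gt0.
rewrite -(ler_pdivlMr _ _ q0) -(ler_pdivrMr _ _ q0).
by apply/andP; split; lra.
Qed.

Lemma minsq_le : \forall u \near +oo,
  0 < minsq u /\ forall t : R, 0 <= t -> f t * minsq u <= (u + c * t) ^+ 2.
Proof.
apply: filterS (filterI (near_pinfty_gt 0)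
  htu) => u [u0 [h1 h2 h3]].
split => [|t t0].
  by rewrite divr_gt0// exprn_gt0//; have := mulr_ge0 (ltW hc) h1; lra.
by rewrite mulrA ler_pdivrMr// [leRHS]mulrC; exact: h3.
Qed.

(** The log ratio has a critical point at t_u, and u^2 times its second derivative is within e of k0
    on the whole window, so Taylor leaves a pure square. *)
Lemma ratio_taylor (e : R) : 0 < e -> exists2 eta, 0 < eta &
  \forall u \near +oo, forall t : R, `|t / u - tau| <= eta ->
    [/\ 0 < t, 0 < f t & exists2 y, (k0 - e) / 2 * ((t - tu u) / u) ^+ 2 <= y
                                     <= (k0 + e) / 2 * ((t - tu u) / u) ^+ 2 &
      (u + c * t) ^+ 2 / f t = minsq u * expR y].
Proof.
move=> e0.
have [eta1 /andP[eta10 _] h1] := logm2_local e0.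
have [eta2 /andP[eta20 _] h2] := ratio_local ltr01.
pose eta := Num.min eta1 eta2.
have eta0 : 0 < eta by rewrite lt_min eta10.
have loc := argmin_pt_local eta0.
exists eta => //; apply: filterS (filterI (near_pinfty_gt 0)
  (filterI htu
  (filterI loc
  (filterI h1
  h2)))) => u [u0 [k1 [k2 [q1 q2]]]] t ht.
have {k2}[tu0 tuc tud] := k2 _ k1.
have eta_1 : eta <= eta1 by rewrite ge_min lexx.
have eta_2 : eta <= eta2 by rewrite ge_min lexx orbT.
have [t0 ft _] := q2 t (le_trans ht eta_2).
have [_ ftu _] := q2 _ (le_trans (ltW tuc) eta_2).
have btw z : Num.min (tu u) t <= z <= Num.max (tu u) t -> `|z / u - tau| <= eta.
  move: ht (ltW tuc); rewrite !scaled_dist_le//.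
  case: (leP (tu u) t) => _ /andP[p1 p2] /andP[p3 p4] /andP[p5 p6].
    by rewrite (le_trans p3 p5) (le_trans p6 p2).
  by rewrite (le_trans p1 p5) (le_trans p6 p4).
have d1 z : Num.min (tu u) t <= z <= Num.max (tu u) t -> is_derive z 1 (logm u) (logm1 u z).
  move=> /btw hz; have [z0 fz _] := q2 z (le_trans hz eta_2).
  exact: is_derive_logm u0 z0 fz.
have d2 z : Num.min (tu u) t <= z <= Num.max (tu u) t -> is_derive z 1 (logm1 u) (logm2 u z).
  move=> /btw hz; have [z0 fz _] := q2 z (le_trans hz eta_2).
  exact: is_derive_logm1 u0 z0 fz.
have u20 : 0 < u ^+ 2 by rewrite exprn_gt0.
(* The sign s = 1 or -1 treats the upper and the lower Taylor bound at once. *)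
have bnd (k : R) (s : R) : (forall z : R, `|z / u - tau| <= eta -> 0 <= s * (k / u ^+ 2 - logm2 u z)) ->
    0 <= s * (k / 2 * ((t - tu u) / u) ^+ 2 - (logm u t - logm u (tu u))).
  move=> hk; have [z [th [hz th0 eq]]] := taylor_critical (k / u ^+ 2) d1 d2 tud.
  have -> : k / 2 * ((t - tu u) / u) ^+ 2 = k / u ^+ 2 / 2 * (t - tu u) ^+ 2.
    by field; rewrite gt_eqF.
  rewrite -opprB eq -mulNr opprB mulrA mulr_ge0//.
  exact: hk z (btw z hz).
split => //; exists (logm u t - logm u (tu u)).
  apply/andP; split.
    have := bnd (k0 - e) (-1); rewrite !mulN1r oppr_ge0 subr_le0; apply.
    move=> z hz; rewrite mulN1r oppr_ge0 subr_le0 ler_pdivrMr//.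
    by have := q1 z (le_trans hz eta_1); rewrite ler_norml => /andP[]; lra.
  have := bnd (k0 + e) 1; rewrite !mul1r subr_ge0; apply.
  move=> z hz; rewrite mul1r subr_ge0 ler_pdivlMr//.
  by have := q1 z (le_trans hz eta_1); rewrite ler_norml => /andP[]; lra.
have lnE z : 0 < z -> 0 < f z -> (u + c * z) ^+ 2 / f z = expR (logm u z).
  move=> z0 fz; have p0 : 0 < u + c * z by rewrite addr_gt0// mulr_gt0.
  by rewrite /log_ratio mulr_natl -lnXn// expRB !lnK// posrE ?exprn_gt0.
by rewrite !lnE// -expRD subrKC.
Qed.

(** Inside the window, exp y >= 1 + y gives an excess of about G0 Q_u (k0 / 2) th^2 / u. Outside,
    the gap gives an excess of order [Q_ u], far above [w_ u]. *)
Lemma quad_lower (th kap : R) : 0 < th -> kap < G0 * k0 * th ^+ 2 / 2 ->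
  \forall u \near +oo, forall t : R, 0 <= t -> th * Num.sqrt u <= `|t - tu u| ->
    f t * (minsq u + kap * w_ u) <= (u + c * t) ^+ 2.
Proof.
move=> th0 hkap.
pose phi (e : R) := (G0 - e) * (k0 - e) * (th ^+ 2 / 2).
have cphi : {for 0, continuous phi}.
  apply: differentiable_continuous; apply/derivable1_diffP.
  by repeat apply: derivableM => //; apply: derivableB.
have h0 : kap < phi 0 by rewrite /phi !subr0; lra.
have hm : 0 < Num.min G0 k0 by rewrite lt_min G0_gt0 k0_gt0.
have [e /andP[e0 em] ephi] := continuous_lt_near cphi h0 hm.
have eG : e < G0 by apply: (lt_le_trans em); rewrite ge_min lexx.
have ek : e < k0 by apply: (lt_le_trans em); rewrite ge_min lexx orbT.
have [eta eta0 h1] := ratio_taylor e0.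
have [del d0 h2] := global_gap eta0.
have Gd : 0 < G0 * del / 2 by rewrite divr_gt0// mulr_gt0.
apply: filterS (filterI (near_pinfty_gt 0)
  (filterI h1
  (filterI h2
  (filterI (minsq_scaled e0)
  (filterI (minsq_scaled Gd)
  (near_pinfty_ge (kap / (G0 * del / 2)))))))) => u [u0 [q1 [q2 [q3 [q4 q5]]]]] t t0 ht.
have Q0 : 0 < Q_ u by rewrite powR_gt0.
set Q := Q_ u in q2 q3 q4 Q0 *.
have [hl|hl] := leP `|t / u - tau| eta; last first.
  have ft0 := hf0 t0.
  apply: le_trans (q2 t t0 (ltW hl)); rewrite ler_wpM2l//.
  have : kap * (Q / u) <= G0 * del / 2 * Q.
    by rewrite mulrCA mulrC ler_pM2r// ler_pdivrMr// mulrC -ler_pdivrMr.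
  by move/andP: q4 => [_]; lra.
have [_ ft [y /andP[y1 _] eq]] := q1 t hl.
rewrite mulrC -ler_pdivlMr// eq.
have yD : (k0 - e) / 2 * (th ^+ 2 / u) <= y.
  apply: le_trans y1; rewrite ler_pM2l ?divr_gt0 ?subr_gt0//.
  rewrite exprMn exprVn -[in leLHS](mulr1 (th ^+ 2 / u)) -(divff (lt0r_neq0 u0)).
  rewrite -mulrA [u^-1 * (u / u)]mulrCA -invfM -expr2 mulrA ler_pM2r ?invr_gt0 ?exprn_gt0//.
  rewrite -[X in _ * X](sqr_sqrtr (ltW u0)) -exprMn -[(t - tu u) ^+ 2]real_normK ?num_real//.
  by rewrite lerXn2r// nnegrE mulr_ge0 ?sqrtr_ge0 ?ltW.
have m0 : 0 < minsq u by case/andP: q3 => q3 _; apply: lt_le_trans q3; rewrite mulr_gt0// subr_gt0.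
have : minsq u * (1 + y) <= minsq u * expR y by rewrite ler_pM2l// expR_ge1Dx.
apply: le_trans; rewrite mulrDr mulr1 lerD2l.
apply: (@le_trans _ _ ((G0 - e) * Q * ((k0 - e) / 2 * (th ^+ 2 / u)))).
  have -> : (G0 - e) * Q * ((k0 - e) / 2 * (th ^+ 2 / u)) = phi e * (Q / u).
    by rewrite /phi; field; rewrite gt_eqF.
  by rewrite ler_wpM2r ?ltW// divr_gt0.
have r0 : 0 <= (k0 - e) / 2 * (th ^+ 2 / u).
  by rewrite mulr_ge0// ?divr_ge0 ?subr_ge0 ?exprn_ge0 ?ltW.
by apply: ler_pM => //; [rewrite mulr_ge0 ?subr_ge0 ?(ltW eG) ?(ltW Q0)|case/andP: q3].
Qed.

(** exp Y <= 1 / (1 - Y) <= 1 + (1 + e) Y for small Y. *)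
Lemma expR_le_affine (e y Y : R) : 0 < e -> y <= Y -> 0 <= Y -> (1 + e) * Y <= e ->
  expR y <= 1 + (1 + e) * Y.
Proof.
move=> e0 yY Y0 hY; apply: (@le_trans _ _ (expR Y)); first by rewrite ler_expR.
have Y1 : Y < 1 by rewrite ltNge; apply/negP => h; nra.
have h : 1 - Y <= expR (- Y) by have := expR_ge1Dx (- Y); lra.
have h1 : expR Y <= (1 - Y)^-1.
  by rewrite -[expR Y]invrK -expRN lef_pV2 ?posrE ?expR_gt0 ?subr_gt0.
apply: (le_trans h1); rewrite -[leLHS]mul1r ler_pdivrMr ?subr_gt0//.
nra.
Qed.

(** The width th u^b is left general: for b = 1/2 the cost is of order [w_ u], for b = a it is
    bounded. *)
Lemma quad_upper (th kap b : R) : 0 <= th -> 0 < b < 1 -> G0 * k0 * th ^+ 2 / 2 < kap ->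
  \forall u \near +oo, forall t : R, `|t - tu u| <= th * u `^ b ->
    [/\ 0 < t, 0 < f t &
      (u + c * t) ^+ 2 <= f t * (minsq u + kap * (Q_ u * (u `^ b / u) ^+ 2))].
Proof.
move=> th0 b01 hkap; have /andP[b0 b1] := b01.
pose phi (e : R) := - ((G0 + e) * (1 + e) * (k0 + e) * (th ^+ 2 / 2)).
have cphi : {for 0, continuous phi}.
  apply: differentiable_continuous; apply/derivable1_diffP; apply: derivableN.
  by repeat apply: derivableM => //; apply: derivableD.
have h0 : - kap < phi 0 by rewrite /phi !addr0 mulr1; lra.
have [e /andP[e0 _] ephi] := continuous_lt_near cphi h0 ltr01.
have [eta eta0 h1] := ratio_taylor e0.
pose C := (1 + e) * ((k0 + e) / 2 * th ^+ 2).
have C0 : 0 <= C.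
  by rewrite mulr_ge0 ?addr_ge0 ?(ltW e0)// mulr_ge0 ?exprn_ge0// divr_ge0// addr_ge0 ?ltW.
have b10 : 0 < 1 - b by rewrite subr_gt0.
apply: filterS (filterI (near_pinfty_gt 0)
  (filterI h1
  (filterI (argmin_window th b01 eta0)
  (filterI (minsq_scaled e0)
  (filterI (near_powR_ge 1 b10)
  (filterI (near_powR_ge (C / e) b10)
  minsq_le)))))) => u [u0 [q1 [q2 [q3 [q4 [q5 [m0 _]]]]]]] t ht.
have [t0 ft [y /andP[_ y1] eq]] := q1 t (q2 t ht).
split => //; rewrite [leRHS]mulrC -ler_pdivrMr// eq.
have Q0 : 0 < Q_ u by rewrite powR_gt0.
set Q := Q_ u in q3 Q0 *.
set r := u `^ b / u.
have rE : r = (u `^ (1 - b))^-1.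
  have uE : u = u `^ b * u `^ (1 - b).
    by rewrite -powRD ?subrKC ?powRr1 ?(ltW u0)// (gt_eqF u0) implybT.
  by rewrite /r {2}uE; field; rewrite !gt_eqF// powR_gt0.
have r0 : 0 < r by rewrite rE invr_gt0 powR_gt0.
have r1 : r <= 1 by rewrite rE invf_le1// powR_gt0.
pose Y := (k0 + e) / 2 * th ^+ 2 * r ^+ 2.
have ke : 0 < (k0 + e) / 2 by rewrite divr_gt0// addr_gt0.
have Y0 : 0 <= Y by rewrite mulr_ge0 ?sqr_ge0// mulr_ge0 ?sqr_ge0// ltW.
have yY : y <= Y.
  apply: (le_trans y1); rewrite /Y -[X in _ <= X]mulrA ler_pM2l// -exprMn -[leLHS]real_normK ?num_real//.
  have thr : `|(t - tu u) / u| <= th * r.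
    by rewrite normrM normfV (gtr0_norm u0) /r mulrA ler_pM2r ?invr_gt0.
  by apply: lerXn2r thr; rewrite nnegrE ?normr_ge0// (mulr_ge0 th0 (ltW r0)).
have eY : (1 + e) * Y <= e.
  have -> : (1 + e) * Y = C * r ^+ 2 by rewrite /C /Y; ring.
  apply: (@le_trans _ _ (C * r)); first by rewrite ler_wpM2l// expr2 ger_pMl.
  by rewrite rE ler_pdivrMr ?powR_gt0// mulrC -ler_pdivrMr.
have hx := expR_le_affine e0 yY Y0 eY.
have hx2 := ler_wpM2l (ltW m0) hx; apply: (le_trans hx2).
rewrite mulrDr mulr1 lerD2l.
apply: (@le_trans _ _ ((G0 + e) * Q * ((1 + e) * Y))).
  have e1Y : 0 <= (1 + e) * Y by apply: mulr_ge0 => //; lra.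
  by rewrite ler_wpM2r//; case/andP: q3.
have -> : (G0 + e) * Q * ((1 + e) * Y) = - phi e * (Q * r ^+ 2) by rewrite /phi /Y; ring.
have Qr : 0 <= Q * r ^+ 2 by rewrite mulr_ge0 ?sqr_ge0// (ltW Q0).
by have ephi' := ephi; rewrite ler_wpM2r//; lra.
Qed.

(** (p - y)^2 >= p^2 (1 - 2 y / p); multiplied out so that v = 0 is allowed. *)
Lemma lower_level_cost (p y v L : R) : 0 < p -> 0 <= y -> 2 * y <= p -> v * L <= p ^+ 2 ->
  v * (L - 2 * y / p * L) <= (p - y) ^+ 2.
Proof.
move=> p0 y0 yp h.
have h1 : 0 <= 1 - 2 * y / p by rewrite subr_ge0 ler_pdivrMr// mul1r.
have -> : v * (L - 2 * y / p * L) = v * L * (1 - 2 * y / p) by ring.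
apply: (le_trans (ler_wpM2r h1 h)).
have -> : p ^+ 2 * (1 - 2 * y / p) = p ^+ 2 - 2 * y * p by field; rewrite gt_eqF.
by have := sqr_ge0 y; lra.
Qed.

(** Replacing p = u + c t by p - x lowers p^2 / f by about 2 x p / f = 2 x (p^2 / f) / p. Near t_u,
    p^2 / f is about G0 Q_u and p about (1 + c tau) u = u / (1 - a), whence the constant 2 G0 (1 -
    a) x. *)
Lemma lower_level_gain (x kap : R) : 0 < x -> 0 <= kap -> kap < 2 * G0 * (1 - a) * x ->
  exists2 eta, 0 < eta & \forall u \near +oo, forall t : R, `|t / u - tau| <= eta ->
    0 <= u - x + c * t /\
    (u - x + c * t) ^+ 2 + f t * (kap * w_ u) <= (u + c * t) ^+ 2.
Proof.
move=> x0 kap0 hkap; have /andP[a0 a1] := a01.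
pose phi (e : R) := (2 - e) * x * (G0 - e) - (1 + c * tau + c * e) * kap.
have cphi : {for 0, continuous phi}.
  apply: differentiable_continuous; apply/derivable1_diffP; apply: derivableB.
    by repeat apply: derivableM => //; apply: derivableB.
  apply: derivableM => //; apply: derivableD => //.
have h0 : 0 < phi 0.
  rewrite /phi !subr0 mulr0 addr0 ctauE.
  have -> : 2 * x * G0 - (1 + a / (1 - a)) * kap = (2 * G0 * (1 - a) * x - kap) / (1 - a).
    by field; rewrite gt_eqF// subr_gt0.
  by rewrite divr_gt0 ?subr_gt0.
have hm : 0 < Num.min G0 1 by rewrite lt_min G0_gt0 ltr01.
have [e /andP[e0 em] ephi] := continuous_lt_near cphi h0 hm.
have eG : e < G0 by apply: (lt_le_trans em); rewrite ge_min lexx.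
have [eta /andP[eta0 _] h] := ratio_local e0.
exists (Num.min eta e); first by rewrite lt_min eta0.
apply: filterS (filterI (near_pinfty_gt 0)
  (filterI (near_pinfty_ge (x / e))
  (filterI (near_pinfty_ge x)
  h))) => u [u0 [ux [ux1 q1]]] t; rewrite le_min => /andP[ht hte].
have [t0 ft] := q1 t ht; rewrite ler_norml => /andP[g1 _].
have ct : 0 < c * t by rewrite mulr_gt0.
split; first by lra.
have Q0 : 0 < Q_ u by rewrite powR_gt0.
set Q := Q_ u in g1 Q0 *.
pose p := u + c * t; have p0 : 0 < p by rewrite addr_gt0.
have g2 : (G0 - e) * Q * f t <= p ^+ 2.
  by rewrite -ler_pdivlMr// -ler_pdivlMr//; rewrite /p; lra.
have pu : p <= (1 + c * tau + c * e) * u.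
  move: hte; rewrite scaled_dist_le// => /andP[_ hte].
  by have := ler_wpM2l (ltW hc) hte; rewrite /p; lra.
have xp : x <= e * p.
  have h1 : e * u <= e * p by rewrite ler_wpM2l ?(ltW e0)// /p; lra.
  by apply: le_trans h1; rewrite mulrC -ler_pdivrMr.
have g3 : (G0 - e) * (f t * (kap * (Q / u))) <= p * ((1 + c * tau + c * e) * kap).
  have h1 : p ^+ 2 * (kap / u) <= p * ((1 + c * tau + c * e) * kap).
    rewrite expr2 -mulrA ler_pM2l// mulrCA [leRHS]mulrC ler_wpM2l// ler_pdivrMr//.
  apply: le_trans h1.
  have -> : (G0 - e) * (f t * (kap * (Q / u))) = (G0 - e) * Q * f t * (kap / u) by ring.
  by rewrite ler_wpM2r// divr_ge0// ltW.
have g4 : p * ((1 + c * tau + c * e) * kap) <= p * ((2 - e) * x * (G0 - e)).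
  by rewrite ler_pM2l//; move: ephi; rewrite /phi; lra.
have g5 : f t * (kap * (Q / u)) <= (2 - e) * x * p.
  have Ge : 0 < G0 - e by rewrite subr_gt0.
  rewrite -(ler_pM2l Ge); apply: (le_trans g3); apply: (le_trans g4).
  by rewrite le_eqVlt; apply/orP; left; apply/eqP; ring.
have g6 : x * x <= x * (e * p) by rewrite ler_pM2l.
have -> : u - x + c * t = p - x by rewrite /p; ring.
rewrite -/p; lra.
Qed.

(** * Decorrelation of two increments with a common endpoint *)

Lemma f_two_sided : \forall t \near +oo,
  A / 2 * t `^ (2 * a) <= f t <= 2 * A * t `^ (2 * a).
Proof.
have A20 : 0 < A / 2 by rewrite divr_gt0.
near=> t; have t0 : 0 < t by near: t; exact: near_pinfty_gt.
have : `|f t / t `^ (2 * a) - A| < A / 2.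
  by near: t; exact: cvg_pinfty_near_lt cvg_f_ratio A20.
have T0 : 0 < t `^ (2 * a) by rewrite powR_gt0.
rewrite ltr_norml => /andP[h1 h2].
by apply/andP; rewrite -(ler_pdivlMr _ _ T0) -(ler_pdivrMr _ _ T0); split; lra.
Unshelve. all: by end_near. Qed.

Lemma derivative_ub : \forall t \near +oo, `|f1 t| * t <= (A * (2 * a) + 1) * t `^ (2 * a).
Proof.
have /andP[a0 a1] := a01.
near=> t; have t0 : 0 < t by near: t; exact: near_pinfty_gt.
have : `|f1 t / t `^ (2 * a - 1) - A * (2 * a)| < 1.
  by near: t; exact: cvg_pinfty_near_lt cvg_f1_ratio ltr01.
have T0 : 0 < t `^ (2 * a - 1) by rewrite powR_gt0.
have Aa := mulr_gt0 A_gt0 a0.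
rewrite ltr_norml => /andP[h1 h2].
have : `|f1 t / t `^ (2 * a - 1)| <= A * (2 * a) + 1.
  by rewrite ler_norml; apply/andP; split; lra.
rewrite normrM normfV (gtr0_norm T0) ler_pdivrMr// => h.
by rewrite (powRS_sub1 (2 * a) t0) mulrCA mulrC ler_pM2l.
Unshelve. all: by end_near. Qed.

(** Under perfect correlation the sum would have variance S = (sqrt (f v) + sqrt (f w))^2. The
    actual variance is S + D - f (w - v) with D = (sqrt (f v) - sqrt (f w))^2. With r = (w - v) / u,
    D is of order r^2 u^(2 a) and f (w - v) of order r^(2 a) u^(2 a); as a < 1, the latter wins for
    small r. *)
Lemma pair_variance : exists eta S0 kap : R, [/\ 0 < eta, 0 < S0, 0 < kap &
  \forall u \near +oo, forall v w : R,
    `|v / u - tau| <= eta -> `|w / u - tau| <= eta -> S0 <= w - v ->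
    [/\ 0 < f v, 0 < f w & (2 * f v + 2 * f w - f (w - v)) * (1 + kap * (f (w - v) / u `^ (2 * a)))
       <= (Num.sqrt (f v) + Num.sqrt (f w)) ^+ 2]].
Proof.
have /andP[a0 a1] := a01.
have hf := f_two_sided.
pose C1 := A * (2 * a) + 1.
have C10 : 0 < C1 by have := mulr_gt0 A_gt0 a0; rewrite /C1; lra.
have hf1 := derivative_ub : \forall t \near +oo, `|f1 t| * t <= C1 * t `^ (2 * a).
have [S1 [_ hS1]] := hf; have [S2 [_ hS2]] := hf1.
pose S0 := Num.max (Num.max S1 S2) 0 + 1.
have S01 : S1 < S0 by have : S1 <= Num.max (Num.max S1 S2) 0; [rewrite !le_max lexx|rewrite /S0; lra].
have S02 : S2 < S0 by have : S2 <= Num.max (Num.max S1 S2) 0; [rewrite !le_max lexx orbT|rewrite /S0; lra].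
have S00 : 0 < S0 by have : 0 <= Num.max (Num.max S1 S2) 0; [rewrite !le_max lexx orbT|rewrite /S0; lra].
pose lo := (tau / 2) `^ (2 * a); pose hi := (2 * tau) `^ (2 * a).
have lo0 : 0 < lo by rewrite powR_gt0// divr_gt0.
have hi0 : 0 < hi by rewrite powR_gt0// mulr_gt0.
have tau20 : 0 < tau / 2 by rewrite divr_gt0.
have [C3 C30 C3E] : exists2 C3, 0 < C3 & C3 = C1 * hi / (tau / 2).
  by eexists; [|reflexivity]; exact: divr_gt0 (mulr_gt0 C10 hi0) tau20.
have [m m0 mE] : exists2 m, 0 < m & m = A / 2 * lo.
  by eexists; [|reflexivity]; rewrite mulr_gt0// divr_gt0.
(* The bound on r^(2 - 2 a) that makes D at most f (w - v) / 2; [eta] is then chosen so that r <= 2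
   eta respects it. *)
have [K0 K00 K0E] : exists2 K0, 0 < K0 & K0 = A * m / (4 * C3 ^+ 2).
  by eexists; [|reflexivity]; rewrite divr_gt0 ?mulr_gt0// exprn_gt0.
pose eta := Num.min (tau / 2) (K0 `^ (2 - 2 * a)^-1 / 2).
have eta0 : 0 < eta by rewrite lt_min tau20/= divr_gt0// powR_gt0.
have eta1 : eta <= tau / 2 by rewrite ge_min lexx.
have eta2 : 2 * eta <= K0 `^ (2 - 2 * a)^-1.
  have : eta <= K0 `^ (2 - 2 * a)^-1 / 2 by rewrite ge_min lexx orbT.
  by lra.
have etaK : (2 * eta) `^ (2 - 2 * a) <= K0.
  have p0 : 0 < 2 - 2 * a by lra.
  apply: (@le_trans _ _ ((K0 `^ (2 - 2 * a)^-1) `^ (2 - 2 * a))).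
    by apply: ge0_ler_powR; rewrite ?nnegrE ?powR_ge0 ?mulr_ge0 ?(ltW eta0) ?(ltW p0).
  by rewrite -powRrM mulVf ?gt_eqF// powRr1// ltW.
have [M M0 ME] : exists2 M, 0 < M & M = 2 * A * hi.
  by eexists; [|reflexivity]; rewrite !mulr_gt0.
exists eta, S0, (8 * M)^-1; split => //; first by rewrite invr_gt0 mulr_gt0.
apply: filterS (filterI (near_pinfty_gt 0)
  (near_pinfty_ge (S0 / (tau / 2)))) => u [u0 uS] v w hv hw hvw.
have U0 : 0 < u `^ (2 * a) by rewrite powR_gt0.
set U := u `^ (2 * a) in U0 *.
have win z : `|z / u - tau| <= eta -> [/\ 0 < z, m * U <= f z, f z <= M * U & `|f1 z| <= C3 * U / u].
  move=> hz; have : tau / 2 <= z / u <= 2 * tau.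
    by move: hz; rewrite ler_norml => /andP[z1 z2]; apply/andP; split; lra.
  move=> /andP[z1 z2].
  have zu0 : 0 < z / u by exact: lt_le_trans z1.
  have z0 : 0 < z by move: zu0; rewrite pmulr_lgt0// invr_gt0.
  have zS : S0 <= z.
    move: uS; rewrite (ler_pdivrMr _ _ tau20) => uS; apply: (le_trans uS).
    by rewrite mulrC -ler_pdivlMr.
  have a20 : 0 <= 2 * a by rewrite mulr_ge0// ltW.
  have zE : z `^ (2 * a) = (z / u) `^ (2 * a) * U.
    by rewrite scaled_powR// divfK// gt_eqF.
  have zlo : lo * U <= z `^ (2 * a).
    rewrite zE ler_pM2r//; apply: ge0_ler_powR => //; rewrite ?nnegrE ?(ltW zu0)//.
    exact: ltW.
  have zhi : z `^ (2 * a) <= hi * U.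
    rewrite zE ler_pM2r//; apply: ge0_ler_powR => //; rewrite ?nnegrE ?(ltW zu0)//.
    by rewrite mulr_ge0// ltW.
  have /andP[f_lo f_hi] := hS1 z (lt_le_trans S01 zS).
  have f_1 := hS2 z (lt_le_trans S02 zS).
  have A20 : 0 < A / 2 by rewrite divr_gt0.
  have A2 : 0 < 2 * A by rewrite mulr_gt0.
  split => //.
  - by apply: le_trans f_lo; rewrite mE -[leLHS]mulrA ler_pM2l.
  - by apply: (le_trans f_hi); rewrite ME -[leRHS]mulrA ler_pM2l.
  - rewrite -(ler_pM2r z0); apply: (le_trans f_1).
    apply: (@le_trans _ _ (C1 * (hi * U))); first by rewrite ler_pM2l.
    have CU : 0 < C1 * hi * U by rewrite !mulr_gt0.
    have -> : C3 * U / u * z = C1 * hi * U * ((z / u) / (tau / 2)).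
      by rewrite C3E; field; rewrite !gt_eqF.
    by rewrite mulrA -[leLHS]mulr1 ler_pM2l// (ler_pdivlMr _ _ tau20) mul1r.
have [v0 v1 v2 _] := win v hv; have [w0 w1 w2 _] := win w hw.
have mU : 0 < m * U by rewrite mulr_gt0.
have fv := lt_le_trans mU v1; have fw := lt_le_trans mU w1.
split => //.
pose dl := w - v; have dl0 : 0 < dl by exact: lt_le_trans hvw.
rewrite -/dl in hvw *.
have /andP[F_lo _] := hS1 dl (lt_le_trans S01 hvw).
set F := f dl in F_lo *.
have D0 : 0 < dl `^ (2 * a) by rewrite powR_gt0.
have F0 : 0 < F by apply: lt_le_trans F_lo; rewrite mulr_gt0// divr_gt0.
have r0 : 0 < dl / u by rewrite divr_gt0.
have r1 : dl / u <= 2 * eta.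
  have -> : dl / u = (w / u - tau) - (v / u - tau) by rewrite /dl; ring.
  apply: (le_trans (ler_norm _)); apply: (le_trans (ler_normB _ _)).
  by rewrite mulr_natl mulr2n lerD.
set r := dl / u in r0 r1.
have vw : v < w by rewrite -subr_gt0.
have dfvw z : v <= z <= w -> is_derive z 1 f (f1 z).
  by move=> /andP[vz _]; apply: is_derive_f; exact: lt_le_trans vz.
have [z /andP[vz zw] eqz] := mean_value vw dfvw.
have hz : `|z / u - tau| <= eta.
  move: hv hw; rewrite !scaled_dist_le// => /andP[p1 p2] /andP[p3 p4].
  by rewrite (le_trans p1 (ltW vz)) (le_trans (ltW zw) p4).
have [_ _ _ f1z] := win z hz.
have df2 : (f w - f v) ^+ 2 <= (C3 * U * r) ^+ 2.
  have h1 : `|f w - f v| <= C3 * U * r.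
    have -> : C3 * U * r = C3 * U / u * dl by rewrite /r; ring.
    by rewrite eqz normrM -/dl (gtr0_norm dl0) ler_pM2r.
  have h2 := le_trans (normr_ge0 _) h1.
  by rewrite -[leLHS]real_normK ?num_real//; apply: lerXn2r h1; rewrite nnegrE.
have p2 := sqr_sqrtr (ltW fv); have q2 := sqr_sqrtr (ltW fw).
have p0 := sqrtr_ge0 (f v); have q0 := sqrtr_ge0 (f w).
set p := Num.sqrt (f v) in p2 p0 *; set q := Num.sqrt (f w) in q2 q0 *.
(* S D = (f w - f v)^2 turns the mean value bound on f into a bound on D. *)
pose S := (p + q) ^+ 2; pose D := (p - q) ^+ 2.
have pq := mulr_ge0 p0 q0.
have SD : S + D = 2 * f v + 2 * f w by rewrite /S /D -p2 -q2; ring.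
have Smul : S * D = (f w - f v) ^+ 2 by rewrite /S /D -p2 -q2; ring.
have SmU : m * U <= S.
  apply: (le_trans v1); rewrite -p2 /S lerXn2r ?nnegrE ?addr_ge0// lerDl//.
have D00 : 0 <= D by exact: sqr_ge0.
have SMU : S <= 4 * M * U by lra.
have S0' : 0 < S by exact: lt_le_trans SmU.
have DF : D <= F / 2.
  have h1 : m * U * D <= (C3 * U * r) ^+ 2.
    by apply: le_trans df2; rewrite -Smul ler_wpM2r.
  rewrite -(ler_pM2l mU); apply: (le_trans h1).
  have dlE : dl `^ (2 * a) = r `^ (2 * a) * U.
    by rewrite scaled_powR// divfK// gt_eqF.
  have rE : r ^+ 2 = r `^ (2 * a) * r `^ (2 - 2 * a).
    by rewrite -powRD ?subrKC ?powR_mulrn ?(ltW r0)// (gt_eqF r0) implybT.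
  have rK : r `^ (2 - 2 * a) <= K0.
    apply: le_trans etaK; apply: ge0_ler_powR; rewrite ?nnegrE ?(ltW r0)//; first by lra.
    by rewrite mulr_ge0// ltW.
  have C32 : 0 < C3 ^+ 2 by rewrite exprn_gt0.
  have rp : 0 < r `^ (2 * a) by rewrite powR_gt0.
  apply: (@le_trans _ _ (C3 ^+ 2 * U ^+ 2 * r `^ (2 * a) * K0)).
    have -> : (C3 * U * r) ^+ 2 = C3 ^+ 2 * U ^+ 2 * r ^+ 2 by ring.
    have CUr : 0 <= C3 ^+ 2 * U ^+ 2 * r `^ (2 * a).
      by apply: mulr_ge0; [apply: mulr_ge0; exact: sqr_ge0|exact: ltW].
    by rewrite rE mulrA ler_wpM2l.
  have -> : C3 ^+ 2 * U ^+ 2 * r `^ (2 * a) * K0 = m * U * (A / 4 * (r `^ (2 * a) * U)).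
    by rewrite K0E; field; rewrite gt_eqF.
  by rewrite -dlE ler_pM2l//; lra.
(* Since S <= 4 M U, rho S is at most half of F. The variance is then at most S (1 - rho), and (1 -
   rho)(1 + rho) <= 1. *)
pose rho := (8 * M)^-1 * (F / U).
have rho0 : 0 <= rho by rewrite mulr_ge0 ?invr_ge0 ?divr_ge0 ?mulr_ge0 ?ltW.
have rhoS : rho * S <= F / 2.
  apply: (@le_trans _ _ (rho * (4 * M * U))); first by rewrite ler_wpM2l.
  rewrite le_eqVlt; apply/orP; left; apply/eqP; rewrite /rho; field.
  by rewrite !gt_eqF.
have V1 : 2 * f v + 2 * f w - F <= S * (1 - rho) by lra.
rewrite -/rho -/S.
have r1' : 0 <= 1 + rho by lra.
apply: (le_trans (ler_wpM2r r1' V1)).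
have -> : S * (1 - rho) * (1 + rho) = S - S * rho ^+ 2 by ring.
by rewrite gerBl mulr_ge0 ?sqr_ge0// ltW.
Qed.

(** * The threshold and the effect of shifting the level *)

Lemma powR_1B2a (u : R) : 0 < u -> Q_ u / u = u `^ (1 - 2 * a).
Proof.
move=> u0; rewrite (powRS_sub1 (2 - 2 * a) u0) mulrAC divff ?gt_eqF// mul1r.
by congr (_ `^ _); ring.
Qed.

(** The threshold is the distance, in units of sqrt u, at which the quadratic cost equals the gain
    from lowering the level by x. Here A / B = tau^2 / (a (1 - a)), so its square is 2 tau^2 x /
    a. *)
Lemma threshold_energy (x : R) : 0 < x ->
  G0 * curvature a c * threshold c a x ^+ 2 / 2 = 2 * G0 * (1 - a) * x.
Proof.
move=> x0; have /andP[a0 a1] := a01; have a1' : 0 < 1 - a by rewrite subr_gt0.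
have tp : 0 < tau `^ (- a) by rewrite powR_gt0.
have tE : tau `^ (- a - 2) = tau `^ (- a) / tau ^+ 2.
  by rewrite powRB ?(gt_eqF tau_gt0) ?implybT// powR_mulrn// ltW.
have AB : 2 * constA c a / constB c a * (1 - a) * x = 2 * tau ^+ 2 / a * x.
  rewrite /constA /constB -[a / (c * (1 - a))]/tau tE.
  by field; rewrite !gt_eqF.
rewrite /threshold AB sqr_sqrtr; last first.
  have t20 : 0 <= 2 * tau ^+ 2 by rewrite mulr_ge0// sqr_ge0.
  exact: mulr_ge0 (divr_ge0 t20 (ltW a0)) (ltW x0).
by rewrite /curvature; field; rewrite !gt_eqF.
Qed.

Lemma near_scale_le_sqr (K : R) : \forall u \near +oo, K * Q_ u <= u ^+ 2.
Proof.
have /andP[a0 a1] := a01;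
have a20 : 0 < 2 * a by rewrite mulr_gt0.
apply: filterS (filterI (near_pinfty_gt 0)
  (near_powR_ge K a20)) => u [u0 h].
rewrite powR_2B2a// mulrA ler_pdivrMr ?powR_gt0// mulrC ler_wpM2l//.
by rewrite exprn_ge0// ltW.
Qed.

Lemma minsq_bounds : \forall u \near +oo,
  G0 / 2 * Q_ u <= minsq u <= 2 * G0 * Q_ u.
Proof.
have G20 : 0 < G0 / 2 by rewrite divr_gt0.
apply: filterS (minsq_scaled G20) => u /andP[h1 h2].
have Q0 : 0 <= Q_ u by exact: powR_ge0.
have h3 := mulr_ge0 (ltW G0_gt0) Q0.
by apply/andP; split; lra.
Qed.

Lemma sqrt_minsq_le : \forall u \near +oo, Num.sqrt (minsq u) <= u.
Proof.
apply: filterS (filterI (near_pinfty_gt 0)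
  (filterI minsq_bounds
  (near_scale_le_sqr (2 * G0)))) => u [u0 [/andP[_ h1] h2]].
by have := ler_wsqrtr (le_trans h1 h2); rewrite sqrtr_sqr gtr0_norm.
Qed.

(** A crude cost for lowering the level by y, valid for all t >= 0: 2 y L / p with L <= 3 G0 Q_u and
    p >= u. It serves where y is a small eps or where the constant is irrelevant. *)
Lemma shifted_level (y : R) : 0 <= y -> \forall u \near +oo, forall t L : R, 0 <= t -> 0 <= L ->
  L <= 3 * G0 * Q_ u -> f t * L <= (u + c * t) ^+ 2 ->
  0 < u - y + c * t /\ f t * (L - 6 * y * G0 * w_ u) <= (u - y + c * t) ^+ 2.
Proof.
move=> y0; apply: filterS (filterI (near_pinfty_gt 0)
  (near_pinfty_ge (2 * y + 1))) => u [u0 uy] t L t0 L0 hL hfL.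
have ct : 0 <= c * t by rewrite mulr_ge0// ltW.
have p0 : 0 < u + c * t by lra.
split; first by lra.
have h1 : 2 * y <= u + c * t by lra.
have := lower_level_cost p0 y0 h1 hfL.
have -> : u + c * t - y = u - y + c * t by ring.
apply: le_trans; rewrite ler_wpM2l ?hf0// lerB//.
have Q0 : 0 <= Q_ u by exact: powR_ge0.
rewrite mulrAC ler_pdivrMr//.
have h2 : 2 * y * L <= 2 * y * (3 * G0 * Q_ u) by rewrite ler_wpM2l// mulr_ge0.
apply: (le_trans h2).
have -> : 2 * y * (3 * G0 * Q_ u) = 6 * y * G0 * w_ u * u.
  by field; rewrite gt_eqF.
have w0 : 0 <= Q_ u / u by rewrite divr_ge0// ltW.
have yG : 0 <= 6 * y * G0 by apply: mulr_ge0 (mulr_ge0 _ y0) (ltW G0_gt0).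
by rewrite ler_wpM2l ?lerDl// mulr_ge0.
Qed.

(** The sharp counterpart, needed beyond the threshold: t >= t_u makes u + c t at least about u / (1
    - a), also when t is far from t_u. *)
Lemma shifted_lower (x kap kap' : R) : 0 < x -> 0 <= kap -> 2 * G0 * (1 - a) * x < kap' ->
  \forall u \near +oo, forall t : R, tu u <= t ->
    f t * (minsq u + kap * w_ u) <= (u + c * t) ^+ 2 ->
    0 < u - x + c * t /\
    f t * (minsq u + (kap - kap') * w_ u) <= (u - x + c * t) ^+ 2.
Proof.
move=> x0 kap0 hk; have /andP[a0 a1] := a01.
have a1' : 0 < 1 - a by rewrite subr_gt0.
have G1 : 0 < 2 * G0 * (1 - a) * x by exact: mulr_gt0 (mulr_gt0 (mulr_gt0 _ G0_gt0) a1') x0.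
have k'0 : 0 < kap' by exact: lt_trans hk.
pose phi (e : R) := kap' * (1 + c * tau - c * e) - 2 * x * (G0 + e).
have cphi : {for 0, continuous phi}.
  apply: differentiable_continuous; apply/derivable1_diffP; apply: derivableB.
    by apply: derivableM => //; apply: derivableB.
  by apply: derivableM => //; apply: derivableD.
have h0 : 0 < phi 0.
  rewrite /phi mulr0 subr0 addr0 ctauE.
  have -> : kap' * (1 + a / (1 - a)) - 2 * x * G0 = (kap' - 2 * G0 * (1 - a) * x) / (1 - a).
    by field; rewrite gt_eqF// subr_gt0.
  by rewrite divr_gt0 ?subr_gt0.
have [e /andP[e0 em] ephi] := continuous_lt_near cphi h0 ltr01.
have e20 : 0 < e / 2 by rewrite divr_gt0.
apply: filterS (filterI (near_pinfty_gt 0)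
  (filterI (near_pinfty_ge (2 * x))
  (filterI (argmin_scaled e0)
  (filterI (minsq_scaled e20)
  (filterI (near_pinfty_ge (kap / (e / 2)))
  htu))))) => u [u0 [ux [q1 [/andP[_ q2] [q3 [tu0 _ _]]]]]] t ht h.
have t0 := le_trans tu0 ht.
have Q0 : 0 < Q_ u by rewrite powR_gt0.
set Q := Q_ u in h q2 Q0 *.
have ct : 0 <= c * t by rewrite mulr_ge0// ltW.
have p0 : 0 < u + c * t by lra.
split; first by lra.
have x2p : 2 * x <= u + c * t by lra.
have := lower_level_cost p0 (ltW x0) x2p h.
have -> : u + c * t - x = u - x + c * t by ring.
apply: le_trans; rewrite ler_wpM2l ?hf0//.
set L := minsq u + kap * (Q / u).
have -> : minsq u + (kap - kap') * (Q / u) = L - kap' * (Q / u) by rewrite /L; ring.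
rewrite lerB// mulrAC ler_pdivrMr//.
have hL : L <= (G0 + e) * Q.
  have : kap * (Q / u) <= e / 2 * Q.
    rewrite mulrCA [leRHS]mulrC ler_pM2l// ler_pdivrMr// mulrC.
    by move: q3; rewrite ler_pdivrMr// mulrC.
  by rewrite /L; lra.
have pl : (1 + c * tau - c * e) * u <= u + c * t.
  move: q1; rewrite scaled_dist_le// => /andP[q1 _].
  by have := ler_wpM2l (ltW hc) (le_trans q1 ht); lra.
have x20 : 0 <= 2 * x by rewrite mulr_ge0// ltW.
apply: (le_trans (ler_wpM2l x20 hL)).
have kQ : 0 <= kap' * (Q / u) by rewrite mulr_ge0 ?divr_ge0 ?(ltW k'0) ?(ltW Q0) ?(ltW u0).
apply: le_trans (ler_wpM2l kQ pl).
have -> : kap' * (Q / u) * ((1 + c * tau - c * e) * u) = kap' * (1 + c * tau - c * e) * Q.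
  by field; rewrite gt_eqF.
by rewrite mulrA ler_pM2r//; move: ephi; rewrite /phi; lra.
Qed.

(** At distance at least ze u^b the relative deficit f (w - v) / u^(2 a) is at least of order u^(2 a
    b - 2 a). *)
Lemma pair_gain (th ze b : R) : 0 < b < 1 -> 0 < ze -> exists2 kap : R, 0 < kap &
  \forall u \near +oo, forall v w : R, `|v - tu u| <= th * u `^ b -> `|w - tu u| <= th * u `^ b ->
    ze * u `^ b <= w - v ->
    [/\ 0 < f v, 0 < f w & (2 * f v + 2 * f w - f (w - v)) * (1 + kap * u `^ (2 * a * b - 2 * a))
       <= (Num.sqrt (f v) + Num.sqrt (f w)) ^+ 2].
Proof.
move=> b01 ze0; have /andP[a0 a1] := a01; have /andP[b0 b1] := b01.
have [eta [S0 [kp [eta0 S00 kp0 hp]]]] := pair_variance.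
have [S1 [_ hS1]] := f_two_sided.
exists (kp * (A / 2 * ze `^ (2 * a))).
  by rewrite !mulr_gt0 ?powR_gt0// invr_gt0.
apply: filterS (filterI (near_pinfty_gt 0)
  (filterI (argmin_window th b01 eta0)
  (filterI (near_powR_ge ((S0 + `|S1| + 1) / ze) b0)
  hp))) => u [u0 [q1 [q2 q3]]] v w hv hw hvw.
move: q2; rewrite ler_pdivrMr// => q2.
have wv : S0 + `|S1| + 1 <= w - v by apply: le_trans hvw; rewrite mulrC.
have S1n := ler_norm S1; have S1p := normr_ge0 S1.
have S0wv : S0 <= w - v by lra.
have S1wv : S1 < w - v by lra.
have [fv fw hV] := q3 v w (q1 v hv) (q1 w hw) S0wv.
split => //.
have /andP[fl _] := hS1 _ S1wv.
set V := 2 * f v + 2 * f w - f (w - v) in hV *.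
(* For an abstract f nothing makes [V] nonnegative; if it is not positive the claim is trivial. *)
have [V0|V0] := leP V 0.
  apply: le_trans (sqr_ge0 _); rewrite mulr_le0_ge0//.
  have : 0 <= kp * (A / 2 * ze `^ (2 * a)) * u `^ (2 * a * b - 2 * a).
    by rewrite !mulr_ge0 ?powR_ge0 ?invr_ge0// ltW.
  by lra.
apply: le_trans hV; rewrite ler_pM2l// lerD2l -[leLHS]mulrA ler_pM2l// ler_pdivlMr ?powR_gt0//.
apply: le_trans fl.
have -> : A / 2 * ze `^ (2 * a) * u `^ (2 * a * b - 2 * a) * u `^ (2 * a) =
    A / 2 * (ze `^ (2 * a) * (u `^ (2 * a * b - 2 * a) * u `^ (2 * a))) by ring.
have A20 : 0 < A / 2 by rewrite divr_gt0.
rewrite ler_pM2l//.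
have -> : u `^ (2 * a * b - 2 * a) * u `^ (2 * a) = (u `^ b) `^ (2 * a).
  by rewrite -powRD ?(gt_eqF u0) ?implybT// -powRrM; congr (_ `^ _); ring.
rewrite -powRM ?powR_ge0 ?(ltW ze0)//.
by apply: ge0_ler_powR; rewrite ?nnegrE ?mulr_ge0 ?powR_ge0 ?(ltW ze0) ?(ltW a0)//; lra.
Qed.

End VarianceAsymptotics.

(** * Gaussian tails in terms of exponent levels *)

Section Levels.
Context {R : realType}.
Implicit Types v z L : R.

Lemma gauss_tail_le_level v z L : 0 <= v -> 0 <= z -> 0 < L -> v * L <= z ^+ 2 ->
  gauss_tail v z <= 2 * expR (- (L / 2)).
Proof.
move=> v0 z0 L0 h; have [v_eq0|vn0] := eqVneq v 0.
  by rewrite /gauss_tail v_eq0 eqxx mulr_ge0 ?expR_ge0.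
have vp : 0 < v by rewrite lt_neqAle eq_sym vn0.
have z20 : 0 < z ^+ 2 by apply: lt_le_trans h; rewrite mulr_gt0.
have := @gauss_tail_ub _ v (z ^+ 2 / L) z; rewrite v0 ler_pdivlMr// => /(_ h z0).
congr (_ <= 2 * expR (- _)); field.
rewrite gt_eqF//=; apply/negP => /eqP zE; move: z20.
by rewrite zE expr0n ltxx.
Qed.

(** The factor 1 / sqrt L is kept for the case a >= 1/2, where the probabilities compared differ
    only by bounded factors. *)
Lemma gauss_tail_le_level_sharp v z L : 0 <= v -> 0 <= z -> 0 < L -> v * L <= z ^+ 2 ->
  gauss_tail v z <= expR (- (L / 2)) / Num.sqrt L.
Proof.
move=> v0 z0 L0 h; have s0 : 0 < Num.sqrt L by rewrite sqrtr_gt0.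
rewrite /gauss_tail; case: eqP => [_|/eqP vn0].
  by rewrite divr_ge0 ?expR_ge0// ltW.
have vp : 0 < v by rewrite lt_neqAle eq_sym vn0.
have hs : Num.sqrt L <= z / Num.sqrt v.
  rewrite ler_pdivlMr ?sqrtr_gt0// -sqrtrM ?(ltW L0)// mulrC.
  by have := ler_wsqrtr h; rewrite sqrtr_sqr ger0_norm.
apply: (le_trans (Psi_nincr hs)); have := Psi_ub1 s0.
by rewrite sqr_sqrtr// ltW.
Qed.

Lemma gauss_tail_ge_level : exists2 k : R, 0 < k & forall v z L, 0 < v -> 0 <= z -> z ^+ 2 <= v * L ->
  k / (1 + Num.sqrt L) * expR (- (L / 2)) <= gauss_tail v z.
Proof.
have [k k0 hk] := @Psi_lb R; exists k => // v z L v0 z0 h.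
have L0 : 0 <= L by rewrite -(pmulr_rge0 _ v0); exact: le_trans (sqr_ge0 z) h.
rewrite /gauss_tail gt_eqF//.
have hs : z / Num.sqrt v <= Num.sqrt L.
  rewrite ler_pdivrMr ?sqrtr_gt0// -sqrtrM//.
  by have := ler_wsqrtr h; rewrite sqrtr_sqr ger0_norm// mulrC.
apply: le_trans (Psi_nincr hs); have := hk _ (sqrtr_ge0 L).
by rewrite sqr_sqrtr.
Qed.

Lemma asymp_eq_rel_error (g h : R -> R) :
  (forall e, 0 < e -> \forall u \near +oo, 0 < g u /\ `|h u - g u| <= e * g u) ->
  asymp_eq_infty h g.
Proof.
move=> hyp; apply/cvgrPdist_le => e e0.
apply: filterS (hyp e e0) => u [gu hg].
rewrite -normrN opprB -[X in _ - X](divff (lt0r_neq0 gu)) -mulrBl normrM normfV (gtr0_norm gu).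
by rewrite ler_pdivrMr.
Qed.

End Levels.

(** * Level bounds for queue events, and the minimiser [t_opt] *)

Section LevelProbabilities.
Context {d : measure_display} {Omega : measurableType d} {R : realType}.
Variable P : probability Omega R.
Variable X : R -> {RV P >-> R}.
Hypothesis hX : centered_gaussian_si X.
Variable c : R.
Hypothesis hc : 0 < c.
Local Notation f := (sigma2 X).

Lemma netput_prob_le_level t s u L : 0 <= s <= t -> 0 <= u + c * (t - s) -> 0 < L ->
  f (t - s) * L <= (u + c * (t - s)) ^+ 2 ->
  (P (netput_gt X c t s u) <= (2 * expR (- (L / 2)))%:E)%E.
Proof.
move=> st z0 L0 h; rewrite netput_gtE (increment_tail hX st z0) lee_fin.
have ts : 0 <= t - s by rewrite subr_ge0; case/andP: st.
exact: gauss_tail_le_level (sigma2_ge0 hX ts) z0 L0 h.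
Qed.

Lemma netput_prob_ge_level : exists2 k : R, 0 < k & forall t s u L, 0 <= s <= t ->
  0 <= u + c * (t - s) -> 0 < f (t - s) -> (u + c * (t - s)) ^+ 2 <= f (t - s) * L ->
  ((k / (1 + Num.sqrt L) * expR (- (L / 2)))%:E <= P (netput_gt X c t s u))%E.
Proof.
have [k k0 hk] := @gauss_tail_ge_level R; exists k => // t s u L st z0 f0 h.
by rewrite netput_gtE (increment_tail hX st z0) lee_fin hk.
Qed.

(* On the intersection X_t - X_r + X_t - X_s exceeds the sum of the two levels,
   and rho measures by how much the variance of that sum falls short of the
   perfectly correlated case. *)
Lemma joint_increment_le_level r s t y z L rho : 0 <= r -> r <= s -> s <= t ->
  0 <= y -> 0 <= z -> 0 < L -> 0 <= rho ->
  f (t - r) * L <= y ^+ 2 -> f (t - s) * L <= z ^+ 2 ->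
  (2 * f (t - r) + 2 * f (t - s) - f (s - r)) * (1 + rho) <=
    (Num.sqrt (f (t - r)) + Num.sqrt (f (t - s))) ^+ 2 ->
  (P ([set w | (y < X t w - X r w)%R] `&` [set w | (z < X t w - X s w)%R]) <=
    (2 * expR (- (L * (1 + rho) / 2)))%:E)%E.
Proof.
move=> r0 rs st y0 z0 L0 rho0 hy hz hV.
have tr : 0 <= t - r by rewrite subr_ge0 (le_trans rs).
have ts : 0 <= t - s by rewrite subr_ge0.
have cp := cgauss_pair hX r0 rs st.
have yz := addr_ge0 y0 z0.
apply: (@le_trans _ _ (P [set w | (y + z < (X t w - X r w) + (X t w - X s w))%R])).
  apply: le_measure; rewrite ?inE.
  - by apply: measurableI; apply: measurable_gt; exact: measurable_increment.
  - by case: cp => mp _ _ _; exact: measurable_gt.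
  - by move=> w /= [h1 h2]; rewrite ltrD.
rewrite (cgauss_tail cp yz) lee_fin; apply: gauss_tail_le_level => //.
- exact: cgauss_ge0 cp.
- by rewrite mulr_gt0//; lra.
have sq v y' : 0 <= v -> 0 <= y' -> v * L <= y' ^+ 2 -> Num.sqrt v * Num.sqrt L <= y'.
  move=> v0 y'0 h; rewrite -sqrtrM//.
  by have := ler_wsqrtr h; rewrite sqrtr_sqr ger0_norm.
have h1 := sq _ _ (sigma2_ge0 hX tr) y0 hy; have h2 := sq _ _ (sigma2_ge0 hX ts) z0 hz.
rewrite mulrCA mulrC.
apply: (@le_trans _ _ ((Num.sqrt (f (t - r)) + Num.sqrt (f (t - s))) ^+ 2 * L)).
  by rewrite ler_pM2r.
rewrite -[X in _ * X](sqr_sqrtr (ltW L0)) -exprMn lerXn2r ?nnegrE ?mulr_ge0 ?addr_ge0 ?sqrtr_ge0//.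
by rewrite mulrDl lerD.
Qed.

(** As X 0 = 0 almost surely, the level event is an increment event started at 0, to which the joint
    bound applies with r = 0. *)
Lemma level_set_start (t z : R) (B : set Omega) (b : R) : 0 <= t -> measurable B ->
  (P ([set w | (z < X t w - X 0 w)%R] `&` B) <= b%:E)%E ->
  (P ([set w | (z < X t w)%R] `&` B) <= b%:E)%E.
Proof.
move=> t0 mB; apply: le_trans.
have [N [mN N0 hN]] := cgsi_start hX.
have m1 : measurable [set w | (z < X t w - X 0 w)%R].
  by apply: measurable_gt; exact: measurable_increment.
have m2 := measurable_level X t z.
apply: (@le_trans _ _ (P (([set w | (z < X t w - X 0 w)%R] `&` B) `|` N))).
  apply: le_measure; rewrite ?inE.
  - exact: measurableI.
  - by apply: measurableU => //; exact: measurableI.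
  - move=> w /= [h1 h2]; have [h|h] := eqVneq (X 0 w) 0.
      by left; rewrite h subr0.
    by right; apply: hN => /=; exact/eqP.
apply: (le_trans (measureU2 _ _ _)) => //; first exact: measurableI.
by rewrite -[leRHS]adde0 leeD2l// le_eqVlt -N0 eqxx.
Qed.

(** Induction on n; the crude count n^2 of pairs is good enough and makes the inductive step linear
    arithmetic. *)
Lemma bonferroni_lower (A : nat -> set Omega) n (p q : R) : 0 <= q ->
  (forall i, (i < n)%N -> measurable (A i)) ->
  (forall i, (i < n)%N -> (p%:E <= P (A i))%E) ->
  (forall i j, (i < j)%N -> (j < n)%N -> (P (A i `&` A j) <= q%:E)%E) ->
  ((n%:R * p - n%:R ^+ 2 * q)%:E <= P (\bigcup_(i < n) A i))%E.
Proof.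
move=> q0; elim: n => [|n IH] mA hp hq.
  by rewrite mul0r expr0n/= mul0r subrr.
have mU : measurable (\bigcup_(i < n) A i).
  by apply: bigcup_measurable => i /= ?; apply: mA; exact: ltnW.
have mn : measurable (A n) by exact: mA.
have -> : \bigcup_(i < n.+1) A i =
    (\bigcup_(i < n) A i) `|` A n.
  apply/seteqP; split => w.
    move=> [i /=]; rewrite ltnS leq_eqVlt => /orP[/eqP ->|h] Aw; first by right.
    by left; exists i.
  by move=> [[i /= h Aw]|Aw]; [exists i => //=; exact: ltnW|exists n => /=].
have IH' : ((n%:R * p - n%:R ^+ 2 * q)%:E <= P (\bigcup_(i < n) A i))%E.
  apply: IH => [i h|i h|i j h1 h2]; [exact/mA/ltnW|exact/hp/ltnW|].
  by apply: hq => //; exact: ltnW.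
have hI : (P ((\bigcup_(i < n) A i) `&` A n) <= (n%:R * q)%:E)%E.
  rewrite setI_bigcupl; apply: finite_union_bound => i h.
    by apply: measurableI => //; apply: mA; exact: ltnW.
  exact: hq.
have hn := hp n (ltnSn n).
rewrite -(probability_fineK P mU) lee_fin in IH'.
rewrite -(probability_fineK P mn) lee_fin in hn.
have mI := measurableI _ _ mU mn.
rewrite -(probability_fineK P mI) lee_fin in hI.
have mUU : measurable ((\bigcup_(i < n) A i) `|` A n) by exact: measurableU.
rewrite -(probability_fineK P mUU) lee_fin.
have eqU : fine (P ((\bigcup_(i < n) A i) `|` A n)) =
    fine (P (\bigcup_(i < n) A i)) + fine (P (A n)) -
    fine (P ((\bigcup_(i < n) A i) `&` A n)).
  by rewrite measureUfinr ?ltey_eq ?fin_num_measure// fineB ?fineD ?fin_numD ?fin_num_measure//.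
rewrite eqU -natr1 mulrDl mul1r sqrrD mulr1 expr1n !mulrDl mul1r.
have := mulr_ge0 (ler0n R n) q0; lra.
Qed.

Lemma sigma2_bounded_near0 A0 alpha0 : AII f A0 alpha0 ->
  exists2 t0 : R, 0 < t0 & exists C : R, forall t : R, 0 <= t < t0 -> f t <= C.
Proof.
move=> hAII; have [A00 /andP[al0 _] _] := hAII.
have [t0 t00 h] := sigma2_near0 hAII; exists t0 => //.
exists (2 * A0 * t0 `^ (2 * alpha0)) => t /andP[]; rewrite le_eqVlt => /orP[/eqP <- _|tp tt0].
  by rewrite (sigma2_0 hX) !mulr_ge0 ?powR_ge0 ?ltW.
have h1 : f t <= 2 * A0 * t `^ (2 * alpha0) by apply: h; rewrite tp.
apply: (le_trans h1); rewrite ler_pM2l ?mulr_gt0//.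
by apply: ge0_ler_powR; rewrite ?nnegrE ?mulr_ge0// ltW.
Qed.

(** Translates minimality of [m_ratio], with its value +oo where sigma vanishes, into the
    cross-multiplied form. Existence for large u ensures that [xget] returns a genuine minimiser. *)
Lemma t_opt_argmin A0 alpha0 Ainf a : AI f Ainf a -> AII f A0 alpha0 ->
  \forall u \near +oo, argmin_pt f c u (t_opt X c u).
Proof.
move=> hAI hAII.
have hf0 (t : R) : 0 <= t -> 0 <= f t by exact: sigma2_ge0.
have hb0 : exists2 t0 : R, 0 < t0 & exists C : R, forall t, 0 <= t < t0 -> f t <= C.
  exact: sigma2_bounded_near0 hAII.
have ex := argmin_pt_exists hAI hc hf0 hb0.
near=> u.
have u0 : 0 < u by near: u; exact: near_pinfty_gt.
have [t0 [t00 ft0 t0min]] : exists t, argmin_pt f c u t by near: u.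
have pos t : 0 <= t -> 0 < u + c * t by move=> ht; have := mulr_ge0 (ltW hc) ht; lra.
have ratio_le s t : 0 <= s -> 0 <= t -> 0 < f s -> 0 < f t ->
    ((u + c * t) / Num.sqrt (f t) <= (u + c * s) / Num.sqrt (f s)) =
    (f s * (u + c * t) ^+ 2 <= f t * (u + c * s) ^+ 2).
  move=> s0 t0' fs ft; have ps := ltW (pos s s0); have pt := ltW (pos t t0').
  rewrite ler_pdivrMr ?sqrtr_gt0// mulrAC ler_pdivlMr ?sqrtr_gt0//.
  rewrite -[LHS](ler_pXn2r (ltn0Sn 1)) ?nnegrE ?mulr_ge0 ?sqrtr_ge0//.
  by rewrite !exprMn (sqr_sqrtr (ltW fs)) (sqr_sqrtr (ltW ft)); congr (_ <= _); rewrite mulrC.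
have sigma_neq0 t : 0 <= t -> (sigma X t == 0) = ~~ (0 < f t).
  move=> t0'; rewrite /sigma sqrtr_eq0 leNgt//.
have [tmin0 tmin] : is_argmin X c u (t_opt X c u).
  have : is_argmin X c u t0.
    split => // s s0; rewrite /m_ratio sigma_neq0// ft0/= sigma_neq0//.
    case: ifPn => [_|]; first exact: leey.
    by rewrite negbK => fs; rewrite lee_fin ratio_le// t0min.
  by move=> h; have := @xgetPex _ 0 [set t | is_argmin X c u t] (ex_intro _ t0 h).
have ftmin : 0 < f (t_opt X c u).
  have := tmin t0 t00; rewrite /m_ratio sigma_neq0// sigma_neq0// ft0/=.
  by case: ifPn; rewrite ?negbK//; rewrite leye_eq.
split => // s s0; have [fs|fs] := ltP 0 (f s); last first.
  have -> : f s = 0 by apply/eqP; rewrite eq_le fs hf0.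
  by rewrite mul0r mulr_ge0 ?sqr_ge0// ltW.
have := tmin s s0; rewrite /m_ratio !sigma_neq0// ftmin fs/= lee_fin.
by rewrite ratio_le.
Unshelve. all: by end_near. Qed.

End LevelProbabilities.

(** * Comparison of the level event with the overflow event *)

Section QueueAsymptotics.
Context {d : measure_display} {Omega : measurableType d} {R : realType}.
Variable P : probability Omega R.
Variable X : R -> {RV P >-> R}.
Hypothesis hX : centered_gaussian_si X.
Variables (c A a A0 alpha0 : R).
Hypothesis hc : 0 < c.
Hypothesis hAI : AI (sigma2 X) A a.
Hypothesis hAII : AII (sigma2 X) A0 alpha0.

Local Notation f := (sigma2 X).
Local Notation tau := (crit_point a c).
Local Notation G0 := (min_value A a c).
Local Notation k0 := (curvature a c).
Local Notation tu := (t_opt X c).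
Local Notation minsq u := ((u + c * tu u) ^+ 2 / f (tu u)).
Local Notation Q_ u := (u `^ (2 - 2 * a)).
Local Notation w_ u := (Q_ u / u).

Let A_gt0 : 0 < A. Proof. exact: AI_A_gt0 hAI. Qed.
Let a01 : 0 < a < 1. Proof. exact: AI_alpha_bounds hAI. Qed.
Let tau_gt0 : 0 < tau. Proof. exact: tau_gt0 hAI hc. Qed.
Let G0_gt0 : 0 < G0. Proof. exact: G0_gt0 hAI hc. Qed.
Let k0_gt0 : 0 < k0. Proof. exact: k0_gt0 hAI hc. Qed.
Let hf0 (t : R) : 0 <= t -> 0 <= f t. Proof. exact: sigma2_ge0. Qed.
Let hb0 : exists2 t0 : R, 0 < t0 & exists C : R, forall t : R, 0 <= t < t0 -> f t <= C.
Proof. exact: sigma2_bounded_near0 hAII. Qed.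
Let htu : \forall u \near +oo, argmin_pt f c u (tu u).
Proof. exact: t_opt_argmin hAI hAII. Qed.

(** The jump term exp(-u^2) of the chaining bound is absorbed because the exponent is at most 2 u^2:
    both [Q_ u] and [w_ u] are o(u^2). *)
Lemma overflow_event_ub (K del eps : R) : 0 < K -> 0 < eps -> exists p : nat,
  \forall u \near +oo, forall t (E : set Omega), 0 < t <= K * u -> measurable E ->
    (forall v : R, 0 <= v <= t -> (P (E `&` netput_gt X c t (t - v) (u - eps)) <=
      (2 * expR (- ((minsq u + del * w_ u) / 2)))%:E)%E) ->
    (P (E `&` overflow X c t u) <=
      (3 * u ^+ p * expR (- ((minsq u + del * w_ u) / 2)))%:E)%E.
Proof.
move=> K0 e0; have [p hp] := overflow_union_bound hX hc hAII e0 K0.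
exists p; apply: filterS (filterI (near_pinfty_ge 1)
  (filterI (minsq_bounds hAI hc hb0 htu)
  (filterI (near_scale_le_sqr hAI (2 * G0))
  (filterI (near_scale_le_sqr hAI `|del|)
  hp)))) => u [u1 [/andP[_ q1] [q2 [q3 hpu]]]] t E tK mE h.
have u0 : 0 < u by lra.
set B := expR (- ((minsq u + del * w_ u) / 2)) in h *.
apply: (le_trans (hpu t E (2 * B) tK mE _)).
  move=> s /andP[s0 st]; have := h (t - s); rewrite subKr; apply.
  by rewrite subr_ge0 st gerBl.
rewrite lee_fin.
have up : 1 <= u ^+ p by rewrite exprn_ege1.
have B0 : 0 < B by rewrite expR_gt0.
have hB : expR (- u ^+ 2) <= B.
  rewrite ler_expR lerN2 ler_pdivrMr//.
  have Q0 : 0 <= Q_ u by exact: powR_ge0.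
  have : del * w_ u <= u ^+ 2.
    apply: le_trans q3; apply: (@le_trans _ _ (`|del| * w_ u)).
      by rewrite ler_wpM2r ?ler_norm// divr_ge0// ltW.
    by rewrite ler_wpM2l// ler_pdivrMr// ler_peMr.
  by lra.
have : B <= u ^+ p * B by rewrite ler_peMl// ltW.
by lra.
Qed.

Lemma level_weight_le (k L M u : R) : 0 < k -> L <= M -> Num.sqrt M <= u ->
  k / (1 + u) <= k / (1 + Num.sqrt L).
Proof.
move=> kp LM Mu; have h := le_trans (ler_wsqrtr LM) Mu; have s0 := sqrtr_ge0 L.
by rewrite ler_pM2l// lef_pV2 ?posrE ?lerD2l//; lra.
Qed.

(** Once T >= t_u the optimal v = t_u is available, and its single event already gives the order up
    to a polynomial factor. *)
Lemma pi_queue0_ge_min : exists2 k : R, 0 < k & \forall u \near +oo, forall t : R, tu u <= t ->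
  k / (1 + u) * expR (- (minsq u / 2)) <= pi_queue X c 0 t u.
Proof.
have [k kp hk] := @gauss_tail_ge_level R; exists k => //; apply: filterS (filterI (near_pinfty_gt 0)
  (filterI (sqrt_minsq_le hAI hc hb0 htu)
  htu)) => u [u0 [q1 [t1 ft1 _]]] t ht.
have tp : 0 < tu u.
  by rewrite lt_neqAle t1 andbT; apply/eqP => h; rewrite -h (sigma2_0 hX) ltxx in ft1.
have ct : 0 <= c * tu u by rewrite mulr_ge0// ltW.
have tt : 0 <= tu u <= t by rewrite t1.
apply: le_trans (overflow_ge_tail hX hc (ltW u0) (lt_le_trans tp ht) tt).
have uc : 0 <= u + c * tu u by lra.
have hL : (u + c * tu u) ^+ 2 <= f (tu u) * minsq u by rewrite [leRHS]mulrC divfK// gt_eqF.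
apply: le_trans (hk _ _ _ ft1 uc hL).
by rewrite ler_pM2r ?expR_gt0//; exact: level_weight_le kp (lexx _) q1.
Qed.

(** For a < 1/2, [w_ u] is a positive power of u, so a surplus del w_u in the exponent beats every
    polynomial, whatever the common part m. *)
Lemma near_exp_gap (n : nat) (C k del e : R) : a < 2^-1 -> 0 <= C -> 0 < k -> 0 < del -> 0 < e ->
  \forall u \near +oo, forall m : R,
    C * u ^+ n * expR (- ((m + del * w_ u) / 2)) <= e * (k / (1 + u) * expR (- (m / 2))).
Proof.
move=> a2 C0 kp d0 e0; have p0 : 0 < 1 - 2 * a by lra.
have d2 : 0 < del / 2 by rewrite divr_gt0.
have ek : 0 < e * k / 2 by rewrite divr_gt0// mulr_gt0.
apply: filterS (filterI (near_pinfty_ge 1)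
  (near_mulr_expN C n.+1 p0 d2 ek)) => u [u1 h] m.
have u0 : 0 < u by lra.
rewrite powR_1B2a//.
have -> : - ((m + del * u `^ (1 - 2 * a)) / 2) = - (del / 2 * u `^ (1 - 2 * a)) + - (m / 2) by field.
rewrite expRD mulrA [leRHS]mulrA ler_pM2r ?expR_gt0// mulrA ler_pdivlMr; last by lra.
have D0 : 0 <= C * u ^+ n * expR (- (del / 2 * u `^ (1 - 2 * a))).
  by rewrite !mulr_ge0 ?exprn_ge0 ?expR_ge0// ltW.
have u2 : 1 + u <= 2 * u by lra.
apply: (le_trans (ler_wpM2l D0 u2)).
have -> : C * u ^+ n * expR (- (del / 2 * u `^ (1 - 2 * a))) * (2 * u) =
   2 * (C * u ^+ n.+1 * expR (- (del / 2 * u `^ (1 - 2 * a)))) by rewrite exprS; ring.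
by lra.
Qed.

Lemma window_le_linear (T : R -> R) (th : R) :
  (\forall u \near +oo, `|T u - tu u| <= th * u `^ 2^-1) ->
  \forall u \near +oo, T u <= (tau + 1) * u.
Proof.
have b01 : 0 < (2^-1 : R) < 1 by rewrite invr_gt0 invf_lt1 ?ltr0n ?ltr1n.
move=> hT; apply: filterS (filterI (near_pinfty_gt 0)
  (filterI hT
  (argmin_window hAI hc hb0 htu th b01 ltr01))) => u [u0 [h1 h2]].
by move: (h2 _ h1); rewrite scaled_dist_le// => /andP[].
Qed.

Lemma half_power_scale (u : R) : 0 < u -> Q_ u * (u `^ 2^-1 / u) ^+ 2 = w_ u.
Proof.
move=> u0; rewrite expr_div_n powR12_sqrt ?(ltW u0)// sqr_sqrtr ?(ltW u0)//.
by field; rewrite gt_eqF.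
Qed.

Variable x : R.
Hypothesis hx : 0 < x.
Variable T : R -> R.
Hypothesis hT : forall u : R, 0 < u -> 0 < T u.

Local Notation p0 u := (pi_queue X c 0 (T u) u).
Local Notation p1 u := (gauss_tail (f (T u)) (u - x + c * T u)).

(* Dropping the context first keeps lra from comparing many transcendental
   atoms up to conversion. *)
Local Ltac light_lra :=
  clear -hX hc hAI hAII hx hT A_gt0 a01 tau_gt0 G0_gt0 k0_gt0 hf0 hb0 htu; lra.

(** Below the threshold the gain from x exceeds the quadratic cost of T differing from t_u, so the
    level exponent drops below [minsq u] by a multiple of [w_ u]. The overflow exponent loses less
    than that, even after the passage to the net. *)
Lemma level_dominates (th e : R) : a < 2^-1 -> 0 <= th ->
  G0 * k0 * th ^+ 2 / 2 < 2 * G0 * (1 - a) * x -> 0 < e ->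
  (\forall u \near +oo, `|T u - tu u| <= th * u `^ 2^-1) ->
  \forall u \near +oo, [/\ 0 < f (T u), 0 <= u - x + c * T u, 0 < p1 u & p0 u <= e * p1 u].
Proof.
move=> a2 th0 hth e0 hwin.
have b01 : 0 < (2^-1 : R) < 1 by rewrite invr_gt0 invf_lt1 ?ltr0n ?ltr1n.
(* The margin is 4 del: one del is lost in each of [kap1] and [kap2], which leaves the level
   exponent M - 2 del w against M - del w for the overflow. *)
pose del := (2 * G0 * (1 - a) * x - G0 * k0 * th ^+ 2 / 2) / 4.
have d0 : 0 < del by rewrite divr_gt0// subr_gt0.
have del4 : 4 * del = 2 * G0 * (1 - a) * x - G0 * k0 * th ^+ 2 / 2 by rewrite /del; field.
clearbody del.
pose kap1 := G0 * k0 * th ^+ 2 / 2 + del; pose kap2 := 2 * G0 * (1 - a) * x - del.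
have E0 : 0 <= G0 * k0 * th ^+ 2 / 2.
  by rewrite divr_ge0// mulr_ge0 ?sqr_ge0// mulr_ge0 ?(ltW G0_gt0) ?(ltW k0_gt0).
have h1 : G0 * k0 * th ^+ 2 / 2 < kap1 by rewrite /kap1; lra.
have h2 : kap2 < 2 * G0 * (1 - a) * x by rewrite /kap2; lra.
have h3 : 0 <= kap2 by rewrite /kap2; lra.
have h4 : kap1 - kap2 = - (2 * del) by rewrite /kap1 /kap2; lra.
clearbody kap1 kap2.
have [eta eta0 hgain] := lower_level_gain hAI hc hx h3 h2.
have K0 : 0 < tau + 1 by have := tau_gt0; lra.
(* With this eps the shift costs 6 eps G0 w = del w / 2. *)
have eps0 : 0 < del / (12 * G0) by rewrite divr_gt0// mulr_gt0.
have [p hp] := overflow_event_ub (- del) K0 eps0.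
have [k kp hk] := @gauss_tail_ge_level R.
have hlin := window_le_linear hwin.
apply: filterS (filterI (near_pinfty_gt 0)
  (filterI hwin
  (filterI hlin
  (filterI (argmin_window hAI hc hb0 htu th b01 eta0)
  (filterI (quad_upper hAI hc hb0 htu th0 b01 h1)
  (filterI hgain
  (filterI hp
  (filterI (shifted_level hAI hc hf0 (ltW eps0))
  (filterI (minsq_bounds hAI hc hb0 htu)
  (filterI (minsq_le hc htu)
  (filterI (sqrt_minsq_le hAI hc hb0 htu)
  (filterI (near_exp_gap p a2 (ler0n R 3) kp d0 e0)
  (near_pinfty_ge (8 * del / G0)))))))))))))) => u [u0 [win [lin [q1 [q2 [q3 [q4 [q5 [/andP[q6 q7] [[q8 q9] [q10 [q11 q12]]]]]]]]]]]].
have [T0 fT0 up] := q2 _ win.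
have [z0 gain] := q3 _ (q1 _ win).
have Q0 : 0 < Q_ u by rewrite powR_gt0.
have w0 : 0 < w_ u by rewrite divr_gt0.
have hdw : 8 * del * w_ u <= G0 * Q_ u.
  rewrite mulrCA [leRHS]mulrC ler_pM2l// ler_pdivrMr//.
  by move: q12; rewrite ler_pdivrMr// [leRHS]mulrC.
have GQ : 0 < G0 * Q_ u by rewrite mulr_gt0.
rewrite half_power_scale// in up.
set M := minsq u in up q4 q6 q7 q8 q9 q10 *.
set w := w_ u in up gain q4 q5 q11 w0 hdw *.
clearbody M w.
have dw : 0 < del * w by rewrite mulr_gt0.
have zL : (u - x + c * T u) ^+ 2 <= f (T u) * (M - 2 * del * w).
  have -> : f (T u) * (M - 2 * del * w) = f (T u) * (M + kap1 * w) - f (T u) * (kap2 * w).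
    have -> : kap1 = kap2 - 2 * del by move: h4; light_lra.
    by ring.
  by move: up gain; light_lra.
have p1_ge : k / (1 + u) * expR (- ((M - 2 * del * w) / 2)) <= p1 u.
  apply: le_trans (hk _ _ _ fT0 z0 zL).
  rewrite ler_pM2r ?expR_gt0//; apply: (level_weight_le kp _ q10).
  by move: dw; light_lra.
have p1_gt0 : 0 < p1 u.
  by apply: lt_le_trans p1_ge; rewrite mulr_gt0 ?expR_gt0// divr_gt0// addr_gt0.
split => //; apply: (@le_trans _ _ (e * (k / (1 + u) * expR (- ((M - 2 * del * w) / 2))))); last first.
  by rewrite ler_pM2l.
apply: le_trans (q11 (M - 2 * del * w)).
have -> : M - 2 * del * w + del * w = M + - del * w by ring.
rewrite -lee_fin pi_queue0E// -[overflow _ _ _ _]setTI.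
apply: q4 => //; first by rewrite hT.
move=> v /andP[v0 vT]; rewrite setTI.
have M3 : M <= 3 * G0 * Q_ u by move: q7 GQ; light_lra.
have [zz hv] := q5 v M v0 (ltW q8) M3 (q9 v v0).
have sv : T u - (T u - v) = v by ring.
have cost : 6 * (del / (12 * G0)) * G0 * w = del / 2 * w.
  by field; rewrite gt_eqF.
apply: netput_prob_le_level => //.
- by rewrite subr_ge0 vT gerBl.
- by rewrite sv ltW.
- by move: q6 hdw GQ dw; light_lra.
- rewrite sv; apply: le_trans hv; rewrite cost ler_wpM2l ?hf0//.
  by move: dw; light_lra.
Qed.

(** If v is at least (th / 4) sqrt u away from t_u, the quadratic excess alone is decisive.
    Otherwise v is at least (th / 4) sqrt u below T, and decorrelation raises the joint exponent by
    more than the level x and the shift eps can lower it. *)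
Lemma joint_negligible (th e : R) : a < 2^-1 -> 0 < th -> 0 < e ->
  (\forall u \near +oo, `|T u - tu u| <= 2 * th * u `^ 2^-1) ->
  (\forall u \near +oo, th / 2 * u `^ 2^-1 <= T u - tu u) ->
  \forall u \near +oo, [/\ 0 < f (T u), 0 <= u - x + c * T u, 0 < p0 u &
    (P ([set w | (u - x + c * T u < X (T u) w)%R] `&` overflow X c (T u) u) <= (e * p0 u)%:E)%E].
Proof.
move=> a2 th0 e0 hwin hgap; have /andP[a0 a1] := a01.
have b01 : 0 < (2^-1 : R) < 1 by rewrite invr_gt0 invf_lt1 ?ltr0n ?ltr1n.
have th4 : 0 < th / 4 by rewrite divr_gt0.
have Gk : 0 < G0 * k0 * (th / 4) ^+ 2.
  by rewrite (mulr_gt0 (mulr_gt0 G0_gt0 k0_gt0))// exprn_gt0.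
have [kap kap0 hkap] : exists2 kap, 0 < kap & kap < G0 * k0 * (th / 4) ^+ 2 / 2.
  by exists (G0 * k0 * (th / 4) ^+ 2 / 4); [rewrite divr_gt0|lra].
have [eps eps0 epsE] : exists2 eps, 0 < eps & 6 * eps * G0 = kap / 2.
  exists (kap / (12 * G0)); first by rewrite divr_gt0// mulr_gt0.
  by field; rewrite gt_eqF.
(* C w bounds the combined loss from lowering one level by x and the other by eps. *)
have [C C0 CE] : exists2 C, 0 < C & C = 6 * x * G0 + kap / 2.
  by eexists; [|reflexivity]; rewrite addr_gt0 ?divr_gt0// (mulr_gt0 _ G0_gt0)// mulr_gt0.
have del0 : 0 < kap / 2 by rewrite divr_gt0.
have [kp kp0 hpair] := pair_gain hAI hc hb0 htu (2 * th) b01 th4.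
have K0 : 0 < tau + 1 by have := tau_gt0; lra.
have [p hp] := overflow_event_ub (kap / 2) K0 eps0.
have [k k_0 hk] := pi_queue0_ge_min.
have hlin := window_le_linear hwin.
have hlow := quad_lower hAI hc hf0 hb0 htu th4 hkap.
have hsh1 := shifted_level hAI hc hf0 (ltW eps0).
have hsh2 := shifted_level hAI hc hf0 (ltW hx).
have hexp := near_exp_gap p a2 (ler0n R 3) k_0 del0 e0.
have a1' : 0 < 1 - a by rewrite subr_gt0.
apply: filterS (filterI (near_pinfty_gt 0)
  (filterI hwin
  (filterI hgap
  (filterI hlin
  (filterI hlow
  (filterI hsh1
  (filterI hsh2
  (filterI hpair
  (filterI (minsq_bounds hAI hc hb0 htu)
  (filterI (minsq_le hc htu)
  (filterI (near_pinfty_ge (kap / G0))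
  (filterI (near_pinfty_ge (4 * C / G0))
  (filterI (near_powR_ge ((C + kap / 2) / (G0 / 4 * kp)) a1')
  (filterI hp
  (filterI hexp
  hk))))))))))))))) => u [u0 [win [gap [lin [q1 [q2 [q3 [q4 [/andP[Ml Mu] [[M0 Mle] [q7 [q8 [q9 [q10 [q11 q12]]]]]]]]]]]]]]].
have T0 := hT u0.
have h0 : 0 < u `^ 2^-1 by rewrite powR_gt0.
have Q0 : 0 < Q_ u by rewrite powR_gt0.
have w0 : 0 < w_ u by rewrite divr_gt0.
have wQ y : y / G0 <= u -> y * w_ u <= G0 * Q_ u.
  rewrite ler_pdivrMr// => h; rewrite mulrCA [leRHS]mulrC ler_pM2l// ler_pdivrMr// mulrC.
  by rewrite mulrC; apply: (le_trans h); rewrite mulrC.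
have kapw := wQ _ q7; have Cw := wQ _ q8.
(* Decorrelation gains order Q_u u^(-a) = u^(1 - a) w_u, which exceeds any multiple of [w_ u]. *)
have rhoE : (C + kap / 2) * w_ u <= G0 / 4 * Q_ u * (kp * u `^ (2 * a * 2^-1 - 2 * a)).
  have -> : u `^ (2 * a * 2^-1 - 2 * a) = u `^ (1 - a) / u.
    rewrite (powRS_sub1 (1 - a) u0) [RHS]mulrAC divff ?gt_eqF// mul1r.
    by congr (_ `^ _); field.
  have -> : G0 / 4 * Q_ u * (kp * (u `^ (1 - a) / u)) =
    (u `^ (1 - a) * (G0 / 4 * kp)) * w_ u by ring.
  rewrite ler_pM2r//; move: q9; rewrite ler_pdivrMr//.
  by rewrite mulr_gt0// divr_gt0.
set rho := kp * u `^ (2 * a * 2^-1 - 2 * a) in rhoE q4.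
have rho0 : 0 <= rho by rewrite mulr_ge0 ?powR_ge0// ltW.
set M := minsq u in q1 q10 q12 Ml Mu M0 Mle *.
set w := w_ u in q1 q2 q3 q10 q11 w0 kapw Cw rhoE *.
set Q := Q_ u in q2 q3 Ml Mu Q0 kapw Cw rhoE *.
have GQ : 0 < G0 * Q by rewrite mulr_gt0.
clear q7 q8 q9; clearbody M w Q rho.
have kw0 : 0 < kap * w by rewrite mulr_gt0.
have M3 : M <= 3 * G0 * Q by move: Mu GQ; light_lra.
have [z0 zx] := q3 _ _ (ltW T0) (ltW M0) M3 (Mle _ (ltW T0)).
have fT : 0 < f (T u).
  have t1 : `|tu u - tu u| <= 2 * th * u `^ 2^-1 by rewrite subrr normr0 !mulr_ge0// ltW.
  have t2 : th / 4 * u `^ 2^-1 <= T u - tu u.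
    by apply: le_trans gap; rewrite ler_pM2r//; move: th0; light_lra.
  by have [] := q4 _ _ t1 win t2.
have tuT : tu u <= T u by rewrite -subr_ge0; apply: le_trans gap; rewrite mulr_ge0 ?divr_ge0// ltW.
have p0k := q12 _ tuT.
have kE : 0 < k / (1 + u) * expR (- (M / 2)) by rewrite mulr_gt0 ?expR_gt0// divr_gt0// addr_gt0.
have pos := lt_le_trans kE p0k.
split => //; first exact: ltW.
apply: (@le_trans _ _ (3 * u ^+ p * expR (- ((M + kap / 2 * w) / 2)))%:E); last first.
  by rewrite lee_fin; apply: (le_trans (q11 M)); rewrite ler_pM2l.
have mE := measurable_level X (T u) (u - x + c * T u).
apply: q10 => //; first by rewrite T0.
move=> v /andP[v0 vT]; have sv : T u - (T u - v) = v by ring.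
have [hv|hv] := leP (th / 4 * Num.sqrt u) `|v - tu u|.
  have MM0 : 0 <= M + kap * w by move: M0 kw0; light_lra.
  have MM3 : M + kap * w <= 3 * G0 * Q by move: Mu kapw; light_lra.
  have [zz hz] := q2 v _ v0 MM0 MM3 (q1 v v0 hv).
  apply: (@le_trans _ _ (P (netput_gt X c (T u) (T u - v) (u - eps)))).
    by apply: le_measure; rewrite ?inE; [apply: measurableI|..|exact: subIsetr] => //;
      exact: measurable_netput_gt.
  apply: netput_prob_le_level => //.
  - by rewrite subr_ge0 vT gerBl.
  - by rewrite sv ltW.
  - by move: M0 kw0; light_lra.
  - rewrite sv; apply: le_trans hz; rewrite epsE ler_wpM2l ?hf0//.
    by move: kw0; light_lra.
have hv' : `|v - tu u| < th / 4 * u `^ 2^-1 by rewrite powR12_sqrt// ltW.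
have [hv1 hv2] : v - tu u < th / 4 * u `^ 2^-1 /\ `|v - tu u| <= 2 * th * u `^ 2^-1.
  split; first exact: le_lt_trans (ler_norm _) hv'.
  by apply: (le_trans (ltW hv')); rewrite ler_pM2r//; move: th0; light_lra.
have vTgap : th / 4 * u `^ 2^-1 <= T u - v.
  by move: hv1 gap; set s := u `^ 2^-1; clearbody s; light_lra.
have [fv _ hV] := q4 _ _ hv2 win vTgap.
have [zv hzv] := q2 v M v0 (ltW M0) M3 (Mle v v0).
have [L L0 LE] : exists2 L, 0 < L & L = M - C * w.
  by eexists; [|reflexivity]; move: Cw Ml GQ; light_lra.
have xw : 0 <= 6 * x * G0 * w.
  by apply: mulr_ge0 (ltW w0); apply: mulr_ge0 (ltW G0_gt0); apply: mulr_ge0 (ltW hx).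
have LG : G0 / 4 * Q <= L by rewrite LE; move: Cw Ml; light_lra.
have Lgain : M + kap / 2 * w <= L * (1 + rho).
  have h1 : G0 / 4 * Q * rho <= L * rho by rewrite ler_wpM2r.
  by rewrite mulrDr mulr1; move: LE rhoE h1; light_lra.
apply: (@le_trans _ _ (2 * expR (- (L * (1 + rho) / 2)))%:E); last first.
  rewrite lee_fin ler_pM2l// ler_expR lerN2 ler_pM2r ?invr_gt0//.
apply: (level_set_start hX (ltW T0)); first exact: measurable_netput_gt.
rewrite netput_gtE; apply: (joint_increment_le_level hX) => //.
- by rewrite subr_ge0.
- by rewrite gerBl.
- exact: ltW.
- by rewrite sv ltW.
- rewrite subr0; apply: le_trans zx; rewrite ler_wpM2l ?(ltW fT)//.
  by rewrite LE CE; move: kw0; light_lra.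
- rewrite sv; apply: le_trans hzv; rewrite ler_wpM2l ?hf0// epsE.
  by rewrite LE CE; move: kw0 xw; light_lra.
- rewrite subr0 sv subr0 [2 * f (T u) + _]addrC [Num.sqrt (f (T u)) + _]addrC.
  exact: hV.
Qed.

(** Beyond the threshold the quadratic cost exceeds the gain from x, so the level exponent stays
    above [minsq u] by del w_u. As the level event concerns a single variable, no chaining
    enters. *)
Lemma level_negligible (th e : R) : a < 2^-1 -> 0 < th -> 0 < e ->
  2 * G0 * (1 - a) * x < G0 * k0 * th ^+ 2 / 2 ->
  (\forall u \near +oo, th * u `^ 2^-1 <= T u - tu u) ->
  \forall u \near +oo, [/\ 0 <= u - x + c * T u, 0 < p0 u & p1 u <= e * p0 u].
Proof.
move=> a2 th0 e0 hth hgap; have /andP[a0 a1] := a01.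
have [del d0 dE] : exists2 del, 0 < del &
    3 * del = G0 * k0 * th ^+ 2 / 2 - 2 * G0 * (1 - a) * x.
  exists ((G0 * k0 * th ^+ 2 / 2 - 2 * G0 * (1 - a) * x) / 3); last by field.
  by rewrite divr_gt0// subr_gt0.
have [kap kapE] : exists kap, kap = 2 * G0 * (1 - a) * x + 2 * del by eexists.
have [kap' kap'E] : exists kap', kap' = 2 * G0 * (1 - a) * x + del by eexists.
have a1' : 0 < 1 - a by rewrite subr_gt0.
have G1 : 0 < 2 * G0 * (1 - a) * x by exact: mulr_gt0 (mulr_gt0 (mulr_gt0 _ G0_gt0) a1') hx.
have h1 : kap < G0 * k0 * th ^+ 2 / 2 by lra.
have h2 : 2 * G0 * (1 - a) * x < kap' by lra.
have h3 : 0 <= kap by lra.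
have h4 : kap - kap' = del by lra.
have hlow := quad_lower hAI hc hf0 hb0 htu th0 h1.
have hsh := shifted_lower hAI hc hf0 hb0 htu hx h3 h2.
have [k k_0 hk] := pi_queue0_ge_min.
have hexp := near_exp_gap 0 a2 (ler0n R 2) k_0 d0 e0.
apply: filterS (filterI (near_pinfty_gt 0)
  (filterI hgap
  (filterI hlow
  (filterI hsh
  (filterI hexp
  (filterI hk
  (minsq_le hc htu))))))) => u [u0 [gap [q1 [q2 [q3 [q4 [M0 _]]]]]]].
have T0 := hT u0.
have w0 : 0 < w_ u by rewrite divr_gt0// powR_gt0.
have dw : 0 < del * w_ u by rewrite mulr_gt0.
have tuT : tu u <= T u by rewrite -subr_ge0; apply: le_trans gap; rewrite mulr_ge0 ?powR_ge0// ltW.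
have gap' : th * Num.sqrt u <= `|T u - tu u|.
  by rewrite -powR12_sqrt ?(ltW u0)//; apply: le_trans gap (ler_norm _).
have [z0 hz] := q2 _ tuT (q1 _ (ltW T0) gap').
rewrite h4 in hz.
have p0k := q4 _ tuT.
have kE : 0 < k / (1 + u) * expR (- (minsq u / 2)) by rewrite mulr_gt0 ?expR_gt0// divr_gt0// addr_gt0.
have pos := lt_le_trans kE p0k.
split => //; first exact: ltW.
have L0 : 0 < minsq u + del * w_ u by rewrite addr_gt0.
have := gauss_tail_le_level (hf0 (ltW T0)) (ltW z0) L0 hz.
move=> /le_trans; apply; have := q3 (minsq u); rewrite expr0 mulr1 => /le_trans; apply.
by rewrite ler_pM2l.
Qed.

(* The events that the netput over [T - v_i, T] exceeds u, for the N starting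
   points v_i = min(T, t_u) - (i / N) u^a, are asymptotically disjoint and have
   probabilities of the same order as that of the level event, so that
   Bonferroni's inequality bounds pi_0 below by N times that order. *)
Lemma level_negligible_long_memory (C e : R) : 2^-1 <= a -> 0 <= C -> 0 < e ->
  (\forall u \near +oo, - (C * u `^ a) <= T u - tu u) ->
  \forall u \near +oo, [/\ 0 <= u - x + c * T u, 0 < p0 u & p1 u <= e * p0 u].
Proof.
move=> a2 C0 e0 hgap; have /andP[a0 a1] := a01.
have s4 : Num.sqrt (4 : R) = 2.
  by rewrite (_ : 4 = 2 ^+ 2) ?sqrtr_sqr ?ger0_norm//; ring.
have C1 : 0 <= C + 1 by rewrite addr_ge0.
have [kap1 kap10 hkap1] : exists2 kap1, 0 <= kap1 & G0 * k0 * (C + 1) ^+ 2 / 2 < kap1.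
  exists (G0 * k0 * (C + 1) ^+ 2 / 2 + 1); last by lra.
  rewrite addr_ge0// divr_ge0// (mulr_ge0 _ (sqr_ge0 _))//.
  by rewrite mulr_ge0 ?(ltW G0_gt0) ?(ltW k0_gt0).
have [k k_0 hk] := netput_prob_ge_level hX c.
have [k1 k10 k1E] : exists2 k1, 0 < k1 & k1 = k * expR (- (kap1 / 2)) / 3.
  by eexists; [|reflexivity]; rewrite divr_gt0// mulr_gt0 ?expR_gt0.
have [C2 C20 C2E] : exists2 C2, 0 < C2 & C2 = 6 * x * G0.
  by eexists; [|reflexivity]; rewrite mulr_gt0// mulr_gt0.
have [k2 k20 k2E] : exists2 k2, 0 < k2 & k2 = 2 * expR (C2 / 2).
  by eexists; [|reflexivity]; rewrite mulr_gt0 ?expR_gt0.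
(* N is chosen so large that the Bonferroni bound N k1 / 2, times e, dominates the level constant
   k2. *)
have [N N0 hN] : exists2 N : nat, 0 < N%:R :> R & k2 <= e * (N%:R * k1 / 2).
  exists (Num.truncn (2 * k2 / (k1 * e))).+1; first by rewrite ltr0n.
  have /truncn_itv/andP[_ h] : 0 <= 2 * k2 / (k1 * e).
    by rewrite divr_ge0 ?mulr_ge0// ltW.
  by move: h; rewrite ltr_pdivrMr ?mulr_gt0//; lra.
have Ni0 : 0 < (N%:R : R)^-1 by rewrite invr_gt0.
have [kp kp0 hpair] := pair_gain hAI hc hb0 htu (C + 1) a01 Ni0.
have hup := quad_upper hAI hc hb0 htu C1 a01 hkap1.
(* The exponent 2 (1 - a)^2 of u in the decorrelation gain between points at distance of order
   u^a. *)
have pexp : 0 < 2 - 4 * a + 2 * a ^+ 2.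
  have -> : 2 - 4 * a + 2 * a ^+ 2 = 2 * (1 - a) ^+ 2 by ring.
  by rewrite mulr_gt0// exprn_gt0// subr_gt0.
have Gkp : 0 < G0 * kp / 4 by rewrite divr_gt0// mulr_gt0.
have kN : 0 < k1 / (2 * N%:R) by rewrite divr_gt0// mulr_gt0.
have p22 : 0 < 2 - 2 * a by lra.
apply: filterS (filterI (near_pinfty_ge 1)
  (filterI hgap
  (filterI hpair
  (filterI hup
  (filterI (shifted_level hAI hc hf0 (ltW hx))
  (filterI (minsq_bounds hAI hc hb0 htu)
  (filterI (minsq_le hc htu)
  (filterI (sqrt_minsq_le hAI hc hb0 htu)
  (filterI (near_mulr_expN 2 1 pexp Gkp kN)
  (near_powR_ge ((2 * C2 + kap1 + 1) / (G0 / 2)) p22)))))))))) => u [u1 [gap [q1 [q2 [q3 [/andP[Ml Mu] [[M0 Mle] [sM [q4 q5]]]]]]]]].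
have u0 : 0 < u by exact: lt_le_trans u1.
have T0 := hT u0.
have ua0 : 0 < u `^ a by rewrite powR_gt0.
have Q0 : 0 < Q_ u by rewrite powR_gt0.
(* Here a >= 1/2 enters: lowering the level changes the exponent by a bounded amount. *)
have w1 : w_ u <= 1.
  rewrite ler_pdivrMr// mul1r -[leRHS](powRr1 (ltW u0)) ler_powR//.
  by move: a2; light_lra.
have Qone : Q_ u * (u `^ a / u) ^+ 2 = 1.
  have -> : (u `^ a / u) ^+ 2 = u `^ (2 * a) / u ^+ 2.
    by rewrite expr_div_n -powR_mulrn ?powR_ge0// -powRrM [a * _]mulrC.
  by rewrite powR_2B2a//; field; rewrite !gt_eqF// powR_gt0.
rewrite Qone in q2.
have rhoE : G0 / 2 * Q_ u * (kp * u `^ (2 * a * a - 2 * a)) =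
    2 * (G0 * kp / 4 * u `^ (2 - 4 * a + 2 * a ^+ 2)).
  have -> : u `^ (2 - 4 * a + 2 * a ^+ 2) = Q_ u * u `^ (2 * a * a - 2 * a).
    by rewrite -powRD ?(gt_eqF u0) ?implybT//; congr (_ `^ _); ring.
  by field.
have rho0 : 0 <= kp * u `^ (2 * a * a - 2 * a) by rewrite mulr_ge0 ?powR_ge0// ltW.
set rho := kp * u `^ (2 * a * a - 2 * a) in q1 rhoE rho0.
set g := G0 * kp / 4 * u `^ (2 - 4 * a + 2 * a ^+ 2) in q4 rhoE.
have G20 : 0 < G0 / 2 by rewrite (divr_gt0 G0_gt0).
move: q5; rewrite (ler_pdivrMr _ _ G20) => q5.
have GQ : 0 < G0 * Q_ u by rewrite mulr_gt0.
have M3 : minsq u <= 3 * G0 * Q_ u by move: Mu GQ; light_lra.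
have [z0 zx] := q3 _ _ (ltW T0) (ltW M0) M3 (Mle _ (ltW T0)).
have Mbig : 2 * C2 + kap1 + 1 <= minsq u by apply: le_trans q5 _; rewrite mulrC.
have gM : 2 * g <= minsq u * rho by rewrite -rhoE ler_wpM2r.
set M := minsq u in q2 M0 Mle sM zx Mbig gM.
set w := w_ u in zx w1.
clear q3 q5 rhoE Ml Mu Qone GQ M3 Q0.
clearbody M w rho g.
(* The common order F = exp(-M / 2) / sqrt M of the level event and of each v_i event, up to
   constant factors. *)
have s0 : 0 < Num.sqrt M by rewrite sqrtr_gt0.
pose E := expR (- (M / 2)); pose F := E / Num.sqrt M.
have E0 : 0 < E by rewrite expR_gt0.
have F0 : 0 < F by rewrite divr_gt0.
have p1F : p1 u <= k2 * F.
  have L0 : 0 < M - C2 by move: Mbig kap10 C20; light_lra.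
  have zL : f (T u) * (M - C2) <= (u - x + c * T u) ^+ 2.
    apply: le_trans zx; rewrite ler_wpM2l ?hf0 ?(ltW T0)// -C2E.
    by rewrite lerD2l lerN2 ger_pMr.
  apply: (le_trans (gauss_tail_le_level_sharp (hf0 (ltW T0)) (ltW z0) L0 zL)).
  have sL : Num.sqrt M / 2 <= Num.sqrt (M - C2).
    have -> : Num.sqrt M / 2 = Num.sqrt (M / 4).
      rewrite sqrtrM ?(ltW M0)//; congr (_ * _).
      by rewrite sqrtrV// s4.
    by apply: ler_wsqrtr; move: Mbig kap10 C20; light_lra.
  have s20 : 0 < Num.sqrt M / 2 by rewrite divr_gt0.
  apply: (@le_trans _ _ (expR (- ((M - C2) / 2)) / (Num.sqrt M / 2))).
    by rewrite ler_pM2l ?expR_gt0// lef_pV2 ?posrE// (lt_le_trans s20).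
  have -> : - ((M - C2) / 2) = C2 / 2 + - (M / 2) by field.
  rewrite expRD -/E /F k2E le_eqVlt; apply/orP; left; apply/eqP; field.
  by rewrite gt_eqF.
(* Starting at the minimum keeps v_i <= T; as T >= t_u - C u^a, all v_i lie within (C + 1) u^a of
   t_u, where the quadratic cost is bounded. *)
pose v i := Num.min (T u) (tu u) - i%:R / N%:R * u `^ a.
have vle i : (i < N)%N -> `|v i - tu u| <= (C + 1) * u `^ a.
  move=> iN.
  have h1 : i%:R / N%:R * u `^ a <= u `^ a.
    by rewrite ger_pMl// ler_pdivrMr// mul1r ler_nat ltnW.
  have h2 : 0 <= i%:R / N%:R * u `^ a by rewrite !mulr_ge0 ?(ltW Ni0) ?(ltW ua0).
  have h3 : 0 <= C * u `^ a by rewrite mulr_ge0// ltW.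
  rewrite /v ler_norml; set s := i%:R / N%:R * u `^ a in h1 h2 *; clearbody s.
  move: h1 h2 h3 gap; set U := u `^ a; clearbody U.
  by case: (leP (T u) (tu u)) => h; move: h; move=> h h1 h2 h3 h4; apply/andP; split; move: h h1 h2 h3 h4; light_lra.
have vT i : v i <= T u.
  have h2 : 0 <= i%:R / N%:R * u `^ a by rewrite !mulr_ge0 ?(ltW Ni0) ?(ltW ua0).
  by apply: (@le_trans _ _ (Num.min (T u) (tu u))); [rewrite gerBl|rewrite ge_min lexx].
have sv i : T u - (T u - v i) = v i by rewrite subKr.
pose Ev i := netput_gt X c (T u) (T u - v i) u.
have mEv i : measurable (Ev i) by exact: measurable_netput_gt.
have srange i : (i < N)%N -> 0 <= T u - v i <= T u.
  by move=> /vle /q2[/ltW v0 _ _]; rewrite subr_ge0 vT gerBl.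
have zpos i : (i < N)%N -> 0 <= u + c * (T u - (T u - v i)).
  by move=> /vle /q2[/ltW v0 _ _]; rewrite sv addr_ge0 ?mulr_ge0 ?(ltW u0) ?(ltW hc).
have PE i : (i < N)%N -> ((k1 * F)%:E <= P (Ev i))%E.
  move=> iN; have [v0 fv0] := q2 _ (vle i iN); rewrite mulr1 => hv.
  have f0 : 0 < f (T u - (T u - v i)) by rewrite sv.
  have hv' : (u + c * (T u - (T u - v i))) ^+ 2 <= f (T u - (T u - v i)) * (M + kap1) by rewrite sv.
  apply: le_trans (hk _ _ _ _ (srange i iN) (zpos i iN) f0 hv'); rewrite lee_fin.
  have -> : - ((M + kap1) / 2) = - (kap1 / 2) + - (M / 2) by field.
  rewrite expRD -/E /F k1E.
  have -> : k * expR (- (kap1 / 2)) / 3 * (E / Num.sqrt M) =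
    k / (3 * Num.sqrt M) * (expR (- (kap1 / 2)) * E) by field; rewrite gt_eqF.
  rewrite ler_pM2r ?mulr_gt0 ?expR_gt0// ler_pM2l//.
  have h1 : 1 <= Num.sqrt M.
    by rewrite -[leLHS]sqrtr1; apply: ler_wsqrtr; move: Mbig kap10 C20; light_lra.
  have h2 : Num.sqrt (M + kap1) <= 2 * Num.sqrt M.
    have -> : 2 * Num.sqrt M = Num.sqrt (4 * M).
      by rewrite sqrtrM// s4.
    by apply: ler_wsqrtr; move: Mbig kap10 C20; light_lra.
  have h3 := sqrtr_ge0 (M + kap1).
  by rewrite lef_pV2 ?posrE ?mulr_gt0//; move: h1 h2 h3; light_lra.
have PEE i j : (i < j)%N -> (j < N)%N -> (P (Ev i `&` Ev j) <= (k1 / (2 * N%:R) * F)%:E)%E.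
  move=> ij jN; have iN := ltn_trans ij jN.
  have vij : v i - v j = (j - i)%:R / N%:R * u `^ a by rewrite /v natrB ?(ltnW ij)//; ring.
  have hgapij : N%:R^-1 * u `^ a <= v i - v j.
    rewrite vij ler_pM2r// -[leLHS]mul1r ler_pM2r// -[1]/(1%:R) ler_nat subn_gt0//.
  have vjvi : 0 <= v i - v j by apply: le_trans hgapij; rewrite mulr_ge0 ?(ltW Ni0) ?(ltW ua0).
  have [fvj fvi hV] := q1 _ _ (vle j jN) (vle i iN) hgapij.
  have /andP[ri0 _] := srange i iN.
  have hrs : T u - v i <= T u - v j by rewrite lerD2l lerN2 -subr_ge0.
  have /andP[_ sj] := srange j jN.
  have [vi0 _ _] := q2 _ (vle i iN); have [vj0 _ _] := q2 _ (vle j jN).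
  rewrite /Ev !netput_gtE.
  apply: (le_trans (@joint_increment_le_level _ _ _ _ _ hX _ _ _ _ _ M rho ri0 hrs sj
    (zpos i iN) (zpos j jN) M0 rho0 _ _ _)).
  - by rewrite !sv; exact: Mle (ltW vi0).
  - by rewrite !sv; exact: Mle (ltW vj0).
  - rewrite !sv [2 * f (v i) + _]addrC [Num.sqrt (f (v i)) + _]addrC.
    by have -> : T u - v j - (T u - v i) = v i - v j by ring.
  rewrite lee_fin.
  apply: (@le_trans _ _ (2 * (expR (- g) * E))).
    rewrite ler_pM2l// /E -expRD ler_expR.
    by move: gM; light_lra.
  have -> : k1 / (2 * N%:R) * F = k1 / (2 * N%:R) / Num.sqrt M * E by rewrite /F; ring.
  rewrite mulrA ler_pM2r// ler_pdivlMr//.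
  apply: le_trans q4; rewrite expr1 mulrAC ler_wpM2r ?expR_ge0// ler_pM2l//.
(* With this pair bound Bonferroni gives N k1 F - N^2 k1 F / (2 N) = N k1 F / 2. *)
have q0 : 0 <= k1 / (2 * N%:R) * F by rewrite mulr_ge0 ?(ltW kN) ?(ltW F0).
have bon := @bonferroni_lower _ _ _ P Ev N (k1 * F) _ q0 (fun i _ => mEv i) PE PEE.
have p0F : N%:R * k1 / 2 * F <= p0 u.
  rewrite -lee_fin pi_queue0E//; apply: le_trans (le_trans bon _).
    rewrite lee_fin le_eqVlt; apply/orP; left; apply/eqP; field.
    by rewrite gt_eqF.
  apply: le_measure; rewrite ?inE.
  - by apply: bigcup_measurable => i _; exact: mEv.
  - exact: measurable_overflow.
  - by move=> w' [i /= iN Ew]; exists (T u - v i) => //; exact: srange.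
have Nk0 : 0 < N%:R * k1 / 2 by rewrite divr_gt0// mulr_gt0.
have pos : 0 < p0 u by exact: lt_le_trans (mulr_gt0 Nk0 F0) p0F.
split => //; first exact: ltW.
apply: (le_trans p1F); apply: (@le_trans _ _ (e * (N%:R * k1 / 2 * F))); last by rewrite ler_pM2l.
by rewrite [leRHS]mulrA ler_pM2r.
Qed.

Lemma pi_queue_le_sum u : 0 < u -> 0 <= u - x + c * T u ->
  pi_queue X c x (T u) u <= p1 u + p0 u.
Proof.
move=> u0 z0.
(* The upper half of the inclusion-exclusion bound holds for any [J], so the trivial 1 is
   supplied. *)
have h : (P ([set w | (u - x + c * T u < X (T u) w)%R] `&` overflow X c (T u) u) <= 1%:E)%E.
  apply: probability_le1; apply: measurableI; last exact: measurable_overflow (hT u0).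
  exact: measurable_level.
by have /andP[] := pi_queue_joint hX hc (hT u0) z0 h.
Qed.

Lemma level_PsiE u : 0 < f (T u) -> p1 u = Psi ((u - x + c * T u) / sigma X (T u)).
Proof. by move=> fT; rewrite /gauss_tail gt_eqF. Qed.

Lemma pi_queue_level_equiv :
  (forall e, 0 < e -> \forall u \near +oo,
     [/\ 0 < f (T u), 0 <= u - x + c * T u, 0 < p1 u & p0 u <= e * p1 u]) ->
  asymp_eq_infty (fun u => pi_queue X c x (T u) u)
    (fun u => Psi ((u - x + c * T u) / sigma X (T u))).
Proof.
move=> h; apply: asymp_eq_rel_error => e e0; apply: filterS (filterI (near_pinfty_gt 0)
  (h e e0)) => u [u0 [fT z0 pos small]].
rewrite -level_PsiE//; split=> //.
have h1 := pi_queue_ge_level hX hc (hT u0) z0.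
have h2 := pi_queue_le_sum u0 z0.
by rewrite ger0_norm ?subr_ge0// lerBlDl; apply: le_trans h2 _; rewrite lerD2l.
Qed.

Lemma pi_queue_overflow_equiv :
  (forall e, 0 < e -> \forall u \near +oo,
     [/\ 0 <= u - x + c * T u, 0 < p0 u & p1 u <= e * p0 u]) ->
  asymp_eq_infty (fun u => pi_queue X c x (T u) u) (fun u => p0 u).
Proof.
move=> h; apply: asymp_eq_rel_error => e e0; apply: filterS (filterI (near_pinfty_gt 0)
  (h e e0)) => u [u0 [z0 pos small]].
split=> //.
have h1 := pi_queue_ge_overflow hX hc x u (hT u0).
have h2 := pi_queue_le_sum u0 z0.
by rewrite ger0_norm ?subr_ge0// lerBlDr; apply: le_trans h2 _; rewrite lerD2r.
Qed.

Lemma pi_queue_sum_equiv :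
  (forall e, 0 < e -> \forall u \near +oo, [/\ 0 < f (T u), 0 <= u - x + c * T u, 0 < p0 u &
    (P ([set w | (u - x + c * T u < X (T u) w)%R] `&` overflow X c (T u) u) <= (e * p0 u)%:E)%E]) ->
  asymp_eq_infty (fun u => pi_queue X c x (T u) u)
    (fun u => Psi ((u - x + c * T u) / sigma X (T u)) + p0 u).
Proof.
move=> h; apply: asymp_eq_rel_error => e e0; apply: filterS (filterI (near_pinfty_gt 0)
  (h e e0)) => u [u0 [fT z0 pos small]].
have /andP[h1 h2] := pi_queue_joint hX hc (hT u0) z0 small.
have psi0 := Psi_ge0 ((u - x + c * T u) / sigma X (T u)).
rewrite (level_PsiE fT) in h1 h2; split; first exact: ltr_wpDl.
have h3 : e * p0 u <= e * (Psi ((u - x + c * T u) / sigma X (T u)) + p0 u).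
  by rewrite ler_pM2l// lerDr.
move: h1 h2 h3 psi0; set r := Psi _; set q := p0 u; set y := pi_queue X c x (T u) u.
by move=> h1 h2 h3 psi0; rewrite ler0_norm ?subr_le0// opprB; move: h1 h3; light_lra.
Qed.

End QueueAsymptotics.

(** * Eventual bounds from limits in the extended reals *)

Section ExtendedLimits.
Context {R : realType}.
Implicit Types (g : R -> R) (l : \bar R) (r : R).

Lemma near_gt_of_ecvg g l r : (g u)%:E @[u --> +oo] --> l -> (r%:E < l)%E ->
  \forall u \near +oo, r < g u.
Proof.
move=> gl rl; have := gl _ (open_nbhs_nbhs (conj (@open_ereal_gt_ereal _ r%:E) rl)).
move=> h; have {h} : \forall u \near +oo, (r%:E < (g u)%:E)%E := h.
by apply: filterS => u; rewrite lte_fin.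
Qed.

Lemma near_lt_of_ecvg g l r : (g u)%:E @[u --> +oo] --> l -> (l < r%:E)%E ->
  \forall u \near +oo, g u < r.
Proof.
move=> gl rl; have := gl _ (open_nbhs_nbhs (conj (@open_ereal_lt_ereal _ r%:E) rl)).
move=> h; have {h} : \forall u \near +oo, ((g u)%:E < r%:E)%E := h.
by apply: filterS => u; rewrite lte_fin.
Qed.

Lemma ereal_between r l : (r%:E < l)%E -> exists2 s, r < s & (s%:E < l)%E.
Proof.
case: l => [l| |//]; last by exists (r + 1); rewrite ?ltry ?ltrDl.
rewrite lte_fin => rl; exists ((r + l) / 2); first by rewrite midf_lt.
by rewrite lte_fin midf_lt.
Qed.

End ExtendedLimits.

(** * Assembly of the cases *)

Theorem theorem3p4 (R : realType) (d : measure_display)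
    (Omega : measurableType d) (P : probability Omega R)
    (X : R -> {RV P >-> R}) (c Ainf alphainf A0 alpha0 x : R)
    (T : R -> R) (omega : \bar R)
    (hX : centered_gaussian_si X) (hc : 0 < c)
    (hAI : AI (sigma2 X) Ainf alphainf) (hAII : AII (sigma2 X) A0 alpha0)
    (hx : 0 < x) (hT : forall u, 0 < u -> 0 < T u)
    (homega : (-oo < omega)%E)
    (hT2 : ((T u - t_opt X c u) / u `^ alphainf)%:E @[u --> +oo] --> omega) :
  (alphainf < 2^-1 ->
    forall theta : \bar R, (0 <= theta)%E ->
    ((T u - t_opt X c u) / Num.sqrt u)%:E @[u --> +oo] --> theta ->
    [/\ (theta < (threshold c alphainf x)%:E)%E ->
          asymp_eq_infty (fun u => pi_queue X c x (T u) u)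
            (fun u => Psi ((u - x + c * T u) / sigma X (T u))),
        theta = (threshold c alphainf x)%:E ->
          asymp_eq_infty (fun u => pi_queue X c x (T u) u)
            (fun u => Psi ((u - x + c * T u) / sigma X (T u)) +
                      pi_queue X c 0 (T u) u)
      & ((threshold c alphainf x)%:E < theta)%E ->
          asymp_eq_infty (fun u => pi_queue X c x (T u) u)
            (fun u => pi_queue X c 0 (T u) u)]) /\
  (2^-1 <= alphainf ->
    asymp_eq_infty (fun u => pi_queue X c x (T u) u)
      (fun u => pi_queue X c 0 (T u) u)).
Proof.
have /andP[a0 a1] := AI_alpha_bounds hAI.
split => [a2 theta theta0 htheta|a2].
  have thrE := threshold_energy hAI hc hx.
  set thr := threshold c alphainf x in thrE *.
  have G0p := G0_gt0 hAI hc; have k0p := k0_gt0 hAI hc.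
  (* Were the square root 0, the positive gain constant would vanish by [threshold_energy]. *)
  have thr0 : 0 < thr.
    have thr_ge0 : 0 <= thr by exact: sqrtr_ge0.
    rewrite lt_neqAle thr_ge0 andbT; apply/eqP => h.
    have a1' : 0 < 1 - alphainf by rewrite subr_gt0.
    have : 0 < 2 * min_value Ainf alphainf c * (1 - alphainf) * x.
      exact: mulr_gt0 (mulr_gt0 (mulr_gt0 _ G0p) a1') hx.
    by rewrite -thrE -h expr0n/= mulr0 mul0r ltxx.
  have Gk : 0 < min_value Ainf alphainf c * curvature alphainf c / 2.
    exact: divr_gt0 (mulr_gt0 G0p k0p) _.
  have energy_lt (s t : R) : 0 <= s -> s < t ->
      min_value Ainf alphainf c * curvature alphainf c * s ^+ 2 / 2 <
      min_value Ainf alphainf c * curvature alphainf c * t ^+ 2 / 2.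
    move=> s0 st; rewrite mulrAC [ltRHS]mulrAC ltr_pM2l//.
    by rewrite ltrXn2r// ?nnegrE// (le_trans s0 (ltW st)).
  have upper (r : R) : (theta < r%:E)%E ->
      \forall u \near +oo, T u - t_opt X c u <= r * u `^ 2^-1.
    move=> hr; have h := near_lt_of_ecvg htheta hr; near=> u.
    have u0 : 0 < u by near: u; exact: near_pinfty_gt.
    have : (T u - t_opt X c u) / Num.sqrt u < r by near: u.
    by rewrite ltr_pdivrMr ?sqrtr_gt0// powR12_sqrt ?(ltW u0)// => /ltW.
  have lower (r : R) : (r%:E < theta)%E ->
      \forall u \near +oo, r * u `^ 2^-1 <= T u - t_opt X c u.
    move=> hr; have h := near_gt_of_ecvg htheta hr; near=> u.
    have u0 : 0 < u by near: u; exact: near_pinfty_gt.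
    have : r < (T u - t_opt X c u) / Num.sqrt u by near: u.
    by rewrite ltr_pdivlMr ?sqrtr_gt0// powR12_sqrt ?(ltW u0)// => /ltW.
  have window (r : R) : 0 < r -> (theta < r%:E)%E ->
      \forall u \near +oo, `|T u - t_opt X c u| <= r * u `^ 2^-1.
    move=> r0 hr; have h1 := upper r hr.
    have h2 : \forall u \near +oo, - r * u `^ 2^-1 <= T u - t_opt X c u.
      by apply: lower; apply: lt_le_trans theta0; rewrite lte_fin oppr_lt0.
    apply: filterS2 h1 h2 => u h1 h2.
    by rewrite ler_norml h1 andbT -mulNr.
  split => hth.
  (* A real s strictly between theta and the threshold turns the limit into an eventual window |T -
     t_u| <= s sqrt u. *)
  - have [s theta_s s_thr] : exists2 s : R, (theta < s%:E)%E & s < thr.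
      case: theta theta0 hth {htheta upper lower window} => [t| |//].
        rewrite lte_fin => _ t_thr; exists ((t + thr) / 2); last by rewrite midf_lt.
        by rewrite lte_fin midf_lt.
      by move=> _; rewrite ltNge leey.
    have s0 : 0 < s by rewrite -lte_fin; exact: le_lt_trans theta_s.
    apply: (pi_queue_level_equiv hX hc hT) => e e0.
    apply: (level_dominates hX hc hAI hAII hx hT a2 (ltW s0) _ e0 (window s s0 theta_s)).
    by rewrite -thrE; exact: energy_lt (ltW s0) s_thr.
  (* At the threshold T - t_u lies eventually between (thr / 2) sqrt u and 2 thr sqrt u. This
     separation is enough for asymptotic disjointness; the two probabilities are not compared with
     each other. *)
  - apply: (pi_queue_sum_equiv hX hc hT) => e e0.
    apply: (joint_negligible hX hc hAI hAII hx hT a2 thr0 e0).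
      by apply: window; rewrite ?mulr_gt0// hth lte_fin; lra.
    by apply: lower; rewrite hth lte_fin; lra.
  - have [s thr_s s_theta] := ereal_between hth.
    apply: (pi_queue_overflow_equiv hX hc hT) => e e0.
    apply: (level_negligible hX hc hAI hAII hx hT a2 (lt_trans thr0 thr_s) e0 _ (lower s s_theta)).
    by rewrite -thrE; exact: energy_lt (ltW thr0) thr_s.
apply: (pi_queue_overflow_equiv hX hc hT) => e e0.
(* omega > -oo provides T - t_u >= - C u^a for large u; for omega = +oo one may take C = 0. *)
have [C C0 hC] : exists2 C : R, 0 <= C & ((- C)%:E < omega)%E.
  case: omega homega {hT2} => [r _| _|//]; last by exists 0; rewrite ?oppr0 ?ltry.
  exists (`|r| + 1); first by rewrite addr_ge0.
  by rewrite lte_fin; have := ler_norm (- r); rewrite normrN; lra.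
apply: (level_negligible_long_memory hX hc hAI hAII hx hT a2 C0 e0).
have h := near_gt_of_ecvg hT2 hC; near=> u.
have u0 : 0 < u by near: u; exact: near_pinfty_gt.
have : - C < (T u - t_opt X c u) / u `^ alphainf by near: u.
by rewrite ltr_pdivlMr ?powR_gt0// mulNr => /ltW.
Unshelve. all: by end_near. Qed.
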